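(* Let $d\ge1$, $0<s<\min\{1,d/2\}$ and $2\le q<2^*=2d/(d-2s)$. Then there exists a constant $C'_{q,d,s}>0$ such that $$\|u\|_q^2\le C'_{q,d,s}\left(h_s[u]+\|u\|^2\right)\qquad\text{for all }u\in C_0^\infty(\mathbb{R}^d).$$
   Context: Here $\|\cdot\|_q$ is the norm of $L^q(\mathbb{R}^d)$, $\|\cdot\|=\|\cdot\|_2$, and $$h_s[u]=\int_{\mathbb{R}^d}|\xi|^{2s}|\hat u(\xi)|^2\,d\xi-\mathcal{C}_{s,d}\int_{\mathbb{R}^d}|x|^{-2s}|u(x)|^2\,dx,\qquad \mathcal{C}_{s,d}=2^{2s}\,\frac{\Gamma((d+2s)/4)^2}{\Gamma((d-2s)/4)^2},$$ with $\hat u(\xi)=(2\pi)^{-d/2}\int_{\mathbb{R}^d}u(x)e^{-i\xi\cdot x}\,dx$. *)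

(* Defs.v *)
From HB Require Import structures.
From mathcomp Require Import all_boot all_order all_algebra.
From mathcomp Require Import all_classical all_reals all_analysis.
From mathcomp Require Import complex.

Set Implicit Arguments.
Unset Strict Implicit.
Unset Printing Implicit Defensive.

Import Order.TTheory GRing.Theory Num.Theory.
Import numFieldNormedType.Exports.
Import ComplexField.Normc.

Local Open Scope classical_set_scope.
Local Open Scope ring_scope.

(* 'rV[T]_n carries the sigma-algebra generated by the coordinates (as the
   library does for n.-tuple T); for T = R this is the Borel sigma-algebra. *)
Definition measure_rV_display : measure_display -> measure_display.
Proof. exact. Qed.

Section measurable_rV.
Context {d : measure_display} {T : measurableType d} (n : nat).

Let coord (i : 'I_n) (x : 'rV[T]_n) : T := x ord0 i.

Let rV_set0 : g_sigma_preimage coord set0.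
Proof. exact: sigma_algebra0. Qed.

Let rV_setC A : g_sigma_preimage coord A -> g_sigma_preimage coord (~` A).
Proof. exact: sigma_algebraC. Qed.

Let rV_bigcup (F : (set 'rV[T]_n)^nat) :
  (forall i, g_sigma_preimage coord (F i)) ->
  g_sigma_preimage coord (\bigcup_i (F i)).
Proof. exact: sigma_algebra_bigcup. Qed.

HB.instance Definition _ := @isMeasurable.Build (measure_rV_display d)
  'rV[T]_n (g_sigma_preimage coord) rV_set0 rV_setC rV_bigcup.

End measurable_rV.

Lemma measurable_coord (d : measure_display) (T : measurableType d) (n : nat)
  (i : 'I_n) : measurable_fun [set: 'rV[T]_n] (fun x => x ord0 i).
Proof.
move=> _ Y mY; rewrite setTI; apply: sub_sigma_algebra.
rewrite -bigcup_seq /=; exists i; first by rewrite /= mem_index_enum.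
by exists Y => //; rewrite setTI.
Qed.

Lemma measurable_fun_rV (d1 d2 : measure_display) (T1 : measurableType d1)
  (T2 : measurableType d2) (n : nat) (f : T1 -> 'rV[T2]_n) :
  (forall i, measurable_fun setT (fun x => f x ord0 i)) ->
  measurable_fun setT f.
Proof.
move=> mf.
suff sub : <<s \big[setU/set0]_(i < n) preimage_set_system setT
    (fun x : 'rV[T2]_n => x ord0 i) measurable >> `<=`
    image_set_system setT f measurable.
  by move=> _ Y mY; exact: sub.
apply: smallest_sub.
  by apply: sigma_algebra_image; exact: sigma_algebra_measurable.
rewrite -bigcup_seq => A [i _] [B mB <-].
rewrite /image_set_system /= !setTI.
by have := mf i measurableT B mB; rewrite setTI; exact.
Qed.

Section lebesgue_rV_cons.
Context {R : realType} (n : nat).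

Definition cons_rV (p : measurableTypeR R * 'rV[R]_n) : 'rV[R]_n.+1 :=
  \row_i oapp (fun j => p.2 ord0 j) p.1 (unlift ord0 i).

Definition uncons_rV (x : 'rV[R]_n.+1) : measurableTypeR R * 'rV[R]_n :=
  (x ord0 ord0, \row_j x ord0 (lift ord0 j)).

Lemma cons_rVK : cancel cons_rV uncons_rV.
Proof.
case=> a x; rewrite /uncons_rV /cons_rV mxE unlift_none /=; congr pair.
by apply/rowP => j; rewrite !mxE liftK.
Qed.

Lemma measurable_cons_rV : measurable_fun setT cons_rV.
Proof.
apply: measurable_fun_rV => i; case: (unliftP ord0 i) => [j|] ->.
  rewrite (_ : (fun _ => _) = (fun x : 'rV[R]_n => x ord0 j) \o snd);
      last first.
    by apply/funext => p; rewrite mxE liftK.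
  by apply: measurableT_comp => //; exact: measurable_coord.
rewrite (_ : (fun _ => _) = fst) //.
by apply/funext => p; rewrite mxE unlift_none.
Qed.

Lemma measurable_uncons_rV : measurable_fun setT uncons_rV.
Proof.
apply/measurable_fun_pairP; split; first exact: measurable_coord.
apply: measurable_fun_rV => j.
rewrite (_ : (fun _ => _) = (fun x : 'rV[R]_n.+1 => x ord0 (lift ord0 j))).
  exact: measurable_coord.
by apply/funext => x; rewrite /= mxE.
Qed.

Variable mu : {sigma_finite_measure set 'rV[R]_n -> \bar R}.

Definition lebesgue_rV_cons : set 'rV[R]_n.+1 -> \bar R :=
  pushforward (lebesgue_measure \x mu)%E cons_rV.

Let mcons (A : set 'rV[R]_n.+1) : measurable A ->
  measurable (cons_rV @^-1` A).
Proof.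
by move=> mA; rewrite -[X in measurable X]setTI; exact: measurable_cons_rV.
Qed.

Let lebesgue_rV_cons0 : lebesgue_rV_cons set0 = 0%E.
Proof. by rewrite /lebesgue_rV_cons /pushforward preimage_set0 measure0. Qed.

Let lebesgue_rV_cons_ge0 A : (0 <= lebesgue_rV_cons A)%E.
Proof. exact: (measure_ge0 (lebesgue_measure \x mu)%E). Qed.

Let lebesgue_rV_cons_sigma_additive : semi_sigma_additive lebesgue_rV_cons.
Proof.
move=> F mF tF mUF; rewrite /lebesgue_rV_cons /pushforward preimage_bigcup.
apply: measure_semi_sigma_additive.
- by move=> k; exact: mcons.
- apply/trivIsetP => /= i j _ _ ij; rewrite -preimage_setI.
  by move/trivIsetP : tF => /(_ _ _ _ _ ij) ->//; rewrite preimage_set0.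
- by rewrite -preimage_bigcup; exact: mcons.
Qed.

HB.instance Definition _ := isMeasure.Build _ _ _ lebesgue_rV_cons
  lebesgue_rV_cons0 lebesgue_rV_cons_ge0 lebesgue_rV_cons_sigma_additive.

Let lebesgue_rV_cons_sigma_finite : sigma_finite setT lebesgue_rV_cons.
Proof.
have /sigma_finiteP[F [FT ndF Ffin]] := sigma_finiteT (@lebesgue_measure R).
have /sigma_finiteP[G [GT ndG Gfin]] := sigma_finiteT mu.
exists (fun k => uncons_rV @^-1` (F k `*` G k)).
  rewrite -preimage_bigcup (_ : \bigcup_k _ = setT) ?preimage_setT//.
  rewrite -setXTT FT GT predeqE => -[x y]; split.
    by move=> [k _ []/= ? ?]; split; exists k.
  move=> [/= [k _ Fkx] [l _ Gly]]; exists (maxn k l) => //; split.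
  - by move: x Fkx; exact/subsetPset/ndF/leq_maxl.
  - by move: y Gly; exact/subsetPset/ndG/leq_maxr.
move=> k; have [mF Fk] := Ffin k; have [mG Gk] := Gfin k; split.
  rewrite -[X in measurable X]setTI.
  by apply: measurable_uncons_rV => //; exact: measurableX.
rewrite /lebesgue_rV_cons /pushforward -comp_preimage (_ : _ \o _ = id).
  rewrite preimage_id product_measure1E// lte_mul_pinfty// ge0_fin_numE//.
by apply/funext => p /=; rewrite cons_rVK.
Qed.

HB.instance Definition _ := Measure_isSigmaFinite.Build _ _ _
  lebesgue_rV_cons lebesgue_rV_cons_sigma_finite.

End lebesgue_rV_cons.

(* n-dimensional Lebesgue measure, the n-fold product of lebesgue_measure;
   lebesgue_rV_box below gives its values on boxes, which determine it. *)
Fixpoint lebesgue_rV {R : realType} (n : nat) :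
    {sigma_finite_measure set 'rV[R]_n -> \bar R} :=
  if n is m.+1 then lebesgue_rV_cons (lebesgue_rV m) else dirac (0 : 'rV[R]_0).

Lemma lebesgue_rV_box {R : realType} (n : nat) (A : 'I_n -> set R) :
  (forall i, measurable (A i)) ->
  lebesgue_rV n [set x | forall i, A i (x ord0 i)] =
  (\prod_(i < n) lebesgue_measure (A i))%E.
Proof.
elim: n A => [|n IHn] A mA.
  by rewrite big_ord0 /= diracE mem_set// => -[].
pose B := [set x : 'rV[R]_n | forall i : 'I_n, A (lift ord0 i) (x ord0 i)].
have consE : @cons_rV R n @^-1` [set x | forall i, A i (x ord0 i)] =
    A ord0 `*` B.
  apply/seteqP; split => [[a x] /= Ax|[a x] /= [Aa Ax] i].
    split; first by have := Ax ord0; rewrite mxE unlift_none.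
    by move=> i; have := Ax (lift ord0 i); rewrite mxE liftK.
  by case: (unliftP ord0 i) => [j|] ->;
    rewrite mxE ?liftK ?unlift_none//; exact: Ax.
have mB : measurable B.
  rewrite (_ : B = \bigcap_(i in setT) [set x | A (lift ord0 i) (x ord0 i)]).
    apply: fin_bigcap_measurable => // i _.
    rewrite -[X in measurable X]setTI.
    exact: (measurable_coord i measurableT (mA _)).
  by apply/seteqP; split => [x Bx i _|x Bx i]; exact: Bx.
rewrite big_ord_recl -(IHn (fun i => A (lift ord0 i))) //.
transitivity ((lebesgue_measure \x lebesgue_rV n)%E
  (@cons_rV R n @^-1` [set x | forall i, A i (x ord0 i)])) => //.
by rewrite consE product_measure1E//; exact: mA.
Qed.

Section smooth_functions.
Context {R : realType} {d : nat}.

Definition iter_partial (l : seq 'I_d) (f : 'rV[R]_d -> R) : 'rV[R]_d -> R :=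
  foldr (fun i g x => 'D_(delta_mx ord0 i) g x) f l.

Definition smooth (f : 'rV[R]_d -> R) : Prop := forall l : seq 'I_d,
  continuous (iter_partial l f) /\
  forall i x, derivable (iter_partial l f) x (delta_mx ord0 i).

(* Test functions are complex-valued. R[i] has no normed R-module structure in
   the library, hence smoothness is stated on real and imaginary parts. *)
Definition C0infty (u : 'rV[R]_d -> R[i]) : Prop :=
  [/\ smooth (fun x => complex.Re (u x)), smooth (fun x => complex.Im (u x))
    & compact (closure [set x | u x != 0])].

End smooth_functions.

(* The library's norm `|x| on 'rV[R]_d is the sup norm. *)
Definition enorm {R : realType} {d : nat} (x : 'rV[R]_d) : R :=
  Num.sqrt (\sum_(i < d) x ord0 i ^+ 2).

Definition dotp {R : realType} {d : nat} (x y : 'rV[R]_d) : R :=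
  \sum_(i < d) x ord0 i * y ord0 i.

Definition expi {R : realType} (t : R) : R[i] := (cos t +i* sin t)%C.

Definition Cintegral {R : realType} {d : nat} (f : 'rV[R]_d -> R[i]) : R[i] :=
  ((\int[lebesgue_rV d]_x complex.Re (f x)) +i*
   (\int[lebesgue_rV d]_x complex.Im (f x)))%C.

Definition fourier {R : realType} {d : nat} (u : 'rV[R]_d -> R[i])
    (xi : 'rV[R]_d) : R[i] :=
  ((2 * pi) `^ (- (d%:R / 2)))%:C%C *
  Cintegral (fun x => u x * expi (- dotp xi x)).

(* Euler's integral, used below only for a > 0. *)
Definition Gamma {R : realType} (a : R) : R :=
  \int[lebesgue_measure]_(t in `]0, +oo[) (t `^ (a - 1) * expR (- t)).

Definition hardy_const {R : realType} (d : nat) (s : R) : R :=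
  2 `^ (2 * s) * (Gamma ((d%:R + 2 * s) / 4) ^+ 2
                  / Gamma ((d%:R - 2 * s) / 4) ^+ 2).

Definition Lqnorm {R : realType} {d : nat} (q : R) (u : 'rV[R]_d -> R[i])
    : \bar R :=
  'N[lebesgue_rV d]_(q%:E)[EFin \o (@normc R) \o u].

(* Both integrals are kept in \bar R, so that no convention on divergent
   integrals enters; they are finite for u in C_0^infty when 0 < s < d/2.
   The value 0 `^ (- (2 * s)) = 0 at the origin concerns a null set. *)
Definition hardy_form {R : realType} {d : nat} (s : R)
    (u : 'rV[R]_d -> R[i]) : \bar R :=
  (\int[lebesgue_rV d]_xi (enorm xi `^ (2 * s) * normc (fourier u xi) ^+ 2)%:E
   - (hardy_const d s)%:E *
     \int[lebesgue_rV d]_x (enorm x `^ (- (2 * s)) * normc (u x) ^+ 2)%:E)%E.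

(* Main.v *)
Require Import Defs.
From mathcomp Require Import all_boot all_order all_algebra.
From mathcomp Require Import all_classical all_reals all_analysis.
From mathcomp Require Import measurable_realfun complex ring lra.

(* Let p_r denote the heat kernel. Since |x|^(-2s) is an average of Gaussians,
   a Schur test in Fourier space shows that if h > 0 and
     \int_0^oo \int t^(s-1) h(y) p_t(y - xi) dy dt <= Gamma(s) th(xi) h(xi),
   then \int |x|^(-2s) |u|^2 dx <= \int th |\hat u|^2 dxi. Take h to be the
   mixture \int w(r) p_r dr. For w(r) = r^(b-1) everything is explicit and
   th = L(b) |xi|^(2s); the choice b0 = (d - 2s) / 4 gives L(b0) = 1 / C_{s,d},
   hence h_s >= 0. By strict log-convexity of the Beta function L(b1) > L(b0)
   when 0 < b1 < b0, so that the weight r^(b0-1) - r^(b1-1), cut off to r > 1,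
   yields the better th = |xi|^(2s) / C_{s,d} + M - K |xi|^(2t) with
   t = s - (b0 - b1), which can be any number slightly below s. Together with
   Plancherel this bounds \int (1 + |xi|^2)^t |\hat u|^2 by h_s[u] + |u|^2.
   The embedding of H^t into L^q then follows by duality with |u|^(q-2) u,
   (1 + |xi|^2)^(-t) being bounded by an average of Gaussians exp(-r |xi|^2),
   r <= 1. Every use of Parseval's formula is regularized by a Gaussian, so
   only continuity and compact support of u are needed. *)

Set Implicit Arguments.
Unset Strict Implicit.
Unset Printing Implicit Defensive.

Import Order.TTheory GRing.Theory Num.Theory.
Import numFieldNormedType.Exports.

Local Open Scope classical_set_scope.
Local Open Scope ring_scope.

(** * Power integrals, the Gamma and Beta functions *)

Section lebesgue_change.
Context {R : realType}.
Local Notation mu := (@lebesgue_measure R).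

(** In frequency space the two terms of h_s trade roles: |xi|^(2s) is a multiplication, and
    |x|^(-2s) becomes an integral operator with positive kernel, formally (-Laplacian)^(-s).
    Positivity lets the phases of the transform be dropped, and a positive h certifies that such an
    operator is bounded by multiplication by th. Heat kernels are chosen since the semigroup law
    reduces the condition on h to Euler integrals in one variable. Subtracting the mixture of
    exponent b1 lowers h by a fraction of order |xi|^(-2(b0 - b1)), but lowers its image by L(b1) /
    L(b0) times that fraction; the excess is the term K |xi|^(2t). This works only at high
    frequency. Low frequencies are paid for by the constant M, that is by the mass |u|^2. Moreover t
    stays below s: t = s would force b1 = b0, where the gain L(b1) - L(b0) vanishes. What must
    remain is t > d (1/2 - 1/q), the critical regularity for L^q, and q < 2d / (d - 2s) says exactly
    that this number is below s. *)

Lemma ge0_integral_affine (a b : R) (f : R -> \bar R) : 0 < a ->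
  measurable_fun [set: R] f -> (forall x, 0 <= f x)%E ->
  (\int[mu]_x f x = a%:E * \int[mu]_x f (a * x + b)%R)%E.
Proof.
move=> a0 mf f0.
pose phi : measurableTypeR R -> measurableTypeR R := fun x => a * x + b.
have mphi : measurable_fun setT phi.
  by apply: measurable_funD => //; apply: measurable_funM.
have := @ge0_integral_pushforward _ _ _ _ R phi mphi mu [set: R] f measurableT mf.
rewrite preimage_setT => /(_ (fun y _ => f0 y)) /= <-.
pose c : {nonneg R} := NngNum (ltW a0).
rewrite (_ : a%:E = c%:num%:E)// -ge0_integral_mscale//.
apply: eq_measure_integral => A mA _.
(* Uniqueness of Lebesgue measure: the rescaled image measure has the right value on half-open
   intervals. *)
apply: (@lebesgue_measure_unique R (mscale c (pushforward mu phi))) => // X.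
move=> [[p q]] _ <-.
change (mu `]p, q] = a%:E * mu (phi @^-1` `]p, q]))%E.
rewrite (_ : phi @^-1` _ = `](p - b) / a, (q - b) / a]%classic); last first.
  apply/seteqP; split => x /=; rewrite !in_itv/=.
    by rewrite ltr_pdivrMr// ler_pdivlMr// ltrBlDr lerBrDr mulrC.
  by rewrite ltr_pdivrMr// ler_pdivlMr// ltrBlDr lerBrDr mulrC.
rewrite !lebesgue_measure_itv/= !lte_fin ltr_pdivrMr// divfK ?gt_eqF// ltrD2r.
case: ifPn => // _; last by rewrite mule0.
by rewrite -!EFinB -EFinM; congr EFin; field; rewrite gt_eqF.
Qed.

Lemma ge0_integral_opp (f : R -> \bar R) : measurable_fun [set: R] f ->
  (forall x, 0 <= f x)%E -> (\int[mu]_x f (- x)%R = \int[mu]_x f x)%E.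
Proof.
move=> mf f0.
have := @ge0_integral_pushforward _ _ _ _ R
  (-%R : measurableTypeR R -> measurableTypeR R).
move=> /(_ (@oppr_measurable R setT) mu setT f measurableT mf).
rewrite preimage_setT => <- //.
by apply: eq_measure_integral => A mA _; exact: lebesgue_measureN.
Qed.

Lemma ge0_integral_shift (f : R -> \bar R) (c : R) : measurable_fun [set: R] f ->
  (forall x, 0 <= f x)%E -> (\int[mu]_x f (x + c)%R = \int[mu]_x f x)%E.
Proof.
move=> mf f0; rewrite (ge0_integral_affine c ltr01 mf f0) mul1e.
by apply: eq_integral => x _; rewrite mul1r.
Qed.

End lebesgue_change.

(* The cutoff is needed because [t `^ a] is [1] for [t < 0]. *)
Definition pw {R : realType} (a t : R) : R := if 0 < t then t `^ (a - 1) else 0.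

Section power_integrals.
Context {R : realType}.
Local Notation mu := (@lebesgue_measure R).
Implicit Types a b c t x : R.

Lemma pw_ge0 a t : 0 <= pw a t.
Proof. by rewrite /pw; case: ifPn => // _; exact: powR_ge0. Qed.

Lemma pw_gt0 a t : 0 < t -> 0 < pw a t.
Proof. by move=> t0; rewrite /pw t0; exact: powR_gt0. Qed.

Lemma measurable_pw a : measurable_fun [set: R] (pw a).
Proof.
rewrite /pw; apply: measurable_fun_ifT => //.
  by apply: measurable_fun_ltr.
Qed.

Lemma pwM a t x : 0 < t -> pw a (t * x) = t `^ (a - 1) * pw a x.
Proof.
move=> t0; rewrite /pw pmulr_rgt0//; case: ifPn => x0; last by rewrite mulr0.
by rewrite powRM// ltW.
Qed.

Lemma pwD a c t : 0 < t -> pw (a + c) t = pw a t * t `^ c.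
Proof.
move=> t0; have tn : t != 0 by rewrite gt_eqF.
by rewrite /pw t0 -powRD ?tn ?implybT// addrAC.
Qed.

Lemma cvg_powR_harmonic c : 0 < c ->
  (harmonic i.+1 : R) `^ c @[i --> \oo] --> (0 : R).
Proof.
move=> c0; have /cvg_at_rightP := powR_cvg0 c0; apply; split.
  by move=> n; exact: harmonic_gt0.
by rewrite (@cvg_shiftS R (@harmonic R)); exact: cvg_harmonic.
Qed.

Lemma integral_powR_cc a b c : c != 0 -> 0 < a < b ->
  (\int[mu]_(t in `[a, b]) (t `^ (c - 1))%:E = ((b `^ c - a `^ c) / c)%:E)%E.
Proof.
move=> c0 /andP[a0 ab].
have D (t : R) : 0 < t -> is_derive t 1 (fun t => t `^ c / c) (t `^ (c - 1)).
  move=> t0; have dp := is_derive1_powR c t0.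
  have -> : t `^ (c - 1) = c^-1 *: (c * t `^ (c - 1)).
    by rewrite /GRing.scale/= mulKf.
  have -> : (fun t : R => t `^ c / c) = c^-1 *: (fun t : R => t `^ c).
    by apply/funext => y; rewrite mulrC.
  exact: is_deriveZ.
have D' (t : R) : 0 < t -> {for t, continuous (fun t : R => t `^ c / c)}.
  move=> t0; apply: differentiable_continuous; apply/derivable1_diffP.
  exact: (@ex_derive _ _ _ _ _ _ _ (D t t0)).
rewrite (@continuous_FTC2 _ _ (fun t => t `^ c / c))//.
- by rewrite -EFinB mulrBl.
- apply: derivable_within_continuous => t; rewrite in_itv/= => /andP[ta _].
  by apply: derivable_powR; rewrite in_itv/= andbT (lt_le_trans a0).
- split.
  + move=> t; rewrite in_itv/= => /andP[ta _].
    exact: (@ex_derive _ _ _ _ _ _ _ (D t (lt_trans a0 ta))).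
  + by apply: cvg_at_right_filter; exact: D'.
  + by apply: cvg_at_left_filter; apply: D'; exact: lt_trans ab.
- move=> t; rewrite in_itv/= => /andP[ta _]; rewrite derive1E.
  exact: (@derive_val _ _ _ _ _ _ _ (D t (lt_trans a0 ta))).
Qed.

Lemma integral_powR_0c c x : 0 < c -> 0 < x ->
  (\int[mu]_(t in `]0%R, x]) (t `^ (c - 1))%:E = (x `^ c / c)%:E)%E.
Proof.
move=> c0 x0.
(* The shift in [harmonic n.+1] keeps the left end strictly below [x]; with [harmonic 0 = 1] the
   interval would be degenerate. *)
pose F n := `[x * harmonic n.+1, x]%classic : set R.
have U : \bigcup_n F n = `]0, x]%classic.
  apply/seteqP; split => t.
    move=> [n _]; rewrite /F/= !in_itv/= => /andP[+ ->]; rewrite andbT.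
    by apply: lt_le_trans; rewrite mulr_gt0// harmonic_gt0.
  rewrite /= in_itv/= => /andP[t0 tx].
  have /cvgrPdist_lt/(_ (t / x)) := @cvg_harmonic R.
  rewrite divr_gt0// => /(_ isT)[n _ /(_ n.+1 (leqnSn n))].
  rewrite sub0r normrN ger0_norm ?harmonic_ge0// => h; exists n => //.
  by rewrite /F/= in_itv/= tx andbT mulrC -ler_pdivlMr// ltW.
have nd : nondecreasing_seq F.
  move=> m n mn; rewrite subsetEset /F; apply: subset_itvr.
  rewrite bnd_simp; apply: ler_wpM2l; first exact: ltW.
  by rewrite /= lef_pV2 ?posrE ?ltr0n// ler_nat.
have mF n : measurable_fun (F n) (fun t : R => (t `^ (c - 1))%:E).
  by apply: measurable_funTS; apply/measurable_EFinP; exact: measurable_powR.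
have := @ge0_nondecreasing_set_cvg_integral _ (measurableTypeR R) R F _ mu nd
  (fun=> measurable_itv _) mF (fun n t _ => powR_ge0 t (c - 1)).
rewrite U => /cvg_unique; apply; first exact: ereal_hausdorff.
have : (x `^ c / c) * (1 - harmonic n.+1 `^ c) @[n --> \oo] --> x `^ c / c * (1 - 0).
  by apply: cvgMr; apply: cvgB; [exact: cvg_cst|exact: cvg_powR_harmonic].
rewrite subr0 mulr1 => h.
have {h} : ((x `^ c / c) * (1 - harmonic n.+1 `^ c))%:E @[n --> \oo] --> (x `^ c / c)%:E.
  by apply: cvg_EFin h; exact: nearW.
apply: cvg_trans; apply: near_eq_cvg; apply: nearW => n /=.
rewrite integral_powR_cc ?gt_eqF// ?mulr_gt0 ?harmonic_gt0//=.
  by rewrite powRM ?harmonic_ge0// ?ltW//; congr EFin; ring.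
by rewrite gtr_pMr// invf_lt1// ltr1n.
Qed.

Lemma integral_powR_cy c x : c < 0 -> 0 < x ->
  (\int[mu]_(t in `[x, +oo[) (t `^ (c - 1))%:E = (- (x `^ c / c))%:E)%E.
Proof.
move=> c0 x0.
pose F n := `[x, x * n.+2%:R]%classic : set R.
have U : \bigcup_n F n = `[x, +oo[%classic.
  apply/seteqP; split => t.
    by move=> [n _]; rewrite /F/= !in_itv/= andbT => /andP[].
  rewrite /= in_itv/= andbT => tx.
  exists (Num.truncn (t / x)) => //; rewrite /F/= in_itv/= tx/= mulrC -ler_pdivrMr//.
  by rewrite ltW// (lt_trans (truncnS_gt _))// ltr_nat.
have nd : nondecreasing_seq F.
  move=> m n mn; rewrite subsetEset /F; apply: subset_itvl.
  by rewrite bnd_simp; apply: ler_wpM2l; [exact: ltW|rewrite ler_nat].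
have mF n : measurable_fun (F n) (fun t : R => (t `^ (c - 1))%:E).
  by apply: measurable_funTS; apply/measurable_EFinP; exact: measurable_powR.
have := @ge0_nondecreasing_set_cvg_integral _ (measurableTypeR R) R F _ mu nd
  (fun=> measurable_itv _) mF (fun n t _ => powR_ge0 t (c - 1)).
rewrite U => /cvg_unique; apply; first exact: ereal_hausdorff.
have : (- (x `^ c / c)) * (1 - harmonic n.+1 `^ (- c)) @[n --> \oo] --> - (x `^ c / c) * (1 - 0).
  by apply: cvgMr; apply: cvgB; [exact: cvg_cst|apply: cvg_powR_harmonic; rewrite oppr_gt0].
rewrite subr0 mulr1 => h.
have {h} : (- (x `^ c / c) * (1 - harmonic n.+1 `^ (- c)))%:E @[n --> \oo] --> (- (x `^ c / c))%:E.
  by apply: cvg_EFin h; exact: nearW.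
apply: cvg_trans; apply: near_eq_cvg; apply: nearW => n /=.
rewrite integral_powR_cc ?lt_eqF// ?x0/=; last by rewrite ltr_pMr// ltr1n.
rewrite powRM ?ltW//; congr EFin.
have -> : (harmonic n.+1 : R) `^ (- c) = n.+2%:R `^ c.
  by rewrite /= -powR_inv1// -powRrM mulN1r opprK.
by ring.
Qed.


(** The bound of integration is an indicator factor on the whole line, so that iterated integrals
    fall directly under Tonelli's theorem. Both sides vanish for [x <= 0]. *)
Lemma integral_pw_le c x : 0 < c ->
  (\int[mu]_t (pw c t * (t <= x)%R%:R)%:E = (pw (c + 1) x / c)%:E)%E.
Proof.
move=> c0; case: (ltP 0 x) => x0; last first.
  rewrite {2}/pw ltNge x0/= mul0r integral0_eq// => t _; rewrite /pw.
  by case: ltP => t0; rewrite ?mul0r//= leNgt (le_lt_trans x0 t0) mulr0.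
rewrite {2}/pw x0 addrK -integral_powR_0c// [RHS]integral_mkcond.
apply: eq_integral => t _; rewrite patchE; case: ifPn.
  by rewrite inE/= in_itv/= /pw => /andP[-> ->]; rewrite mulr1.
rewrite notin_setE/= in_itv/= /pw => /negP; rewrite negb_and => /orP[/negPf ->|/negPf ->].
  by rewrite mul0r.
by rewrite mulr0.
Qed.

Lemma integral_powR_ge c x : c < 0 -> 0 < x ->
  (\int[mu]_t (t `^ (c - 1) * (x <= t)%R%:R)%:E = (- (x `^ c / c))%:E)%E.
Proof.
move=> c0 x0; rewrite -integral_powR_cy// [RHS]integral_mkcond.
apply: eq_integral => t _; rewrite patchE; case: ifPn.
  by rewrite inE/= in_itv/= andbT => ->; rewrite mulr1.
by rewrite notin_setE/= in_itv/= andbT => /negP/negPf ->; rewrite mulr0.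
Qed.

(** Writing [expR (- x)] as a tail integral turns integration by parts ([gamS]) and the substitution
    t -> 1/t ([integral_pw_expRV]) into Tonelli exchanges. *)
Lemma integral_expR_ge x :
  (\int[mu]_t (expR (- t) * (x <= t)%R%:R)%:E = (expR (- x))%:E)%E.
Proof.
have ce : continuous (fun t : R => expR (- t)).
  move=> t; apply: continuous_comp; last exact: continuous_expR.
  exact: opp_continuous.
have D (t : R) : is_derive t 1 (fun t => - expR (- t)) (expR (- t)).
  have D1 : is_derive t 1 (expR \o -%R) (expR (- t) * -1).
    exact: is_derive1_comp.
  by have := is_deriveN D1; rewrite mulrN1 opprK.
transitivity (\int[mu]_(t in `[x, +oo[) (expR (- t))%:E)%E.
  rewrite [RHS]integral_mkcond.
  apply: eq_integral => t _; rewrite patchE; case: ifPn.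
    by rewrite inE/= in_itv/= andbT => ->; rewrite mulr1.
  by rewrite notin_setE/= in_itv/= andbT => /negP/negPf ->; rewrite mulr0.
rewrite (@ge0_continuous_FTC2y _ _ (fun t => - expR (- t)) _ 0).
- by rewrite sub0e -EFinN opprK.
- by move=> t _; exact: expR_ge0.
- by apply: continuous_subspaceT => t; exact: ce.
- by rewrite -oppr0; apply: cvgN; exact: cvgr_expR.
- by move=> t _; exact: (@ex_derive _ _ _ _ _ _ _ (D t)).
- by apply: cvg_at_right_filter; apply: cvgN; exact: ce.
- by move=> t _; rewrite derive1E (@derive_val _ _ _ _ _ _ _ (D t)).
Qed.

End power_integrals.

(** * Tonelli's theorem and linearity for integrals of nonnegative real functions *)

Lemma tonelli (d1 d2 : measure_display) (T1 : measurableType d1)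
    (T2 : measurableType d2) (R : realType)
    (m1 : {sigma_finite_measure set T1 -> \bar R})
    (m2 : {sigma_finite_measure set T2 -> \bar R}) (f : T1 -> T2 -> R) :
  measurable_fun [set: T1 * T2] (fun p => f p.1 p.2) ->
  (forall x y, 0 <= f x y) ->
  (\int[m1]_x \int[m2]_y (f x y)%:E = \int[m2]_y \int[m1]_x (f x y)%:E)%E.
Proof.
move=> mf f0.
by apply: (@fubini_tonelli _ _ _ _ _ m1 m2 (fun p => (f p.1 p.2)%:E)) => [|p];
  [exact/measurable_EFinP|by rewrite lee_fin].
Qed.

Lemma measurable_integral_fst (d1 d2 : measure_display) (T1 : measurableType d1)
    (T2 : measurableType d2) (R : realType)
    (m1 : {sigma_finite_measure set T1 -> \bar R}) (f : T1 -> T2 -> R) :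
  measurable_fun [set: T1 * T2] (fun p => f p.1 p.2) ->
  (forall x y, 0 <= f x y) ->
  measurable_fun setT (fun y => \int[m1]_x (f x y)%:E)%E.
Proof.
move=> mf f0.
apply: (@measurable_fun_fubini_tonelli_G _ _ _ _ _ m1 (fun p => (f p.1 p.2)%:E)) => [|p];
  [exact/measurable_EFinP|by rewrite lee_fin].
Qed.

Lemma measurable_integral_snd (d1 d2 : measure_display) (T1 : measurableType d1)
    (T2 : measurableType d2) (R : realType)
    (m2 : {sigma_finite_measure set T2 -> \bar R}) (f : T1 -> T2 -> R) :
  measurable_fun [set: T1 * T2] (fun p => f p.1 p.2) ->
  (forall x y, 0 <= f x y) ->
  measurable_fun setT (fun x => \int[m2]_y (f x y)%:E)%E.
Proof.
move=> mf f0.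
apply: (@measurable_fun_fubini_tonelli_F _ _ _ _ _ m2 (fun p => (f p.1 p.2)%:E)) => [|p];
  [exact/measurable_EFinP|by rewrite lee_fin].
Qed.

Lemma ge0_RZl (d : measure_display) (T : measurableType d) (R : realType)
    (m : {measure set T -> \bar R}) (k : R) (f : T -> R) :
  measurable_fun setT f -> (forall x, 0 <= f x) -> 0 <= k ->
  (\int[m]_x (k * f x)%:E = k%:E * \int[m]_x (f x)%:E)%E.
Proof.
move=> mf f0 k0; under eq_integral do rewrite EFinM.
by rewrite ge0_integralZl_EFin//; [move=> x _; rewrite lee_fin|exact/measurable_EFinP].
Qed.

Lemma measurable_ler_nat (d : measure_display) (T : measurableType d)
    (R : realType) (f g : T -> R) :
  measurable_fun setT f -> measurable_fun setT g ->
  measurable_fun setT (fun x => (f x <= g x)%R%:R : R).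
Proof.
move=> mf mg.
rewrite (_ : (fun _ => _) = (fun x => if f x <= g x then 1 else 0)); last first.
  by apply/funext => x; case: (_ <= _).
by apply: measurable_fun_ifT => //; exact: measurable_fun_ler.
Qed.

Lemma integral_gt0 (d : measure_display) (T : measurableType d) (R : realType)
    (m : {measure set T -> \bar R}) (f : T -> R) (A : set T) :
  measurable_fun setT f -> (forall x, 0 <= f x) -> measurable A -> m A != 0 ->
  (forall x, A x -> 0 < f x) -> (0 < \int[m]_x (f x)%:E)%E.
Proof.
move=> mf f0 mA mA0 fA; rewrite lt_neqAle integral_ge0 ?andbT; last first.
  by move=> x _; rewrite lee_fin.
apply: contra_neq mA0 => /esym I0.
have : (\int[m]_x `|(f x)%:E| = 0)%E.
  by under eq_integral do rewrite gee0_abs ?lee_fin//.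
have mEf : measurable_fun setT (fun x => (f x)%:E) by exact/measurable_EFinP.
move/(ae_eq_integral_abs m measurableT mEf) => [N [mN N0 sN]]; apply: (subset_measure0 mA mN _ N0) => x Ax.
by apply: sN => /= /(_ I)[] /eqP; rewrite gt_eqF// fA.
Qed.

Lemma measurable_invr (R : realType) : measurable_fun [set: R] (fun x => x^-1).
Proof.
rewrite (_ : (fun _ => _) =
    (fun x : R => if 0 <= x then x `^ (-1) else - ((- x) `^ (-1)))); last first.
  apply/funext => x; case: leP => x0; first by rewrite powR_inv1.
  by rewrite powR_inv1 ?oppr_ge0 ?ltW// invrN opprK.
apply: measurable_fun_ifT.
- exact: measurable_fun_ler.
- exact: measurable_powR.
- apply: measurable_funN.
  by apply: (measurableT_comp (measurable_powR _)); exact: oppr_measurable.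
Qed.

(** * Euler's integrals: recursion, finiteness, convolution of powers, strict log-convexity *)

Section gamma.
Context {R : realType}.
Local Notation mu := (@lebesgue_measure R).
Implicit Types a b c t x : R.

Let gam a := (\int[mu]_t (pw a t * expR (- t))%:E)%E.

Let measurable_expN : measurable_fun [set: R] (fun t => expR (- t)).
Proof. by apply: measurableT_comp => //; exact: oppr_measurable. Qed.

Let gam_ge0 a : (0 <= gam a)%E.
Proof. by apply: integral_ge0 => t _; rewrite lee_fin mulr_ge0 ?pw_ge0 ?expR_ge0. Qed.

(** With the exponential unfolded into a tail integral, the inner integral after the exchange is
    that of [pw c] up to [x]. The identity holds in the extended reals, hence it may be used to
    prove finiteness. *)
Let gamS c : 0 < c -> (gam (c + 1) = c%:E * gam c)%E.
Proof.
move=> c0.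
have m1 : measurable_fun [set: R * R]
    (fun p => pw c p.1 * (expR (- p.2) * (p.1 <= p.2)%R%:R)).
  apply: measurable_funM.
    by apply: measurableT_comp => //; exact: measurable_pw.
  apply: measurable_funM; last exact: measurable_ler_nat.
  exact: (measurableT_comp measurable_expN).
have -> : gam c = (\int[mu]_t \int[mu]_x (pw c t * (expR (- x) * (t <= x)%R%:R))%:E)%E.
  apply: eq_integral => t _; rewrite ge0_RZl ?pw_ge0//; last first.
    by apply: measurable_funM => //; exact: measurable_ler_nat.
  by rewrite integral_expR_ge -EFinM.
rewrite (@tonelli _ _ _ _ R mu mu (fun t x => pw c t * (expR (- x) * (t <= x)%R%:R)) m1); last first.
  by move=> t x; rewrite !mulr_ge0 ?pw_ge0 ?expR_ge0.
rewrite -ge0_integralZl_EFin ?(ltW c0)//; last 2 first.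
- by move=> x _; apply: integral_ge0 => t _; rewrite lee_fin !mulr_ge0 ?pw_ge0 ?expR_ge0.
- apply: (measurable_integral_fst mu m1) => t x.
  by rewrite !mulr_ge0 ?pw_ge0 ?expR_ge0.
apply: eq_integral => x _.
under eq_integral do rewrite mulrCA.
rewrite ge0_RZl ?expR_ge0//; last 2 first.
- by apply: measurable_funM => //; [exact: measurable_pw|exact: measurable_ler_nat].
- by move=> t; rewrite mulr_ge0 ?pw_ge0.
rewrite integral_pw_le// -!EFinM; congr EFin; field.
by rewrite gt_eqF.
Qed.

(** Up to 1 the exponential is dropped and the power is integrable; beyond 1 the exponent is raised
    to the integer [n.+1], where finiteness follows by induction from [gam 1] through [gamS]. *)
Let gam_fin a : 0 < a -> (gam a < +oo)%E.
Proof.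
have gam1 : (gam 1 < +oo)%E.
  apply: (@le_lt_trans _ _ (\int[mu]_t (expR (- t) * (0 <= t)%R%:R)%:E)%E).
    apply: ge0_le_integral => //.
    - by move=> t _; rewrite lee_fin mulr_ge0 ?pw_ge0 ?expR_ge0.
    - by apply/measurable_EFinP/measurable_funM => //; exact: measurable_pw.
    - by apply/measurable_EFinP/measurable_funM => //; exact: measurable_ler_nat.
    - move=> t _; rewrite lee_fin /pw subrr powRr0; case: ltP => t0.
        by rewrite mul1r (ltW t0) mulr1.
      by rewrite mul0r mulr_ge0 ?expR_ge0.
  by rewrite integral_expR_ge ltry.
have gamn n : (gam n.+1%:R < +oo)%E.
  elim: n => [|n ih]; first exact: gam1.
  rewrite -natr1 gamS ?ltr0n//.
  by apply: lte_mul_pinfty; [rewrite lee_fin ler0n|by []|exact: ih].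
move=> a0; pose n := (Num.truncn a).+1.
have an : a <= n%:R by rewrite ltW// truncnS_gt.
apply: (@le_lt_trans _ _ (\int[mu]_t ((pw a t * (t <= 1)%R%:R)%:E +
    (pw n.+1%:R t * expR (- t))%:E))%E).
  apply: ge0_le_integral => //.
  - by move=> t _; rewrite lee_fin mulr_ge0 ?pw_ge0 ?expR_ge0.
  - by apply/measurable_EFinP/measurable_funM => //; exact: measurable_pw.
  - apply: emeasurable_funD; apply/measurable_EFinP/measurable_funM => //; first exact: measurable_pw.
      exact: measurable_ler_nat.
    exact: measurable_pw.
  - move=> t _; rewrite -EFinD lee_fin /pw; case: (ltP 0 t) => t0; last by rewrite !mul0r addr0.
    case: (leP t 1) => t1.
      rewrite mulr1 -[leLHS]addr0 lerD ?mulr_ge0 ?powR_ge0 ?expR_ge0//.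
      by rewrite ler_piMr ?powR_ge0// -expR0 ler_expR oppr_le0 ltW.
    rewrite mulr0 add0r ler_wpM2r ?expR_ge0//; apply: ler_powR; first exact: ltW.
    rewrite lerD2r (le_trans an)// ler_nat//.
rewrite ge0_integralD//; last 4 first.
- by move=> t _; rewrite lee_fin mulr_ge0 ?pw_ge0.
- by apply/measurable_EFinP/measurable_funM => //; [exact: measurable_pw|exact: measurable_ler_nat].
- by move=> t _; rewrite lee_fin mulr_ge0 ?pw_ge0 ?expR_ge0.
- by apply/measurable_EFinP/measurable_funM => //; exact: measurable_pw.
rewrite integral_pw_le//; apply: lte_add_pinfty; [exact: ltry|exact: gamn].
Qed.

Lemma GammaE a : 0 < a -> gam a = (Gamma a)%:E.
Proof.
move=> a0; rewrite -[LHS]fineK ?ge0_fin_numE ?gam_fin//; congr EFin.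
rewrite /Gamma /Rintegral; congr fine; rewrite [RHS]integral_mkcond.
apply: eq_integral => t _; rewrite patchE; case: ifPn.
  by rewrite inE/= in_itv/= andbT /pw => ->.
by rewrite notin_setE/= in_itv/= andbT /pw => /negP/negPf ->; rewrite mul0r.
Qed.

Lemma GammaS c : 0 < c -> Gamma (c + 1) = c * Gamma c :> R.
Proof.
move=> c0; have := gamS c0.
by rewrite !GammaE ?addr_gt0// -EFinM => -[].
Qed.

Lemma Gamma_gt0 a : 0 < a -> 0 < Gamma a :> R.
Proof.
move=> a0; rewrite -lte_fin -GammaE//.
apply: (@integral_gt0 _ _ R mu (fun t => pw a t * expR (- t)) `]0, 1[) => //.
- by apply: measurable_funM => //; exact: measurable_pw.
- by move=> t; rewrite mulr_ge0 ?pw_ge0 ?expR_ge0.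
- by rewrite /= lebesgue_measure_itv/= lte01 oppr0 adde0 eqe oner_eq0.
- by move=> t; rewrite /= in_itv/= => /andP[t0 _]; rewrite mulr_gt0 ?pw_gt0 ?expR_gt0.
Qed.

Lemma integral_pw_expR a x : 0 < a -> 0 < x ->
  (\int[mu]_t (pw a t * expR (- (x * t)))%:E = (Gamma a * x `^ (- a))%:E)%E.
Proof.
move=> a0 x0.
have ma : measurable_fun [set: R] (fun t => pw a t * expR (- t)).
  by apply: measurable_funM; [exact: measurable_pw|exact: measurable_expN].
have mb : measurable_fun [set: R] (fun t => pw a t * expR (- (x * t))).
  apply: measurable_funM; first exact: measurable_pw.
  by apply: measurableT_comp => //; apply: measurableT_comp => //; exact: measurable_funM.
set I := (X in X = _).
have E : (Gamma a)%:E = ((x `^ a)%:E * I)%E.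
  rewrite -GammaE// /gam.
  rewrite (@ge0_integral_affine R x 0 (fun t => (pw a t * expR (- t))%:E) x0); last 2 first.
  - exact/measurable_EFinP.
  - by move=> t; rewrite lee_fin mulr_ge0 ?pw_ge0 ?expR_ge0.
  under eq_integral do rewrite addr0 pwM// -mulrA.
  rewrite ge0_RZl ?powR_ge0//; last first.
    by move=> t; rewrite mulr_ge0 ?pw_ge0 ?expR_ge0.
  by rewrite muleA -EFinM mulr_powRB1 ?ltW.
rewrite mulrC EFinM E muleA -EFinM -powRD ?addNr; first by rewrite powRr0 mul1e.
by rewrite (gt_eqF x0) implybT.
Qed.

(** No substitution t -> 1/t is made: [expR (- (x / t))] becomes a tail integral over u >= x / t,
    and after the exchange the same condition reads t >= x / u. This is the integral that evaluates
    mixtures of heat kernels with power weights. *)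
Lemma integral_pw_expRV c x : 0 < c -> 0 < x ->
  (\int[mu]_t (pw (- c) t * expR (- (x / t)))%:E = (Gamma c * x `^ (- c))%:E)%E.
Proof.
move=> c0 x0.
pose g t u : R := pw (- c) t * (expR (- u) * (x / t <= u)%R%:R).
have g0 t u : 0 <= g t u by rewrite !mulr_ge0 ?pw_ge0 ?expR_ge0.
have mdiv : measurable_fun [set: R] (fun t => x / t).
  by apply: measurable_funM => //; exact: measurable_invr.
have mg : measurable_fun [set: R * R] (fun p => g p.1 p.2).
  apply: measurable_funM.
    by apply: measurableT_comp => //; exact: measurable_pw.
  apply: measurable_funM; first exact: (measurableT_comp measurable_expN).
  by apply: measurable_ler_nat => //; exact: (measurableT_comp mdiv).
have -> : (\int[mu]_t (pw (- c) t * expR (- (x / t)))%:E =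
    \int[mu]_t \int[mu]_u (g t u)%:E)%E.
  apply: eq_integral => t _; rewrite ge0_RZl ?pw_ge0//; last first.
    by apply: measurable_funM => //; exact: measurable_ler_nat.
  by rewrite integral_expR_ge -EFinM.
rewrite (tonelli mu mu mg g0).
have gE (u : R) : (\int[mu]_t (g t u)%:E = (x `^ (- c) / c * (pw (c + 1) u * expR (- u)))%:E)%E.
  case: (ltP 0 u) => u0; last first.
    rewrite integral0_eq.
      by rewrite /pw ltNge u0/= mul0r mulr0.
    move=> t _; rewrite /g /pw; case: ifPn => t0; last by rewrite mul0r.
    by rewrite leNgt (le_lt_trans u0) ?divr_gt0// mulr0 mulr0.
  transitivity (\int[mu]_t (expR (- u) * (t `^ (- c - 1) * (x / u <= t)%R%:R))%:E)%E.
    apply: eq_integral => t _; congr EFin; rewrite /g mulrCA; congr *%R.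
    rewrite /pw; case: ltP => t0; first by rewrite !ler_pdivrMr// (mulrC u t).
    by rewrite mul0r [x / u <= t]leNgt (le_lt_trans t0) ?divr_gt0// mulr0.
  rewrite ge0_RZl ?expR_ge0//; last 2 first.
  - apply: measurable_funM; [exact: measurable_powR|exact: measurable_ler_nat].
  - by move=> t; rewrite mulr_ge0 ?powR_ge0.
  rewrite integral_powR_ge ?oppr_lt0 ?divr_gt0// -EFinM; congr EFin.
  rewrite /pw u0 addrK powRM ?invr_ge0 ?ltW//.
  have -> : u^-1 `^ (- c) = u `^ c.
    by rewrite -powR_inv1 ?ltW// -powRrM mulN1r opprK.
  by field; rewrite gt_eqF.
under eq_integral do rewrite gE.
rewrite ge0_RZl ?divr_ge0 ?powR_ge0 ?(ltW c0)//; last 2 first.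
- by apply: measurable_funM => //; exact: measurable_pw.
- by move=> t; rewrite mulr_ge0 ?pw_ge0 ?expR_ge0.
rewrite [X in (_ * X)%E](GammaE (addr_gt0 c0 ltr01)) GammaS// -EFinM; congr EFin.
by field; rewrite gt_eqF.
Qed.

(** Euler's Beta integral: the cutoffs in the two [pw] factors confine [t] to ]0, 1[. It is
    extended-real, so that identities can precede finiteness. *)
Definition beta a b := (\int[mu]_t (pw a t * pw b (1 - t))%:E)%E.

Lemma beta_ge0 a b : (0 <= beta a b)%E.
Proof. by apply: integral_ge0 => t _; rewrite lee_fin mulr_ge0 ?pw_ge0. Qed.

Let mpwB b (r : R) : measurable_fun [set: R] (fun x => pw b (r - x)).
Proof. by apply: (measurableT_comp (measurable_pw b)); exact: measurable_funB. Qed.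

(** Scaling by [r] when [r > 0]. For [r <= 0] both sides vanish, even with an infinite [beta],
    because 0 times infinity is 0. *)
Lemma integral_pw_conv a b r :
  (\int[mu]_x (pw a x * pw b (r - x))%:E = (pw (a + b) r)%:E * beta a b)%E.
Proof.
case: (ltP 0 r) => r0; last first.
  rewrite [in RHS]/pw ltNge r0/= mul0e integral0_eq// => x _; rewrite /pw.
  case: ltP => x0; last by rewrite mul0r.
  by rewrite subr_gt0 ltNge (le_trans r0 (ltW x0))/= mulr0.
have mf : measurable_fun [set: R] (fun x => pw a x * pw b (r - x)).
  by apply: measurable_funM; [exact: measurable_pw|exact: mpwB].
rewrite (@ge0_integral_affine R r 0 (fun x => (pw a x * pw b (r - x))%:E) r0); last 2 first.
- exact/measurable_EFinP.
- by move=> t; rewrite lee_fin mulr_ge0 ?pw_ge0.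
have E (x : R) : pw a (r * x + 0) * pw b (r - (r * x + 0)) =
    r `^ (a - 1) * r `^ (b - 1) * (pw a x * pw b (1 - x)).
  have rx : r - r * x = r * (1 - x) by ring.
  by rewrite addr0 rx (pwM a x r0) (pwM b (1 - x) r0) mulrACA.
under eq_integral do rewrite E.
rewrite ge0_RZl ?mulr_ge0 ?powR_ge0//; last 2 first.
- by apply: measurable_funM; [exact: measurable_pw|exact: mpwB].
- by move=> t; rewrite mulr_ge0 ?pw_ge0.
rewrite muleA -EFinM; congr (_%:E * _)%E.
have rn : r != 0 by rewrite gt_eqF.
rewrite /pw r0 -powRD ?rn ?implybT// -{1}(powRr1 (ltW r0)) -powRD ?rn ?implybT//.
congr (_ `^ _); ring.
Qed.

(** Liouville's formula: substitute r = x + y and convolve the powers. It serves twice: an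
    exponential [F] expresses Beta through Gamma, and a heat kernel [F] gives the action of the
    potential on power weights. *)
Lemma liouville a b (F : R -> R) :
  measurable_fun [set: R] F -> (forall r, 0 <= F r) ->
  (\int[mu]_x \int[mu]_y (pw a x * pw b y * F (x + y))%:E =
   beta a b * \int[mu]_r (pw (a + b) r * F r)%:E)%E.
Proof.
move=> mF F0.
pose g x r : R := F r * (pw a x * pw b (r - x)).
have g0 x r : 0 <= g x r by rewrite !mulr_ge0 ?pw_ge0.
have mg : measurable_fun [set: R * R] (fun p => g p.1 p.2).
  apply: measurable_funM; first exact: (measurableT_comp mF).
  apply: measurable_funM; first exact: (measurableT_comp (measurable_pw a)).
  by apply: (measurableT_comp (measurable_pw b)); exact: measurable_funB.
transitivity (\int[mu]_x \int[mu]_r (g x r)%:E)%E.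
  apply: eq_integral => x _.
  rewrite -(@ge0_integral_shift R (fun r => (g x r)%:E) x); last 2 first.
  - by apply/measurable_EFinP; exact: (measurableT_comp mg (measurable_pair1 x)).
  - by move=> r; rewrite lee_fin.
  by apply: eq_integral => y _; rewrite /g addrK mulrC (addrC x).
rewrite (tonelli mu mu mg g0).
have gE (r : R) : (\int[mu]_x (g x r)%:E = beta a b * (pw (a + b) r * F r)%:E)%E.
  rewrite ge0_RZl//; last 2 first.
  - by apply: measurable_funM; [exact: measurable_pw|exact: mpwB].
  - by move=> x; rewrite mulr_ge0 ?pw_ge0.
  by rewrite integral_pw_conv muleA -EFinM muleC mulrC.
under eq_integral do rewrite gE.
rewrite ge0_integralZl ?beta_ge0//.
- by apply/measurable_EFinP/measurable_funM => //; exact: measurable_pw.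
- by move=> r _; rewrite lee_fin mulr_ge0 ?pw_ge0.
Qed.

Lemma betaE a b : 0 < a -> 0 < b ->
  beta a b = (Gamma a * Gamma b / Gamma (a + b))%:E.
Proof.
move=> a0 b0; have ab0 : 0 < a + b by exact: addr_gt0.
have := @liouville a b (fun r => expR (- r)) measurable_expN (fun r => expR_ge0 _).
rewrite [X in (_ = beta a b * X)%E](GammaE ab0).
have -> : (\int[mu]_x \int[mu]_y (pw a x * pw b y * expR (- (x + y)))%:E =
    (Gamma a * Gamma b)%:E :> \bar R)%E.
  transitivity (\int[mu]_x (Gamma b * (pw a x * expR (- x)))%:E)%E.
    apply: eq_integral => x _.
    under eq_integral do rewrite opprD expRD mulrACA.
    rewrite ge0_RZl ?mulr_ge0 ?pw_ge0 ?expR_ge0//; last 2 first.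
    - by apply: measurable_funM => //; exact: measurable_pw.
    - by move=> t; rewrite mulr_ge0 ?pw_ge0 ?expR_ge0.
    by rewrite [X in (_ * X)%E](GammaE b0) -EFinM mulrC.
  rewrite ge0_RZl ?(ltW (Gamma_gt0 b0))//; last 2 first.
  - by apply: measurable_funM => //; exact: measurable_pw.
  - by move=> t; rewrite mulr_ge0 ?pw_ge0 ?expR_ge0.
  by rewrite [X in (_ * X)%E](GammaE a0) -EFinM mulrC.
have G0 := Gamma_gt0 ab0.
(* An infinite value is excluded because its product with the positive number [Gamma (a + b)] is a
   real number. *)
have := beta_ge0 a b; case: (beta a b) => [r| |]//=.
  by rewrite -EFinM => _ [->]; rewrite mulfK ?gt_eqF.
by rewrite mulyr gtr0_sg// mul1e.
Qed.

(** Strict Cauchy-Schwarz for the weight [pw b (1 - t)]: the powers of exponents (a - 1)/2 and (c -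
    a - 1)/2 multiply to the power that defines the midpoint value, and they are not proportional
    since [a != c / 2]. *)
Lemma beta_log_convex a b c : 0 < a < c -> 0 < b -> a != c / 2 ->
  fine (beta (c / 2) b) ^+ 2 < fine (beta a b) * fine (beta (c - a) b).
Proof.
move=> /andP[a0 ac] b0 ac2.
have c0 : 0 < c by exact: lt_trans ac.
have ca0 : 0 < c - a by rewrite subr_gt0.
have c20 : 0 < c / 2 by rewrite divr_gt0.
have bE p : 0 < p -> exists2 r : R, 0 < r & beta p b = r%:E.
  move=> p0; exists (Gamma p * Gamma b / Gamma (p + b)); last exact: betaE.
  by apply: divr_gt0; [apply: mulr_gt0|]; apply: Gamma_gt0 => //; exact: addr_gt0.
have mpp p : measurable_fun [set: R] (fun x => pw p x * pw b (1 - x)).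
  by apply: measurable_funM; [exact: measurable_pw|exact: mpwB].
have [[A0 B0 eA0] [A1 B1 eA1] [A2 B2 eA2]] := And3 (bE _ c20) (bE _ a0) (bE _ ca0).
rewrite eA0 eA1 eA2 [fine _]/= [fine A1%:E]/= [fine A2%:E]/=.
(* The minimizer in [l] of [A1 + l ^+ 2 * A2 - 2 * l * A0], kept opaque; the quadratic is the
   integral of the square [f] below, and its minimum is [A1 - A0 ^+ 2 / A2]. *)
have [l el] : exists l, l = A0 / A2 by eexists.
have l0 : 0 < l by rewrite el divr_gt0.
have l1 := ltW l0.
pose f (x : R) := pw b (1 - x) * (pw a x + l ^+ 2 * pw (c - a) x - 2 * l * pw (c / 2) x).
have fE x : 0 < x -> f x = pw b (1 - x) *
    (x `^ ((a - 1) / 2) - l * x `^ ((c - a - 1) / 2)) ^+ 2.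
  move=> x0; rewrite /f; congr *%R; rewrite /pw x0.
  have sq p : x `^ p = x `^ (p / 2) ^+ 2 by rewrite expr2 -powRD ?(gt_eqF x0) ?implybT// -splitr.
  rewrite (sq (a - 1)) (sq (c - a - 1)).
  have -> : x `^ (c / 2 - 1) = x `^ ((a - 1) / 2) * x `^ ((c - a - 1) / 2).
    by rewrite -powRD ?(gt_eqF x0) ?implybT//; congr (_ `^ _); field.
  by ring.
have f0 x : 0 <= f x.
  case: (ltP 0 x) => x0; first by rewrite fE// mulr_ge0 ?pw_ge0 ?sqr_ge0.
  by rewrite /f /pw (ltNge 0 x) x0/= !(mulr0, addr0, subr0).
have mf : measurable_fun [set: R] f.
  apply: measurable_funM; first exact: mpwB.
  apply: measurable_funB; last by apply: measurable_funM => //; exact: measurable_pw.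
  apply: measurable_funD; first exact: measurable_pw.
  by apply: measurable_funM => //; exact: measurable_pw.
have f_gt0 : (0 < \int[mu]_x (f x)%:E)%E.
  have key (u v : R) : 0 <= u -> u < v -> v <= 1 ->
      (forall x, u < x < v -> x `^ ((a - 1) / 2) - l * x `^ ((c - a - 1) / 2) != 0) ->
      (0 < \int[mu]_x (f x)%:E)%E.
    move=> u0 uv v1 h; apply: (@integral_gt0 _ _ R mu f `]u, v[) => //.
      by rewrite /= lebesgue_measure_itv/= lte_fin uv -EFinB eqe subr_eq0 gt_eqF.
    move=> x; rewrite /= in_itv/= => xuv; have /andP[ux xv] := xuv.
    have x0 : 0 < x by exact: le_lt_trans ux.
    rewrite fE// mulr_gt0// ?exprn_even_gt0 ?h//.
    by rewrite pw_gt0// subr_gt0 (lt_le_trans xv).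
  (* The two powers balance at no more than one point, since x^(a - c/2) is injective. Hence one of
     the halves ]0, 1/2[ and ]1/2, 1[ contains no zero of [f], and either of them suffices. *)
  have [[y [/andP[y0 y1] hy]]|] := pselect (exists y : R, 0 < y < 2^-1 /\
      y `^ ((a - 1) / 2) - l * y `^ ((c - a - 1) / 2) == 0); last first.
    move=> h; apply: (key 0 2^-1) => //; first by rewrite invf_le1// ler1n.
    by move=> x x01; apply/negP => hx; apply: h; exists x.
  apply: (key 2^-1 1) => //; first by rewrite invf_lt1// ltr1n.
  move=> x /andP[x0 x1]; apply: contraNneq ac2 => hx.
  have lE (z : R) : 0 < z -> z `^ ((a - 1) / 2) - l * z `^ ((c - a - 1) / 2) = 0 ->
      l = z `^ (a - c / 2).
    move=> z0 /eqP; rewrite subr_eq0 => /eqP e.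
    apply: (@mulIf _ (z `^ ((c - a - 1) / 2))); first by rewrite gt_eqF ?powR_gt0.
    have zn : z != 0 by rewrite gt_eqF.
    by rewrite -e -powRD ?zn ?implybT//; congr (_ `^ _); field.
  have xp : 0 < x by rewrite (lt_trans _ x0)// invr_gt0.
  have := lE _ y0 (eqP hy); rewrite (lE _ xp hx) => /(congr1 (@ln R)).
  rewrite !ln_powR => /eqP; rewrite -subr_eq0 -mulrBr mulf_eq0 subr_eq0 => /orP[//|].
  rewrite subr_eq0 => /eqP/ln_inj; rewrite !posrE => /(_ xp y0) xy.
  by move: x0; rewrite xy ltNge (ltW y1).
(* The mixed term is moved to the left, so that only nonnegative integrands are added. *)
have : (\int[mu]_x (f x)%:E + (2 * l * A0)%:E = (A1 + l ^+ 2 * A2)%:E)%E.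
  have -> : (2 * l * A0)%:E = (\int[mu]_x (2 * l * (pw (c / 2) x * pw b (1 - x)))%:E)%E.
    rewrite ge0_RZl; [|exact: mpp|by move=> x; rewrite mulr_ge0 ?pw_ge0|exact: mulr_ge0].
    by rewrite -/(beta _ _) eA0 EFinM.
  rewrite -ge0_integralD//; last 4 first.
  - by move=> x _; rewrite lee_fin.
  - exact/measurable_EFinP.
  - by move=> x _; rewrite lee_fin !mulr_ge0 ?pw_ge0.
  - by apply/measurable_EFinP; apply: measurable_funM => //; exact: mpp.
  transitivity (\int[mu]_x ((pw a x * pw b (1 - x))%:E +
       (l ^+ 2 * (pw (c - a) x * pw b (1 - x)))%:E))%E.
    by apply: eq_integral => x _; rewrite -!EFinD /f; congr EFin; ring.
  rewrite ge0_integralD//; last 4 first.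
  - by move=> x _; rewrite lee_fin mulr_ge0 ?pw_ge0.
  - by apply/measurable_EFinP; exact: mpp.
  - by move=> x _; rewrite lee_fin !mulr_ge0 ?pw_ge0.
  - by apply/measurable_EFinP; apply: measurable_funM => //; exact: mpp.
  rewrite ge0_RZl; [|exact: mpp|by move=> x; rewrite mulr_ge0 ?pw_ge0|exact: exprn_ge0].
  by rewrite -!/(beta _ _) eA1 eA2 -EFinM -EFinD.
case: (integral _ _ _) f_gt0 => [r| |]// r0 [E].
move: r0; rewrite lte_fin (_ : r = A1 - A0 ^+ 2 / A2); last first.
  apply: (addIr (2 * l * A0)); rewrite E el; field.
  by rewrite gt_eqF.
by rewrite subr_gt0 ltr_pdivrMr.
Qed.

End gamma.

(** * One-dimensional Gaussian integrals *)

Section gauss1.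
Context {R : realType}.
Local Notation mu := (@lebesgue_measure R).
Implicit Types k m r s t x : R.

Lemma integral_gauss t m : 0 < t ->
  (\int[mu]_x (expR (- (t * (x - m) ^+ 2)))%:E = (Num.sqrt (pi / t))%:E)%E.
Proof.
move=> t0; pose s := Num.sqrt (t^-1 / 2).
have s2 : s ^+ 2 = t^-1 / 2 by rewrite sqr_sqrtr// divr_ge0 ?invr_ge0 ?ltW.
have s0 : s != 0 by rewrite gt_eqF// sqrtr_gt0 divr_gt0 ?invr_gt0.
have := integral_normal_pdf m s.
under eq_integral do rewrite normal_pdfE//.
have pk0 := normal_peak_gt0 s0.
have E x : normal_fun m s x = expR (- (t * (x - m) ^+ 2)).
  by rewrite /normal_fun s2; congr expR; field; rewrite gt_eqF.
rewrite ge0_RZl ?normal_peak_ge0//; last 2 first.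
- exact: measurable_normal_fun.
- by move=> x; exact: normal_fun_ge0.
under eq_integral do rewrite E.
move=> H; rewrite -[LHS]mul1e.
have -> : 1%E = ((normal_peak s)^-1%:E * (normal_peak s)%:E)%E :> \bar R.
  by rewrite -EFinM mulVf// gt_eqF.
rewrite -muleA H mule1 /normal_peak invrK; congr (Num.sqrt _)%:E.
by rewrite s2; field; rewrite gt_eqF.
Qed.

Lemma measurable_gauss t m :
  measurable_fun [set: R] (fun x => expR (- (t * (x - m) ^+ 2))).
Proof.
apply: measurableT_comp => //; apply: measurableT_comp => //.
by apply: measurable_funM => //; apply: measurable_funX; exact: measurable_funB.
Qed.

Lemma integrable_gauss t m : 0 < t ->
  mu.-integrable [set: R] (fun x => (expR (- (t * (x - m) ^+ 2)))%:E).
Proof.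
move=> t0; apply/integrableP; split.
  by apply/measurable_EFinP; exact: measurable_gauss.
under eq_integral do rewrite gee0_abs ?lee_fin ?expR_ge0//.
by rewrite integral_gauss// ltry.
Qed.

Let g t x := expR (- (t * x ^+ 2)).

Let integrable_g t : 0 < t -> mu.-integrable [set: R] (fun x => (g t x)%:E).
Proof.
move=> t0; have := integrable_gauss 0 t0.
by apply: eq_integrable => // x _; rewrite subr0.
Qed.

Let measurable_g t : measurable_fun [set: R] (g t).
Proof.
have := measurable_gauss t 0.
by congr measurable_fun; apply/funext => x; rewrite subr0.
Qed.

Let integrable_xg t : 0 < t -> mu.-integrable [set: R] (fun x => (`|x| * g t x)%:E).
Proof.
move=> t0; have t20 : 0 < t / 2 by rewrite divr_gt0.
(* Half of the Gaussian pays for |x|: |x| <= 1 + x^2 <= (1 + 2/t) (1 + t x^2 / 2) <= (1 + 2/t) exp(t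
   x^2 / 2). *)
have h : mu.-integrable [set: R] (fun x => ((1 + 2 / t)%:E * (g (t / 2) x)%:E)%E).
  by apply: integrableZl => //; exact: integrable_g.
apply: le_integrable h => //.
  apply/measurable_EFinP/measurable_funM => //; exact: measurable_g.
move=> x _; rewrite -EFinM !abse_EFin lee_fin.
rewrite [leLHS]ger0_norm ?mulr_ge0 ?expR_ge0// [leRHS]ger0_norm; last first.
  by rewrite mulr_ge0 ?expR_ge0 ?addr_ge0 ?mulr_ge0 ?invr_ge0 ?(ltW t0).
have -> : g t x = g (t / 2) x * g (t / 2) x.
  by rewrite /g -expRD -opprD -mulrDl -splitr.
rewrite mulrA ler_wpM2r ?expR_ge0//.
rewrite /g expRN ler_pdivrMr ?expR_gt0//.
apply: (@le_trans _ _ ((1 + 2 / t) * (1 + t / 2 * x ^+ 2))); last first.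
  by rewrite ler_wpM2l ?addr_ge0 ?mulr_ge0 ?invr_ge0 ?(ltW t0)// expR_ge1Dx.
have -> : (1 + 2 / t) * (1 + t / 2 * x ^+ 2) = 1 + x ^+ 2 + (2 / t + t / 2 * x ^+ 2).
  by field; rewrite gt_eqF.
have : 0 <= 2 / t + t / 2 * x ^+ 2.
  have t1 := ltW t0; apply: addr_ge0; first by rewrite divr_ge0.
  by apply: mulr_ge0; [rewrite divr_ge0|exact: sqr_ge0].
suff : `|x| <= 1 + x ^+ 2 by lra.
by rewrite -(real_normK (num_real x)); have := sqr_ge0 (`|x| - 1); have := normr_ge0 x; nra.
Qed.

(** The fundamental theorem of calculus on [-(n + 1), n + 1], then dominated convergence with bound
    |h|. *)
Let Rintegral_derivative0 (H h : R -> R) :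
  (forall x, is_derive x 1 H (h x)) -> continuous h ->
  mu.-integrable [set: R] (EFin \o h) ->
  (H n.+1%:R @[n --> \oo] --> (0 : R)) -> (H (- n.+1%:R) @[n --> \oo] --> (0 : R)) ->
  \int[mu]_x h x = 0.
Proof.
move=> dH ch ih H1 H2.
pose D n := `[- n.+1%:R, n.+1%:R]%classic : set R.
pose hn n x : \bar R := ((EFin \o h) \_ (D n)) x.
have mh : measurable_fun [set: R] (EFin \o h) by exact: measurable_int ih.
have mhn n : measurable_fun [set: R] (hn n).
  by apply/(measurable_restrictT _ _).1 => //; [exact: measurable_itv|exact: measurable_funTS].
have c1 : {ae mu, forall x, [set: R] x -> hn ^~ x @ \oo --> (EFin \o h) x}.
  apply: aeW => x _; apply: cvg_near_cst; near=> n.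
  rewrite /hn patchE ifT// inE /D/= in_itv/= -ler_norml.
  near: n; exists (Num.truncn `|x|) => // n /= xn.
  by rewrite ltW// (lt_le_trans (truncnS_gt _))// ler_nat.
have c2 : mu.-integrable [set: R] (abse \o (EFin \o h)) by exact: integrable_abse.
have c3 : {ae mu, forall x n, [set: R] x -> (`|hn n x| <= (abse \o (EFin \o h)) x)%E}.
  apply: aeW => x n _; rewrite /hn patchE; case: ifPn => // _.
  by rewrite abse0 abse_ge0.
have [_ _] := @dominated_convergence _ (measurableTypeR R) R mu [set: R] measurableT
  hn (EFin \o h) _ mhn mh c1 c2 c3.
have -> : (fun n => \int[mu]_x hn n x)%E = (fun n => (H n.+1%:R - H (- n.+1%:R))%:E).
  apply/funext => n; rewrite -integral_mkcond (@continuous_FTC2 _ _ H)//.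
  - by rewrite -subr_gt0 opprK -natrD ltr0n.
  - exact: continuous_subspaceT.
  - have cH x : {for x, continuous H}.
      apply: differentiable_continuous; apply/derivable1_diffP.
      exact: (@ex_derive _ _ _ _ _ _ _ (dH x)).
    split.
    + by move=> x _; exact: (@ex_derive _ _ _ _ _ _ _ (dH x)).
    + by apply: cvg_at_right_filter; exact: cH.
    + by apply: cvg_at_left_filter; exact: cH.
  - by move=> x _; rewrite derive1E (@derive_val _ _ _ _ _ _ _ (dH x)).
move=> lim.
have lim0 : ((H n.+1%:R - H (- n.+1%:R))%:E @[n --> \oo] --> (0%R)%:E)%E.
  by apply: cvg_EFin; [exact: nearW|rewrite -(subr0 0); exact: cvgB].
by rewrite /Rintegral -(cvg_unique _ lim0 lim).
Unshelve. all: by end_near. Qed.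

Let continuous_g t : continuous (g t).
Proof.
move=> x; apply: continuous_comp; last exact: continuous_expR.
apply: continuousN; apply: continuousM; first exact: cvg_cst.
exact: exprn_continuous.
Qed.

Let continuous_sinM k : continuous (fun x => sin (k * x)).
Proof.
move=> x; apply: continuous_comp; last exact: continuous_sin.
by apply: continuousM; [exact: cvg_cst|exact: cvg_id].
Qed.

Let continuous_cosM k : continuous (fun x => cos (k * x)).
Proof.
move=> x; apply: continuous_comp; last exact: continuous_cos.
by apply: continuousM; [exact: cvg_cst|exact: cvg_id].
Qed.

Let integrable_g_cos t k : 0 < t ->
  mu.-integrable [set: R] (fun x => (g t x * cos (k * x))%:E).
Proof.
move=> t0; apply: le_integrable (integrable_g t0) => //.
  apply/measurable_EFinP/measurable_funM; first exact: measurable_g.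
  exact: (continuous_measurable_fun (@continuous_cosM k)).
move=> x _; rewrite !abse_EFin lee_fin normrM ler_piMr ?normr_ge0//.
by rewrite ler_norml cos_geN1 cos_le1.
Qed.

Let integrable_xg_sin t k : 0 < t ->
  mu.-integrable [set: R] (fun x => (x * g t x * sin (k * x))%:E).
Proof.
move=> t0; apply: le_integrable (integrable_xg t0) => //.
  apply/measurable_EFinP/measurable_funM; last first.
    exact: (continuous_measurable_fun (@continuous_sinM k)).
  by apply: measurable_funM => //; exact: measurable_g.
move=> x _; rewrite !abse_EFin lee_fin !normrM normr_id.
rewrite ler_piMr ?mulr_ge0 ?normr_ge0//.
by rewrite ler_norml sin_geN1 sin_le1.
Qed.

Let dg t x : is_derive x 1 (g t) (- (2 * t * x) * g t x).
Proof.
have h : is_derive x 1 (fun x => - (t * x ^+ 2)) (- (2 * t * x)).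
  apply: is_derive_eq.
  by rewrite /GRing.scale/=; ring.
rewrite mulrC; exact: (is_derive1_comp (f := expR)).
Qed.

Let dsin k x : is_derive x 1 (fun x => sin (k * x)) (k * cos (k * x)).
Proof.
have h : is_derive x 1 (fun x => k * x) k.
  by apply: is_derive_eq; rewrite /GRing.scale/=; ring.
rewrite mulrC; exact: (is_derive1_comp (f := sin)).
Qed.

(** The derivative of [g t x * sin (k * x)] integrates to zero. This turns the derivative in [k] of
    the cosine integral into a multiple of that integral. *)
Let by_parts t k : 0 < t ->
  \int[mu]_x (x * g t x * sin (k * x)) = k / (2 * t) * \int[mu]_x (g t x * cos (k * x)).
Proof.
move=> t0.
pose H x := g t x * sin (k * x).
pose h x := k * (g t x * cos (k * x)) - 2 * t * (x * g t x * sin (k * x)).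
have dH x : is_derive x 1 H (h x).
  apply: (is_derive_eq (is_deriveM (dg t x) (dsin k x))).
  by rewrite /h /GRing.scale/=; ring.
have i1 : mu.-integrable [set: R] (fun x => (k * (g t x * cos (k * x)))%:E).
  have := integrableZl measurableT k (integrable_g_cos k t0).
  by apply: eq_integrable => // x _; rewrite EFinM.
have i2 : mu.-integrable [set: R] (fun x => (2 * t * (x * g t x * sin (k * x)))%:E).
  have := integrableZl measurableT (2 * t) (integrable_xg_sin k t0).
  by apply: eq_integrable => // x _; rewrite -EFinM.
have ih : mu.-integrable [set: R] (EFin \o h).
  have := integrableB measurableT i1 i2.
  by apply: eq_integrable => // x _.
have ch : continuous h.
  move=> x; rewrite /h; apply: cvgB; apply: cvgMr.
    by apply: cvgM; [exact: continuous_g|exact: continuous_cosM].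
  apply: cvgM; last exact: continuous_sinM.
  by apply: cvgM; [exact: cvg_id|exact: continuous_g].
have Hb (e : R) (n : nat) : `|e| = 1 -> `|H (e * n.+1%:R)| <= t^-1 * harmonic n.
  move=> e1; rewrite normrM (@le_trans _ _ (g t (e * n.+1%:R)))//.
    rewrite ger0_norm ?expR_ge0// ler_piMr ?expR_ge0//.
    by rewrite ler_norml sin_geN1 sin_le1.
  rewrite /g expRN exprMn -(real_normK (num_real e)) e1 expr1n mul1r /harmonic/= -invfM.
  rewrite lef_pV2 ?posrE ?expR_gt0 ?mulr_gt0//.
  apply: (@le_trans _ _ (1 + t * n.+1%:R ^+ 2)); last exact: expR_ge1Dx.
  rewrite -[leLHS]add0r lerD// ler_wpM2l ?(ltW t0)//.
  by rewrite expr2 ler_peMr// ler1n.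
have Hc (e : R) : `|e| = 1 -> H (e * n.+1%:R) @[n --> \oo] --> (0 : R).
  move=> e1; apply/norm_cvg0P; apply: (@squeeze_cvgr _ _ _ _ (fun=> 0) (fun n => t^-1 * harmonic n)).
  - by apply: nearW => n; rewrite normr_ge0 Hb.
  - exact: cvg_cst.
  - by rewrite -[X in _ --> X](mulr0 t^-1); apply: cvgMr; exact: cvg_harmonic.
have := Rintegral_derivative0 dH ch ih.
have h1 : H n.+1%:R @[n --> \oo] --> (0 : R).
  by have := Hc 1 (normr1 _); under eq_fun do rewrite mul1r.
have h2 : H (- n.+1%:R) @[n --> \oo] --> (0 : R).
  have := Hc (-1) (normrN1 _); by under eq_fun do rewrite mulN1r.
move=> /(_ h1 h2).
rewrite /h RintegralB// !RintegralZl//; [|exact: integrable_xg_sin|exact: integrable_g_cos].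
move=> /eqP; rewrite subr_eq0 => /eqP e.
apply: (@mulfI _ (2 * t)); first by rewrite gt_eqF// mulr_gt0.
rewrite -e; field; by rewrite gt_eqF.
Qed.

Let F t k := \int[mu]_x (g t x * cos (k * x)).

(** Differentiation under the integral sign, dominated by [|x| * g t x] uniformly in [k], followed
    by [by_parts]. *)
Let dF t k : 0 < t -> is_derive k 1 (F t) (- (k / (2 * t)) * F t k).
Proof.
move=> t0.
have d1 (y x : R) : is_derive x 1 (fun x => g t y * cos (x * y)) (- (y * g t y * sin (x * y))).
  have h : is_derive x 1 (fun x => x * y) y.
    by apply: is_derive_eq; rewrite /GRing.scale/=; ring.
  have h2 : is_derive x 1 (fun x => cos (x * y)) (- sin (x * y) * y).
    exact: (is_derive1_comp (f := cos)).
  apply: (is_derive_eq (is_deriveZ (g t y) h2)).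
  by rewrite /GRing.scale/=; ring.
have P (x y : R) : partial1of2 (fun x y => g t y * cos (x * y)) x y = - (y * g t y * sin (x * y)).
  by rewrite partial1of2E (@derive_val _ _ _ _ _ _ _ (d1 y x)).
have kk : `](k - 1), (k + 1)[%classic k by rewrite /= in_itv/=; apply/andP; split; lra.
have A1 x : `](k - 1), (k + 1)[%classic x ->
  mu.-integrable [set: R] (EFin \o (fun y => g t y * cos (x * y))) by move=> _; exact: integrable_g_cos.
have A2 (x y : R) : `](k - 1), (k + 1)[%classic x -> [set: R] y ->
    derivable (fun x => g t y * cos (x * y)) x 1.
  by move=> _ _; exact: (@ex_derive _ _ _ _ _ _ _ (d1 y x)).
have A3 (y : R) : 0 <= `|y| * g t y by rewrite mulr_ge0 ?expR_ge0.
have A4 (x y : R) : `](k - 1), (k + 1)[%classic x -> [set: R] y ->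
    `|partial1of2 (fun x y => g t y * cos (x * y)) x y| <= `|y| * g t y.
  move=> _ _; rewrite P normrN !normrM [`|g t y|]ger0_norm ?expR_ge0// ler_piMr ?A3//.
  by rewrite ler_norml sin_geN1 sin_le1.
have D := @derivable_under_integral R _ _ mu (fun x y => g t y * cos (x * y)) setT
  measurableT k _ _ kk A1 A2 _ A3 (integrable_xg t0) A4.
have E := @differentiation_under_integral R _ _ mu (fun x y => g t y * cos (x * y)) setT
  measurableT k _ _ kk A1 A2 _ A3 (integrable_xg t0) A4.
apply: DeriveDef; first exact: D.
rewrite -derive1E E.
transitivity (\int[mu]_x (- (x * g t x * sin (k * x)))).
  by apply: eq_Rintegral => y _; rewrite P.
rewrite mulNr -by_parts//.
transitivity (\int[mu]_x (-1 * (x * g t x * sin (k * x)))).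
  by apply: eq_Rintegral => y _; rewrite mulN1r.
by rewrite RintegralZl ?mulN1r//; exact: integrable_xg_sin.
Qed.

(** The cosine transform [F] solves F' = - k / (2t) F, so its product with exp(k^2 / (4t)) is
    constant; its value at 0 is the Gaussian integral. *)
Lemma Rintegral_gauss_cos t k : 0 < t ->
  \int[mu]_x (expR (- (t * x ^+ 2)) * cos (k * x)) =
  Num.sqrt (pi / t) * expR (- (k ^+ 2 / (4 * t))).
Proof.
move=> t0; rewrite -/(F t k).
pose E x := expR (x ^+ 2 / (4 * t)).
have dE (x : R) : is_derive x 1 E (x / (2 * t) * E x).
  have h : is_derive x 1 (fun x => x ^+ 2 / (4 * t)) (x / (2 * t)).
    apply: is_derive_eq; rewrite /GRing.scale/=.
    by field; rewrite gt_eqF.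
  by rewrite mulrC; exact: (is_derive1_comp (f := expR)).
have d0 (x : R) : is_derive x 1 (F t * E) 0.
  apply: (is_derive_eq (is_deriveM (dF x t0) (dE x))).
  by rewrite /GRing.scale/=; ring.
have := is_derive_0_is_cst k 0 d0.
rewrite !fctE /E expr0n/= mul0r expR0 mulr1 => e.
rewrite expRN; apply: (canRL (mulfK _)); first by rewrite gt_eqF ?expR_gt0.
rewrite e /F /Rintegral (_ : integral _ _ _ = (Num.sqrt (pi / t))%:E)//.
rewrite -(integral_gauss 0 t0); apply: eq_integral => x _.
by rewrite mul0r cos0 mulr1 subr0.
Qed.

Let integral_opp (f : R -> \bar R) : measurable_fun [set: R] f ->
  (\int[mu]_x f (- x)%R = \int[mu]_x f x)%E.
Proof.
move=> mf; rewrite [LHS]integralE [RHS]integralE; congr (_ - _)%E.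
- rewrite -(@ge0_integral_opp R (f^\+)%E) => //; last exact: measurable_funepos.
  by apply: eq_integral => x _; rewrite ?funeposE ?funenegE.
- rewrite -(@ge0_integral_opp R (f^\-)%E) => //; last exact: measurable_funeneg.
  by apply: eq_integral => x _; rewrite ?funeposE ?funenegE.
Qed.

Let integrable_g_sin t k : 0 < t ->
  mu.-integrable [set: R] (fun x => (g t x * sin (k * x))%:E).
Proof.
move=> t0; apply: le_integrable (integrable_g t0) => //.
  apply/measurable_EFinP/measurable_funM; first exact: measurable_g.
  exact: (continuous_measurable_fun (@continuous_sinM k)).
move=> x _; rewrite !abse_EFin lee_fin normrM ler_piMr ?normr_ge0//.
by rewrite ler_norml sin_geN1 sin_le1.
Qed.

Lemma Rintegral_gauss_sin t k : 0 < t ->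
  \int[mu]_x (expR (- (t * x ^+ 2)) * sin (k * x)) = 0.
Proof.
move=> t0; have i0 := integrable_g_sin k t0.
have := integral_opp (measurable_int _ i0).
move=> /(congr1 fine) h.
have : - (\int[mu]_x (g t x * sin (k * x))) = \int[mu]_x (g t x * sin (k * x)).
  rewrite -[RHS]h -mulN1r -RintegralZl//.
  by apply: eq_Rintegral => x _; rewrite /g sqrrN mulrN sinN; ring.
rewrite /g; lra.
Qed.

(** The free phase [c] is what the induction on the dimension needs: it carries the contribution of
    the other coordinates. *)
Lemma Rintegral_gauss_cosD t k c : 0 < t ->
  \int[mu]_x (expR (- (t * x ^+ 2)) * cos (k * x + c)) =
  Num.sqrt (pi / t) * expR (- (k ^+ 2 / (4 * t))) * cos c.
Proof.
move=> t0.
have i1 : mu.-integrable [set: R] (fun x => (cos c * (g t x * cos (k * x)))%:E).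
  have := integrableZl measurableT (cos c) (integrable_g_cos k t0).
  by apply: eq_integrable.
have i2 : mu.-integrable [set: R] (fun x => (sin c * (g t x * sin (k * x)))%:E).
  have := integrableZl measurableT (sin c) (integrable_g_sin k t0).
  by apply: eq_integrable.
transitivity (\int[mu]_x (cos c * (g t x * cos (k * x)) - sin c * (g t x * sin (k * x)))).
  by apply: eq_Rintegral => x _; rewrite cosD /g; ring.
rewrite RintegralB// !RintegralZl//; [|exact: integrable_g_sin|exact: integrable_g_cos].
by rewrite Rintegral_gauss_cos// Rintegral_gauss_sin// mulr0 subr0 mulrC.
Qed.

End gauss1.

(** * The one-dimensional heat kernel and its semigroup law *)

Section heat1.
Context {R : realType}.
Local Notation mu := (@lebesgue_measure R).
Implicit Types r s x y : R.

(** The kernel of the semigroup generated by the second derivative, without the factor 1/2 of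
    probability. In this normalization the transform of the Gaussian exp(- r x^2) is a multiple of
    the kernel at the same time [r]. *)
Definition hk1 r x : R := (Num.sqrt (4 * pi * r))^-1 * expR (- (x ^+ 2 / (4 * r))).

Lemma hk1_ge0 r x : 0 <= hk1 r x.
Proof. by rewrite mulr_ge0 ?invr_ge0 ?sqrtr_ge0 ?expR_ge0. Qed.

Lemma integral_hk1 r y : 0 < r -> (\int[mu]_x (hk1 r (x - y))%:E = 1)%E.
Proof.
move=> r0; have t0 : 0 < (4 * r)^-1 by rewrite invr_gt0 mulr_gt0.
transitivity (\int[mu]_x ((Num.sqrt (4 * pi * r))^-1 * expR (- ((4 * r)^-1 * (x - y) ^+ 2)))%:E)%E.
  by apply: eq_integral => x _; rewrite /hk1 [_ / (4 * r)]mulrC.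
rewrite ge0_RZl ?invr_ge0 ?sqrtr_ge0//; last exact: measurable_gauss.
rewrite integral_gauss// -EFinM; congr EFin.
rewrite (_ : pi / (4 * r)^-1 = 4 * pi * r); last by field; rewrite gt_eqF.
by rewrite mulVf// gt_eqF// sqrtr_gt0 !mulr_gt0// pi_gt0.
Qed.

Lemma integral_hk1_conv r s x : 0 < r -> 0 < s ->
  (\int[mu]_y (hk1 r (x - y) * hk1 s y)%:E = (hk1 (r + s) x)%:E)%E.
Proof.
move=> r0 s0; have rs0 : 0 < r + s by exact: addr_gt0.
(* Rate of the Gaussian in [y] after completing the square; its centre is x s / (r + s). *)
pose t := (r + s) / (4 * r * s).
have t0 : 0 < t by rewrite divr_gt0 ?mulr_gt0.
have rn : r != 0 by rewrite gt_eqF.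
have sn : s != 0 by rewrite gt_eqF.
have rsn : r + s != 0 by rewrite gt_eqF.
pose c := (Num.sqrt (4 * pi * r))^-1 * (Num.sqrt (4 * pi * s))^-1 *
  expR (- (x ^+ 2 / (4 * (r + s)))).
transitivity (\int[mu]_y (c * expR (- (t * (y - x * s / (r + s)) ^+ 2)))%:E)%E.
  apply: eq_integral => y _; congr EFin; rewrite /hk1 /c mulrACA -!mulrA; congr (_ * (_ * _)).
  rewrite -!expRD; congr expR; rewrite /t; field.
  by rewrite rn sn rsn.
rewrite ge0_RZl ?mulr_ge0 ?invr_ge0 ?sqrtr_ge0 ?expR_ge0//; last exact: measurable_gauss.
rewrite integral_gauss// -EFinM; congr EFin.
rewrite /c /hk1 mulrAC; congr (_ * _).
have p0 := @pi_gt0 R.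
apply: (@mulIf _ (Num.sqrt (4 * pi * r) * Num.sqrt (4 * pi * s) * Num.sqrt (4 * pi * (r + s)))).
  by rewrite !mulf_neq0// gt_eqF// sqrtr_gt0 !mulr_gt0.
have n1 : Num.sqrt (4 * pi * r) != 0 by rewrite gt_eqF// sqrtr_gt0 !mulr_gt0.
have n2 : Num.sqrt (4 * pi * s) != 0 by rewrite gt_eqF// sqrtr_gt0 !mulr_gt0.
have n3 : Num.sqrt (4 * pi * (r + s)) != 0 by rewrite gt_eqF// sqrtr_gt0 !mulr_gt0.
transitivity (Num.sqrt (pi / t) * Num.sqrt (4 * pi * (r + s))).
  by field; rewrite n1 n2.
transitivity (Num.sqrt (4 * pi * r) * Num.sqrt (4 * pi * s)); last by field; rewrite n3.
have h1 : 0 <= pi / t by rewrite divr_ge0 ?pi_ge0 ?ltW.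
have h2 : 0 <= 4 * pi * r by rewrite !mulr_ge0 ?pi_ge0 ?ltW.
rewrite -[LHS](sqrtrM _ h1) -[RHS](sqrtrM _ h2); congr Num.sqrt.
by rewrite /t; field; rewrite rn sn rsn.
Qed.

End heat1.

(** * Lebesgue measure on row vectors and the heat kernel *)

Section rV_integration.
Context {R : realType}.
Implicit Types n : nat.

Lemma ge0_integral_rV_cons n (f : 'rV[R]_n.+1 -> \bar R) :
  measurable_fun setT f -> (forall x, 0 <= f x)%E ->
  (\int[lebesgue_rV n.+1]_x f x =
   \int[@lebesgue_measure R]_a \int[lebesgue_rV n]_x f (cons_rV (a, x)))%E.
Proof.
move=> mf f0.
have E := @ge0_integral_pushforward _ _ _ _ R _ (@measurable_cons_rV R n)
  (lebesgue_measure \x lebesgue_rV n)%E setT f measurableT mf (fun y _ => f0 y).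
rewrite preimage_setT in E; transitivity (\int[(lebesgue_measure \x lebesgue_rV n)%E]_p
   (f \o @cons_rV R n) p)%E; first exact: E.
apply: (@fubini_tonelli1 _ _ _ _ R (@lebesgue_measure R) (lebesgue_rV n)) => //.
  by apply: measurableT_comp => //; exact: measurable_cons_rV.
by move=> p; exact: f0.
Qed.

Lemma cons_rV0 n (a : R) (x : 'rV[R]_n) : cons_rV (a, x) ord0 ord0 = a.
Proof. by rewrite mxE unlift_none. Qed.

Lemma cons_rVS n (a : R) (x : 'rV[R]_n) i : cons_rV (a, x) ord0 (lift ord0 i) = x ord0 i.
Proof. by rewrite mxE liftK. Qed.

Lemma integral_rV0 (f : 'rV[R]_0 -> \bar R) : measurable_fun setT f ->
  (\int[lebesgue_rV 0]_x f x = f 0%R)%E.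
Proof. by move=> mf; rewrite /= integral_dirac// diracT mul1e. Qed.

Lemma measurable_prod_coord n (f : 'I_n -> R -> R) :
  (forall i, measurable_fun [set: R] (f i)) ->
  measurable_fun [set: 'rV[R]_n] (fun x => \prod_i f i (x ord0 i)).
Proof.
move=> mf; under eq_fun do rewrite -big_enum.
elim: (enum _) => [|i s ih].
  by under eq_fun do rewrite big_nil; exact: measurable_cst.
under eq_fun do rewrite big_cons; apply: measurable_funM => //.
by apply: (measurableT_comp (mf i)); exact: measurable_coord.
Qed.

Lemma ge0_integral_prod_coord n (f : 'I_n -> R -> R) (c : 'I_n -> R) :
  (forall i, measurable_fun [set: R] (f i)) -> (forall i a, 0 <= f i a) ->
  (forall i, \int[@lebesgue_measure R]_a (f i a)%:E = (c i)%:E)%E ->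
  (\int[lebesgue_rV n]_x (\prod_i f i (x ord0 i))%:E = (\prod_i c i)%:E)%E.
Proof.
elim: n f c => [|n ih] f c mf f0 fc.
  by rewrite integral_rV0 ?big_ord0//; apply/measurable_EFinP; exact: measurable_prod_coord.
have p0 m (g : 'I_m -> R -> R) (x : 'rV[R]_m) : (forall i a, 0 <= g i a) ->
    0 <= \prod_i g i (x ord0 i) by move=> g0; apply: prodr_ge0 => i _; exact: g0.
rewrite ge0_integral_rV_cons; last 2 first.
- by apply/measurable_EFinP; exact: measurable_prod_coord.
- by move=> x; rewrite lee_fin p0.
pose g i := f (lift ord0 i).
have c0 i : 0 <= c i.
  by rewrite -lee_fin -fc integral_ge0// => a _; rewrite lee_fin.
transitivity (\int[@lebesgue_measure R]_a ((\prod_i c (lift ord0 i)) * f ord0 a)%:E)%E.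
  apply: eq_integral => a _.
  under eq_integral => x _.
    rewrite big_ord_recl cons_rV0; under eq_bigr do rewrite cons_rVS.
    over.
  rewrite ge0_RZl//; last 2 first.
  - by apply: (@measurable_prod_coord n g) => i; exact: mf.
  - by move=> x; apply: prodr_ge0 => i _; exact: f0.
  by rewrite (ih g _ (fun i => mf _) (fun i => f0 _) (fun i => fc _)) -EFinM mulrC.
rewrite ge0_RZl//; last 2 first.
- exact: mf.
- by apply: prodr_ge0 => i _; exact: c0.
by rewrite fc -EFinM [in RHS]big_ord_recl mulrC.
Qed.

Lemma continuous_rV_dist n (f : 'rV[R]_n -> R) (x : 'rV[R]_n) : continuous f ->
  forall e : R, 0 < e -> exists2 d : R, 0 < d &
    forall y : 'rV[R]_n, (forall i, `|x ord0 i - y ord0 i| < d) -> `|f x - f y| < e.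
Proof.
move=> cf e e0; have /cvgrPdist_lt/(_ _ e0) := cf x.
move=> /nbhs_ballP[d /= d0 h]; exists d => // y xy; apply: h; split => // i j.
by rewrite (ord1 i); exact: xy.
Qed.

(* A continuous function is the limit of its compositions with the rounding of
   all coordinates to multiples of [1 / m], which take countably many values. *)
Lemma continuous_rV_measurable n (f : 'rV[R]_n -> R) :
  continuous f -> measurable_fun setT f.
Proof.
move=> cf.
pose k (m : nat) (x : 'rV[R]_n) : 'rV[int]_n := \row_i Num.floor (x ord0 i * m.+1%:R).
pose r (m : nat) (z : 'rV[int]_n) : 'rV[R]_n := \row_i ((z ord0 i)%:~R / m.+1%:R).
have mk m z : measurable [set x | k m x = z].
  rewrite (_ : [set x | _] = \bigcap_(i in [set: 'I_n])
      [set x : 'rV[R]_n | (z ord0 i)%:~R <= x ord0 i * m.+1%:R < (z ord0 i + 1)%:~R]); last first.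
    apply/seteqP; split => x /=.
      by move=> <- i _ /=; rewrite mxE; exact: floor_itv.
    move=> h; apply/rowP => i; rewrite mxE; apply/floor_def; exact: h.
  apply: fin_bigcap_measurable => // i _.
  rewrite (_ : mkset _ = (fun x : 'rV[R]_n => x ord0 i * m.+1%:R) @^-1`
     `[(z ord0 i)%:~R, (z ord0 i + 1)%:~R[); last first.
    by apply/seteqP; split => x /=; rewrite in_itv.
  rewrite -[X in measurable X]setTI; apply: measurable_funM => //.
  exact: measurable_coord.
apply: (@measurable_fun_cvg _ _ _ _ (fun m x => f (r m (k m x)))).
  move=> m _ Y mY; rewrite setTI.
  rewrite (_ : _ @^-1` Y = \bigcup_j (if unpickle j is Some z then
     (if f (r m z) \in Y then [set x | k m x = z] else set0) else set0)).
    apply: bigcup_measurable => j _; case: unpickle => // z; case: ifP => // _.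
  apply/seteqP; split => x /=.
    move=> xY; exists (pickle (k m x)) => //; rewrite pickleK.
    by rewrite mem_set.
  by move=> [j _]; case: unpickle => // z; case: ifPn => // zY xz; rewrite xz -in_setE.
move=> x _; apply/cvgrPdist_lt => e e0.
have [d d0 h] := continuous_rV_dist x cf e0.
near=> m; apply: h => i; rewrite !mxE.
have /andP[h1 h2] := floor_itv (x ord0 i * m.+1%:R).
rewrite ger0_norm; last by rewrite subr_ge0 ler_pdivrMr.
apply: (@lt_trans _ _ (m.+1%:R^-1)).
  rewrite ltrBlDl -[X in _ < _ + X]mul1r -mulrDl ltr_pdivlMr//.
  by move: h2; rewrite intrD.
near: m; have /cvgrPdist_lt/(_ _ d0) := @cvg_harmonic R.
by apply: filterS => m; rewrite sub0r normrN ger0_norm ?harmonic_ge0.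
Unshelve. all: by end_near. Qed.

Definition n2 n (x : 'rV[R]_n) : R := \sum_i x ord0 i ^+ 2.

Lemma n2_ge0 n (x : 'rV[R]_n) : 0 <= n2 x.
Proof. by apply: sumr_ge0 => i _; exact: sqr_ge0. Qed.

Lemma n2N n (x : 'rV[R]_n) : n2 (- x) = n2 x.
Proof. by apply: eq_bigr => i _; rewrite mxE sqrrN. Qed.

Lemma n2_gt0 n (x : 'rV[R]_n) : x != 0 -> 0 < n2 x.
Proof.
move=> x0; rewrite lt_neqAle n2_ge0 andbT eq_sym; apply: contra x0 => /eqP h.
apply/eqP/rowP => i; rewrite mxE; apply/eqP; rewrite -sqrf_eq0; apply/eqP.
exact: (psumr_eq0P (fun i _ => sqr_ge0 (x ord0 i)) h).
Qed.

Lemma n2_0 n : n2 (0 : 'rV[R]_n) = 0.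
Proof. by rewrite /n2 big1// => i _; rewrite mxE expr0n. Qed.

Lemma measurable_n2 n : measurable_fun [set: 'rV[R]_n] (@n2 n).
Proof.
apply: measurable_sum => i; apply: measurable_funX.
exact: measurable_coord.
Qed.

Lemma measurable_rVB n :
  measurable_fun [set: 'rV[R]_n * 'rV[R]_n] (fun p => p.1 - p.2).
Proof.
apply: measurable_fun_rV => i; under eq_fun do rewrite !mxE.
apply: measurable_funB; apply: (measurableT_comp (measurable_coord i)) => //.
Qed.

Lemma measurable_dotp n :
  measurable_fun [set: 'rV[R]_n * 'rV[R]_n] (fun p => dotp p.1 p.2).
Proof.
apply: measurable_sum => i.
by apply: measurable_funM; apply: (measurableT_comp (measurable_coord i)).
Qed.

Definition hk n r (x : 'rV[R]_n) : R := \prod_i hk1 r (x ord0 i).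

Lemma hkE n r (x : 'rV[R]_n) :
  hk r x = (Num.sqrt (4 * pi * r))^-1 ^+ n * expR (- (n2 x / (4 * r))).
Proof.
rewrite /hk /hk1 big_split/= prodr_const card_ord; congr (_ * _).
by rewrite -expR_sum /n2 mulr_suml sumrN.
Qed.

Lemma hk_ge0 n r (x : 'rV[R]_n) : 0 <= hk r x.
Proof. by apply: prodr_ge0 => i _; exact: hk1_ge0. Qed.

Lemma hkN n r (x : 'rV[R]_n) : hk r (- x) = hk r x.
Proof. by rewrite !hkE n2N. Qed.

Lemma hkC n r (x y : 'rV[R]_n) : hk r (x - y) = hk r (y - x).
Proof. by rewrite -hkN opprB. Qed.

Lemma measurable_hk n :
  measurable_fun [set: R * 'rV[R]_n] (fun p => hk p.1 p.2).
Proof.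
under eq_fun do rewrite hkE.
have m4 : measurable_fun [set: R * 'rV[R]_n] (fun p => (4 * p.1)^-1).
  apply: (measurableT_comp (@measurable_invr R)).
  by apply: measurable_funM.
apply: measurable_funM.
  apply: measurable_funX; apply: (measurableT_comp (@measurable_invr R)).
  apply: measurableT_comp.
    by apply: continuous_measurable_fun; exact: sqrt_continuous.
  by apply: measurable_funM.
apply: measurableT_comp => //; apply: measurableT_comp => //.
apply: measurable_funM; last exact: m4.
by apply: (measurableT_comp (@measurable_n2 n)).
Qed.

Lemma measurable_hkr n r : measurable_fun [set: 'rV[R]_n] (@hk n r).
Proof. exact: (measurableT_comp (@measurable_hk n) (measurable_pair1 r)). Qed.

Lemma measurable_hkB n r :
  measurable_fun [set: 'rV[R]_n * 'rV[R]_n] (fun p => hk r (p.1 - p.2)).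
Proof.
exact: (measurableT_comp (measurable_hkr r) (@measurable_rVB n)).
Qed.

Lemma measurable_hk1 r : measurable_fun [set: R] (hk1 r).
Proof.
apply: measurable_funM => //; apply: measurableT_comp => //.
apply: measurableT_comp => //; apply: measurable_funM => //.
Qed.

Lemma measurable_hk1B r a : measurable_fun [set: R] (fun x => hk1 r (x - a)).
Proof. by apply: (measurableT_comp (measurable_hk1 r)); exact: measurable_funB. Qed.

Lemma hk1N r (a : R) : hk1 r (- a) = hk1 r a.
Proof. by rewrite /hk1 sqrrN. Qed.

Lemma integral_hk n r (y : 'rV[R]_n) : 0 < r ->
  (\int[lebesgue_rV n]_x (hk r (x - y))%:E = 1)%E.
Proof.
move=> r0.
have := @ge0_integral_prod_coord n (fun i a => hk1 r (a - y ord0 i)) (fun=> 1)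
  (fun i => measurable_hk1B r _) (fun i a => hk1_ge0 r _) (fun i => integral_hk1 _ r0).
rewrite big1// => h; rewrite -[RHS]h; apply: eq_integral => x _; congr EFin.
by apply: eq_bigr => i _; rewrite !mxE.
Qed.

Lemma integral_hk_conv n r s (x : 'rV[R]_n) : 0 < r -> 0 < s ->
  (\int[lebesgue_rV n]_y (hk r (x - y) * hk s y)%:E = (hk (r + s) x)%:E)%E.
Proof.
move=> r0 s0.
have mf (i : 'I_n) : measurable_fun [set: R] (fun a => hk1 r (x ord0 i - a) * hk1 s a).
  apply: measurable_funM; last exact: measurable_hk1.
  by under eq_fun do rewrite -hk1N opprB; exact: measurable_hk1B.
rewrite /hk -(@ge0_integral_prod_coord n _ _ mf).
- by apply: eq_integral => y _; rewrite -big_split; congr EFin; apply: eq_bigr => i _; rewrite !mxE.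
- by move=> i a; rewrite mulr_ge0 ?hk1_ge0.
- by move=> i; rewrite integral_hk1_conv.
Qed.

Definition gs n t (x : 'rV[R]_n) : R := expR (- (t * n2 x)).

Lemma gs_ge0 n t (x : 'rV[R]_n) : 0 <= gs t x.
Proof. exact: expR_ge0. Qed.

Lemma gs_le1 n t (x : 'rV[R]_n) : 0 <= t -> gs t x <= 1.
Proof. by move=> t0; rewrite -expR0 ler_expR oppr_le0 mulr_ge0// n2_ge0. Qed.

Lemma measurable_gsp n : measurable_fun [set: R * 'rV[R]_n] (fun p => gs p.1 p.2).
Proof.
apply: measurableT_comp => //; apply: measurableT_comp => //.
by apply: measurable_funM => //; apply: (measurableT_comp (@measurable_n2 n)).
Qed.

Lemma measurable_gs n t : measurable_fun [set: 'rV[R]_n] (gs t).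
Proof.
apply: measurableT_comp => //; apply: measurableT_comp => //.
by apply: measurable_funM => //; exact: measurable_n2.
Qed.

Lemma integral_gs n t : 0 < t ->
  (\int[lebesgue_rV n]_x (gs t x)%:E = (Num.sqrt (pi / t) ^+ n)%:E)%E.
Proof.
move=> t0.
have mf (i : 'I_n) : measurable_fun [set: R] (fun a => expR (- (t * a ^+ 2))).
  by have := measurable_gauss t 0; under eq_fun do rewrite subr0.
have h (i : 'I_n) : (\int[@lebesgue_measure R]_a (expR (- (t * a ^+ 2)))%:E = (Num.sqrt (pi / t))%:E)%E.
  by have := integral_gauss 0 t0; under eq_integral do rewrite subr0.
have := ge0_integral_prod_coord mf (fun i a => expR_ge0 _) h.
rewrite prodr_const card_ord => <-; apply: eq_integral => x _; congr EFin.
by rewrite -expR_sum /gs /n2 mulr_sumr sumrN.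
Qed.

Lemma integrable_gs n t : 0 < t ->
  (lebesgue_rV n).-integrable setT (fun x : 'rV[R]_n => (gs t x)%:E).
Proof.
move=> t0; apply/integrableP; split; first by apply/measurable_EFinP; exact: measurable_gs.
under eq_integral do rewrite gee0_abs ?lee_fin ?gs_ge0//.
by rewrite integral_gs// ltry.
Qed.

End rV_integration.

Lemma EFin_Rintegral (d : measure_display) (T : measurableType d) (R : realType)
    (m : {measure set T -> \bar R}) (f : T -> R) :
  m.-integrable setT (fun x => (f x)%:E) ->
  (\int[m]_x (f x)%:E = (\int[m]_x f x)%:E)%E.
Proof. by move=> i; rewrite /Rintegral fineK//; exact: integrable_fin_num. Qed.

Lemma integrableZlR (d : measure_display) (T : measurableType d) (R : realType)
    (m : {measure set T -> \bar R}) (k : R) (f : T -> R) :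
  m.-integrable setT (fun x => (f x)%:E) ->
  m.-integrable setT (fun x => (k * f x)%:E).
Proof. by move=> i; have := integrableZl measurableT k i; apply: eq_integrable. Qed.

Lemma le_integrableR (d : measure_display) (T : measurableType d) (R : realType)
    (m : {measure set T -> \bar R}) (f g : T -> R) :
  measurable_fun setT f -> (forall x, `|f x| <= g x) ->
  m.-integrable setT (fun x => (g x)%:E) -> m.-integrable setT (fun x => (f x)%:E).
Proof.
move=> mf fg; apply: le_integrable => //; first exact/measurable_EFinP.
by move=> x _; rewrite !abse_EFin lee_fin (le_trans (fg x))// ler_norm.
Qed.

(** * Cosine transforms of Gaussians in n variables *)

Section gauss_cos.
Context {R : realType}.
Implicit Types n : nat.

Let integral_gauss1_cos (t k c e : R) : 0 < t ->
  (\int[@lebesgue_measure R]_x (expR (- (t * x ^+ 2)) * (1 + e * cos (k * x + c)))%:E =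
   (Num.sqrt (pi / t) * (1 + e * expR (- (k ^+ 2 / (4 * t))) * cos c))%:E)%E.
Proof.
move=> t0.
pose g (x : R) := expR (- (t * x ^+ 2)).
have mg : measurable_fun [set: R] g.
  by have := measurable_gauss t 0; under eq_fun do rewrite subr0.
have ig : (@lebesgue_measure R).-integrable setT (fun x => (g x)%:E).
  by have := integrable_gauss 0 t0; apply: eq_integrable => // x _; rewrite subr0.
have mc : measurable_fun [set: R] (fun x => cos (k * x + c)).
  apply: (measurableT_comp (continuous_measurable_fun (@continuous_cos R))).
  by apply: measurable_funD => //; apply: measurable_funM.
have ic : (@lebesgue_measure R).-integrable setT (fun x => (g x * cos (k * x + c))%:E).
  apply: le_integrableR ig; first exact: measurable_funM.
  move=> x; rewrite normrM ger0_norm ?expR_ge0// ler_piMr ?expR_ge0//.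
  by rewrite ler_norml cos_geN1 cos_le1.
have iec := integrableZlR e ic.
transitivity (\int[@lebesgue_measure R]_x ((g x)%:E + (e * (g x * cos (k * x + c)))%:E))%E.
  by apply: eq_integral => x _; rewrite -EFinD /g; congr EFin; ring.
rewrite integralD//= (EFin_Rintegral iec) RintegralZl// Rintegral_gauss_cosD//.
have -> : (\int[@lebesgue_measure R]_x (g x)%:E = (Num.sqrt (pi / t))%:E)%E.
  by have := integral_gauss 0 t0 => <-; apply: eq_integral => x _; rewrite subr0.
by rewrite -EFinD; congr EFin; ring.
Qed.

(** Adding 1 to the cosine makes the integrand nonnegative, so that the coordinates are split off
    one at a time by Tonelli. The phase absorbs the outer coordinate, and the exponential already
    produced becomes the coefficient [e] of [integral_gauss1_cos]. *)
Lemma integral_gs_cos1 n t (k : 'rV[R]_n) c : 0 < t ->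
  (\int[lebesgue_rV n]_x (gs t x * (1 + cos (dotp k x + c)))%:E =
   (Num.sqrt (pi / t) ^+ n * (1 + expR (- (n2 k / (4 * t))) * cos c))%:E)%E.
Proof.
move=> t0.
have m n' (k' : 'rV[R]_n') c' : measurable_fun [set: 'rV[R]_n']
    (fun x => gs t x * (1 + cos (dotp k' x + c'))).
  apply: measurable_funM; first exact: measurable_gs.
  apply: measurable_funD => //.
  apply: (measurableT_comp (continuous_measurable_fun (@continuous_cos R))).
  apply: measurable_funD => //.
  exact: (measurableT_comp (@measurable_dotp R n') (measurable_pair1 k')).
have p n' (k' x : 'rV[R]_n') c' : 0 <= gs t x * (1 + cos (dotp k' x + c')).
  by rewrite mulr_ge0 ?gs_ge0// -lerBlDl sub0r cos_geN1.
elim: n k c => [|n ih] k c.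
  rewrite integral_rV0; last by apply/measurable_EFinP; exact: m.
  by rewrite /gs /dotp /n2 !big_ord0 mulr0 mul0r oppr0 expR0 add0r expr0 !mul1r.
rewrite ge0_integral_rV_cons; last 2 first.
- by apply/measurable_EFinP; exact: m.
- by move=> x; rewrite lee_fin.
pose k' : 'rV[R]_n := \row_j k ord0 (lift ord0 j).
have gE a (x : 'rV[R]_n) : gs t (cons_rV (a, x)) = expR (- (t * a ^+ 2)) * gs t x.
  have nE' : n2 (cons_rV (a, x)) = a ^+ 2 + n2 x.
    rewrite /n2 big_ord_recl cons_rV0; congr (_ + _).
    by apply: eq_bigr => i _; rewrite cons_rVS.
  by rewrite /gs nE' -expRD mulrDr opprD.
have dE a (x : 'rV[R]_n) : dotp k (cons_rV (a, x)) = k ord0 ord0 * a + dotp k' x.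
  rewrite /dotp big_ord_recl cons_rV0; congr (_ + _).
  by apply: eq_bigr => i _; rewrite cons_rVS mxE.
have nE : n2 k = k ord0 ord0 ^+ 2 + n2 k'.
  by rewrite /n2 big_ord_recl; congr (_ + _); apply: eq_bigr => i _; rewrite mxE.
transitivity (\int[@lebesgue_measure R]_a (Num.sqrt (pi / t) ^+ n * (expR (- (t * a ^+ 2)) *
    (1 + expR (- (n2 k' / (4 * t))) * cos (k ord0 ord0 * a + c))))%:E)%E.
  apply: eq_integral => a _.
  transitivity (\int[lebesgue_rV n]_x (expR (- (t * a ^+ 2)) *
      (gs t x * (1 + cos (dotp k' x + (k ord0 ord0 * a + c)))))%:E)%E.
    apply: eq_integral => x _; rewrite gE dE -mulrA; congr (_ * (_ * (1 + cos _)))%:E.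
    by ring.
  rewrite ge0_RZl ?expR_ge0//; [|exact: m].
  by rewrite ih -EFinM; congr EFin; ring.
have m1 : measurable_fun [set: R] (fun a => expR (- (t * a ^+ 2)) *
    (1 + expR (- (n2 k' / (4 * t))) * cos (k ord0 ord0 * a + c))).
  apply: measurable_funM.
    by have := measurable_gauss t 0; under eq_fun do rewrite subr0.
  apply: measurable_funD => //; apply: measurable_funM => //.
  apply: (measurableT_comp (continuous_measurable_fun (@continuous_cos R))).
  by apply: measurable_funD => //; apply: measurable_funM.
rewrite ge0_RZl; last 3 first.
- exact: m1.
- move=> a; rewrite mulr_ge0 ?expR_ge0//.
  have e1 : expR (- (n2 k' / (4 * t))) <= 1.
    by rewrite -expR0 ler_expR oppr_le0 divr_ge0 ?n2_ge0 ?mulr_ge0 ?(ltW t0).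
  have e0 := expR_ge0 (- (n2 k' / (4 * t))).
  by have := cos_geN1 (k ord0 ord0 * a + c); nra.
- by rewrite exprn_ge0 ?sqrtr_ge0.
rewrite integral_gauss1_cos// -EFinM (exprSr _ n) -expRD -[in RHS]mulrA; congr (_ * (_ * (1 + expR _ * _)))%:E.
by rewrite nE; ring.
Qed.

Lemma integrable_gs_cos n t (k : 'rV[R]_n) c : 0 < t ->
  (lebesgue_rV n).-integrable setT (fun x : 'rV[R]_n => (gs t x * cos (dotp k x + c))%:E).
Proof.
move=> t0; apply: le_integrableR (integrable_gs n t0).
  apply: measurable_funM; first exact: measurable_gs.
  apply: (measurableT_comp (continuous_measurable_fun (@continuous_cos R))).
  apply: measurable_funD => //.
  exact: (measurableT_comp (@measurable_dotp R n) (measurable_pair1 k)).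
move=> x; rewrite normrM ger0_norm ?gs_ge0// ler_piMr ?gs_ge0//.
by rewrite ler_norml cos_geN1 cos_le1.
Qed.

Lemma Rintegral_gs_cos n t (k : 'rV[R]_n) c : 0 < t ->
  \int[lebesgue_rV n]_x (gs t x * cos (dotp k x + c)) =
  (2 * pi) ^+ n * hk t k * cos c.
Proof.
move=> t0; have ic := integrable_gs_cos k c t0; have ig := integrable_gs n t0.
have := integral_gs_cos1 k c t0.
have -> : (\int[lebesgue_rV n]_x (gs t x * (1 + cos (dotp k x + c)))%:E =
    \int[lebesgue_rV n]_x ((gs t x)%:E + (gs t x * cos (dotp k x + c))%:E))%E.
  by apply: eq_integral => x _; rewrite -EFinD mulrDr mulr1.
rewrite integralD//= integral_gs// (EFin_Rintegral ic) -EFinD => -[].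
rewrite mulrDr mulr1 => /addrI ->; rewrite hkE !mulrA; congr (_ * _ * _).
rewrite -exprMn; congr (_ ^+ _).
have p0 := @pi_gt0 R.
apply: (@mulIf _ (Num.sqrt (4 * pi * t))); first by rewrite gt_eqF// sqrtr_gt0 !mulr_gt0.
rewrite mulfVK ?gt_eqF ?sqrtr_gt0 ?mulr_gt0// -sqrtrM ?divr_ge0 ?ltW//.
have -> : pi / t * (4 * pi * t) = (2 * pi) ^+ 2 by field; rewrite gt_eqF.
by rewrite sqrtr_sqr ger0_norm// mulr_ge0 ?ltW.
Qed.

End gauss_cos.

(** * Gaussian-regularized Fourier inversion and Parseval formulas *)

Section fubini_kernel.
Context (d1 d2 : measure_display) (X : measurableType d1) (Y : measurableType d2)
  (R : realType) (m1 : {sigma_finite_measure set X -> \bar R})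
  (m2 : {sigma_finite_measure set Y -> \bar R}).

Lemma measurable_Rintegral_fst (f : X -> Y -> R) :
  measurable_fun [set: X * Y] (fun p => f p.1 p.2) ->
  measurable_fun setT (fun y => \int[m1]_x f x y).
Proof.
move=> mf; pose g (p : X * Y) := (f p.1 p.2)%:E.
have mg : measurable_fun setT g by exact/measurable_EFinP.
rewrite /Rintegral; apply: (measurableT_comp (fine_measurable measurableT)).
have -> : (fun y => \int[m1]_x (f x y)%:E)%E =
    (fun y => \int[m1]_x (g^\+ (x, y)) - \int[m1]_x (g^\- (x, y)))%E.
  apply/funext => y; rewrite integralE.
  by congr (_ - _)%E; apply: eq_integral => x _; rewrite ?funeposE ?funenegE.
apply: emeasurable_funB.
  by apply: (@measurable_fun_fubini_tonelli_G _ _ _ _ _ m1 (g^\+)%E) => //; exact: measurable_funepos.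
by apply: (@measurable_fun_fubini_tonelli_G _ _ _ _ _ m1 (g^\-)%E) => //; exact: measurable_funeneg.
Qed.

Variables (f : X -> R) (h : Y -> R) (k : X -> Y -> R) (L : R).
Hypothesis if1 : m1.-integrable setT (fun x => (f x)%:E).
Hypothesis ih : m2.-integrable setT (fun y => (h y)%:E).
Hypothesis mk : measurable_fun [set: X * Y] (fun p => k p.1 p.2).
Hypothesis kL : forall x y, `|k x y| <= L.

Let mf : measurable_fun setT f.
Proof. by apply/measurable_EFinP; exact: measurable_int if1. Qed.

Let mh : measurable_fun setT h.
Proof. by apply/measurable_EFinP; exact: measurable_int ih. Qed.

Let mkx x : measurable_fun setT (k x).
Proof. exact: (measurableT_comp mk (measurable_pair1 x)). Qed.

Let mky y : measurable_fun setT (fun x => k x y).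
Proof. exact: (measurableT_comp mk (measurable_pair2 y)). Qed.

Let inf : m1.-integrable setT (fun x => (L * `|f x|)%:E).
Proof. by apply: integrableZlR; have := integrable_abse if1. Qed.

Lemma integrable_kernel_fst y : m1.-integrable setT (fun x => (f x * k x y)%:E).
Proof.
apply: le_integrableR inf; first exact: measurable_funM.
by move=> x; rewrite normrM mulrC ler_wpM2r.
Qed.

Lemma integrable_kernel_snd x : m2.-integrable setT (fun y => (h y * k x y)%:E).
Proof.
have i : m2.-integrable setT (fun y => (L * `|h y|)%:E).
  by apply: integrableZlR; have := integrable_abse ih.
apply: le_integrableR i; first exact: measurable_funM.
by move=> y; rewrite normrM mulrC ler_wpM2r.
Qed.

Lemma normr_Rintegral_kernel y : `|\int[m1]_x (f x * k x y)| <= L * \int[m1]_x `|f x|.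
Proof.
have i := integrable_kernel_fst y.
apply: (le_trans (le_normr_Rintegral measurableT i)).
rewrite -RintegralZl//; last by have := integrable_abse if1.
apply: le_Rintegral => //; first by have := integrable_abse i.
by move=> x _; rewrite normrM mulrC ler_wpM2r.
Qed.

Lemma integrable_Rintegral_kernel :
  m2.-integrable setT (fun y => (h y * \int[m1]_x (f x * k x y))%:E).
Proof.
have i : m2.-integrable setT (fun y => ((L * \int[m1]_x `|f x|) * `|h y|)%:E).
  by apply: integrableZlR; have := integrable_abse ih.
apply: le_integrableR i.
  apply: measurable_funM => //; apply: measurable_Rintegral_fst.
  by apply: measurable_funM => //; exact: measurableT_comp.
by move=> y; rewrite normrM mulrC ler_wpM2r// normr_Rintegral_kernel.
Qed.

(** The triple product is dominated by L |f| |h| and hence integrable on the product space, so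
    Fubini applies. The kernel [k] will be a cosine, or the integral [Kc] of cosines. *)
Lemma Rintegral_kernel_swap :
  \int[m2]_y (h y * \int[m1]_x (f x * k x y)) =
  \int[m1]_x (f x * \int[m2]_y (h y * k x y)).
Proof.
pose F (p : X * Y) := (h p.2 * f p.1 * k p.1 p.2)%:E.
have mF : measurable_fun setT F.
  apply/measurable_EFinP; apply: measurable_funM => //.
  by apply: measurable_funM; [exact: (measurableT_comp mh)|exact: (measurableT_comp mf)].
have iF : (m1 \x m2)%E.-integrable setT F.
  apply/(@integrable12ltyP _ _ _ _ _ m1 m2 F mF).
  apply: (@le_lt_trans _ _ (\int[m1]_x (((\int[m2]_y `|h y|) * (L * `|f x|))%:E))%E); last first.
    have i := integrableZlR (\int[m2]_y `|h y|) inf.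
    by rewrite (EFin_Rintegral i) ltry.
  apply: ge0_le_integral => //.
  - by move=> x _; exact: integral_ge0.
  - apply: (@measurable_fun_fubini_tonelli_F _ _ _ _ _ m2 (abse \o F)) => [|p]; last exact: abse_ge0.
    exact: measurableT_comp.
  - have i := integrableZlR (\int[m2]_y `|h y|) inf; exact: measurable_int i.
  - move=> x _.
    have iy : m2.-integrable setT (fun y => (L * `|f x| * `|h y|)%:E).
      by apply: integrableZlR; have := integrable_abse ih.
    rewrite mulrC -RintegralZl//; last by have := integrable_abse ih.
    rewrite -EFin_Rintegral//; apply: ge0_le_integral => //.
    + by apply: measurableT_comp => //; exact: (measurableT_comp mF (measurable_pair1 x)).
    + exact: measurable_int iy.
    + move=> y _; rewrite abse_EFin lee_fin !normrM.
      have -> : L * `|f x| * `|h y| = `|h y| * `|f x| * L by ring.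
      by rewrite ler_wpM2l ?mulr_ge0.
have E := @Fubini _ _ _ _ _ m1 m2 F iF.
rewrite /Rintegral; congr fine; symmetry.
transitivity (\int[m1]_x \int[m2]_y F (x, y))%E.
  apply: eq_integral => x _; rewrite EFinM -/(Rintegral _ _ _).
  have i := integrable_kernel_snd x.
  rewrite -(EFin_Rintegral i) -integralZl//.
  by apply: eq_integral => y _; rewrite -EFinM /F/=; congr EFin; ring.
rewrite E; apply: eq_integral => y _; rewrite EFinM -/(Rintegral _ _ _).
have i := integrable_kernel_fst y.
rewrite -(EFin_Rintegral i) -integralZl//.
by apply: eq_integral => x _; rewrite -EFinM /F/=; congr EFin; ring.
Qed.

End fubini_kernel.

(** * Cosine and sine transforms of integrable functions *)

Section fourier_real.
Context {R : realType} (n : nat).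
Local Notation mu := (@lebesgue_rV R n).
Local Notation V := 'rV[R]_n.
Local Notation L1 f := (mu.-integrable setT (fun x => (f x)%:E)).
Implicit Types (f g u v : V -> R) (e t c : R).

(** Unnormalized cosine and sine transforms. Fourier analysis is done on real functions; a
    complex-valued function is a pair of them. *)
Definition fc f (xi : V) : R := \int[mu]_x (f x * cos (dotp xi x)).
Definition fs f (xi : V) : R := \int[mu]_x (f x * sin (dotp xi x)).
Definition hconv e f (y : V) : R := \int[mu]_x (f x * hk e (x - y)).

Lemma dotpC (x y : V) : dotp x y = dotp y x.
Proof. by apply: eq_bigr => i _; rewrite mulrC. Qed.

Lemma dotpBl (x y z : V) : dotp (x - y) z = dotp x z - dotp y z.
Proof. by rewrite /dotp -sumrB; apply: eq_bigr => i _; rewrite !mxE mulrBl. Qed.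

Let mcosp : measurable_fun [set: V * V] (fun p => cos (dotp p.1 p.2)).
Proof.
exact: (measurableT_comp (continuous_measurable_fun (@continuous_cos R)) (@measurable_dotp R n)).
Qed.

Let msinp : measurable_fun [set: V * V] (fun p => sin (dotp p.1 p.2)).
Proof.
exact: (measurableT_comp (continuous_measurable_fun (@continuous_sin R)) (@measurable_dotp R n)).
Qed.

Let cosb (a : R) : `|cos a| <= 1. Proof. by rewrite ler_norml cos_geN1 cos_le1. Qed.
Let sinb (a : R) : `|sin a| <= 1. Proof. by rewrite ler_norml sin_geN1 sin_le1. Qed.

Lemma integrable_cosM f y : L1 f -> L1 (fun x => f x * cos (dotp y x)).
Proof.
move=> i; have := @integrable_kernel_fst _ _ _ _ _ mu f (fun x y => cos (dotp y x)) 1 i.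
apply=> [|? ?]; last exact: cosb.
by under eq_fun do rewrite dotpC; exact: mcosp.
Qed.

Lemma integrable_sinM f y : L1 f -> L1 (fun x => f x * sin (dotp y x)).
Proof.
move=> i; have := @integrable_kernel_fst _ _ _ _ _ mu f (fun x y => sin (dotp y x)) 1 i.
apply=> [|? ?]; last exact: sinb.
by under eq_fun do rewrite dotpC; exact: msinp.
Qed.

Lemma measurable_fc f : L1 f -> measurable_fun setT (fc f).
Proof.
move=> i; apply: (@measurable_Rintegral_fst _ _ _ _ _ mu).
apply: measurable_funM.
  apply: (measurableT_comp (f := f)) => //.
  by apply/measurable_EFinP; exact: measurable_int i.
by under eq_fun do rewrite dotpC; exact: mcosp.
Qed.

Lemma measurable_fs f : L1 f -> measurable_fun setT (fs f).
Proof.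
move=> i; apply: (@measurable_Rintegral_fst _ _ _ _ _ mu).
apply: measurable_funM.
  apply: (measurableT_comp (f := f)) => //.
  by apply/measurable_EFinP; exact: measurable_int i.
by under eq_fun do rewrite dotpC; exact: msinp.
Qed.

Lemma fc_bound f xi : L1 f -> `|fc f xi| <= \int[mu]_x `|f x|.
Proof.
move=> i; rewrite -[leRHS]mul1r.
apply: (@normr_Rintegral_kernel _ _ _ _ _ mu f (fun x y => cos (dotp y x)) 1 i) => //.
by under eq_fun do rewrite dotpC; exact: mcosp.
Qed.

Lemma fs_bound f xi : L1 f -> `|fs f xi| <= \int[mu]_x `|f x|.
Proof.
move=> i; rewrite -[leRHS]mul1r.
apply: (@normr_Rintegral_kernel _ _ _ _ _ mu f (fun x y => sin (dotp y x)) 1 i) => //.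
by under eq_fun do rewrite dotpC; exact: msinp.
Qed.

(** The phase [c] treats two formulas at once: [c = 0] yields the cosine parts of inversion and of
    Parseval's formula, and [c = pi / 2] the sine parts, whose integrals vanish. *)
Let Kc f c (y xi : V) := \int[mu]_x (f x * cos (dotp (x - y) xi + c)).

Let KcE f c y xi : L1 f -> Kc f c y xi =
  cos c * (fc f xi * cos (dotp xi y) + fs f xi * sin (dotp xi y)) -
  sin c * (fs f xi * cos (dotp xi y) - fc f xi * sin (dotp xi y)).
Proof.
move=> i; have ic := integrable_cosM xi i; have is' := integrable_sinM xi i.
pose a := cos c * cos (dotp xi y) + sin c * sin (dotp xi y).
pose b := cos c * sin (dotp xi y) - sin c * cos (dotp xi y).
transitivity (\int[mu]_x (a * (f x * cos (dotp xi x)) + b * (f x * sin (dotp xi x)))).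
  apply: eq_Rintegral => x _; rewrite cosD dotpBl cosB sinB /a /b (dotpC x) (dotpC y); ring.
rewrite RintegralD// ?RintegralZl//; [|exact: integrableZlR|exact: integrableZlR].
rewrite -/(fc f xi) -/(fs f xi) /a /b; ring.
Qed.

Let mKc f c : L1 f -> measurable_fun [set: V * V] (fun p => Kc f c p.1 p.2).
Proof.
move=> i; under eq_fun do rewrite KcE//.
have m1 := measurableT_comp (measurable_fc i) (@measurable_snd _ _ V V).
have m2 := measurableT_comp (measurable_fs i) (@measurable_snd _ _ V V).
have m3 : measurable_fun [set: V * V] (fun p => cos (dotp p.2 p.1)).
  by under eq_fun do rewrite dotpC; exact: mcosp.
have m4 : measurable_fun [set: V * V] (fun p => sin (dotp p.2 p.1)).
  by under eq_fun do rewrite dotpC; exact: msinp.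
apply: measurable_funB; apply: measurable_funM => //.
  by apply: measurable_funD; apply: measurable_funM.
by apply: measurable_funB; apply: measurable_funM.
Qed.

Let mcosB c y : measurable_fun [set: V * V] (fun p => cos (dotp (p.1 - y) p.2 + c)).
Proof.
apply: (measurableT_comp (continuous_measurable_fun (@continuous_cos R))).
apply: measurable_funD => //; under eq_fun do rewrite dotpBl.
apply: measurable_funB; first exact: measurable_dotp.
exact: (measurableT_comp (@measurable_dotp R n) (measurableT_comp (measurable_pair1 y) measurable_snd)).
Qed.

Let Kc_bound f c y xi : L1 f -> `|Kc f c y xi| <= \int[mu]_x `|f x|.
Proof.
move=> i; rewrite -[leRHS]mul1r.
by apply: (@normr_Rintegral_kernel _ _ _ _ _ mu f
  (fun x xi => cos (dotp (x - y) xi + c)) 1 i).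
Qed.

Lemma hk_bound t (x : V) : 0 < t -> `|hk t x| <= (Num.sqrt (4 * pi * t))^-1 ^+ n.
Proof.
move=> t0; rewrite ger0_norm ?hk_ge0// hkE ler_piMr ?exprn_ge0 ?invr_ge0 ?sqrtr_ge0//.
by rewrite -expR0 ler_expR oppr_le0 divr_ge0 ?n2_ge0 ?mulr_ge0 ?(ltW t0).
Qed.

Lemma integrable_hkM f t y : 0 < t -> L1 f -> L1 (fun x => f x * hk t (x - y)).
Proof.
move=> t0 i; apply: (@integrable_kernel_fst _ _ _ _ _ mu f (fun x y : V => hk t (x - y)) _ i
  (measurable_hkB _) (fun x y : V => hk_bound (x - y) t0)).
Qed.

Lemma measurable_hconv f t : L1 f -> measurable_fun setT (hconv t f).
Proof.
move=> i; apply: (@measurable_Rintegral_fst _ _ _ _ _ mu).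
apply: measurable_funM; last exact: measurable_hkB.
apply: (measurableT_comp (f := f)) => //.
by apply/measurable_EFinP; exact: measurable_int i.
Qed.

Lemma integrable_hconvM f g t : 0 < t -> L1 f -> L1 g -> L1 (fun y => g y * hconv t f y).
Proof.
move=> t0 i ig; exact: (@integrable_Rintegral_kernel _ _ _ _ _ mu mu f g (fun x y : V => hk t (x - y)) _ i ig
  (measurable_hkB _) (fun x y : V => hk_bound (x - y) t0)).
Qed.

(** Integrate in [xi] first: the Gaussian average of the cosine of (x - y).xi + c is (2 pi)^n
    [hk t (x - y)] times cos c. *)
Let phase_inversion f c y t : 0 < t -> L1 f ->
  \int[mu]_xi (gs t xi * Kc f c y xi) = cos c * ((2 * pi) ^+ n * hconv t f y).
Proof.
move=> t0 i; have igs := integrable_gs n t0.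
rewrite (@Rintegral_kernel_swap _ _ _ _ _ mu mu f (gs t) (fun x xi => cos (dotp (x - y) xi + c)) 1 i igs (mcosB c y))//.
rewrite mulrA /hconv -RintegralZl//; last exact: integrable_hkM.
by apply: eq_Rintegral => x _; rewrite Rintegral_gs_cos//; ring.
Qed.

Let phase_parseval f g c t : 0 < t -> L1 f -> L1 g ->
  \int[mu]_xi (gs t xi * \int[mu]_y (g y * Kc f c y xi)) =
  cos c * ((2 * pi) ^+ n * \int[mu]_y (g y * hconv t f y)).
Proof.
move=> t0 i ig; have igs := integrable_gs n t0.
rewrite (@Rintegral_kernel_swap _ _ _ _ _ mu mu g (gs t) (Kc f c) _ ig igs (mKc c i)
  (fun x y => Kc_bound c x y i)).
transitivity (\int[mu]_y ((cos c * (2 * pi) ^+ n) * (g y * hconv t f y))); last first.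
  by rewrite RintegralZl ?mulrA//; exact: integrable_hconvM.
apply: eq_Rintegral => y _.
by rewrite phase_inversion//; ring.
Qed.

Let integrable_gsKc f c y t : 0 < t -> L1 f -> L1 (fun xi => gs t xi * Kc f c y xi).
Proof.
move=> t0 i; exact: (@integrable_Rintegral_kernel _ _ _ _ _ mu mu f (gs t)
  (fun x xi => cos (dotp (x - y) xi + c)) 1 i (integrable_gs n t0) (mcosB c y)).
Qed.

Lemma inversion_cos f y t : 0 < t -> L1 f ->
  L1 (fun xi => gs t xi * (fc f xi * cos (dotp xi y) + fs f xi * sin (dotp xi y))) /\
  \int[mu]_xi (gs t xi * (fc f xi * cos (dotp xi y) + fs f xi * sin (dotp xi y))) =
  (2 * pi) ^+ n * hconv t f y.
Proof.
move=> t0 i.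
have E xi : gs t xi * (fc f xi * cos (dotp xi y) + fs f xi * sin (dotp xi y)) =
    gs t xi * Kc f 0 y xi by rewrite KcE// cos0 sin0; ring.
split; first by under eq_fun do rewrite E; exact: integrable_gsKc.
by under eq_Rintegral do rewrite E; rewrite phase_inversion// cos0 mul1r.
Qed.

Lemma inversion_sin f y t : 0 < t -> L1 f ->
  L1 (fun xi => gs t xi * (fs f xi * cos (dotp xi y) - fc f xi * sin (dotp xi y))) /\
  \int[mu]_xi (gs t xi * (fs f xi * cos (dotp xi y) - fc f xi * sin (dotp xi y))) = 0.
Proof.
move=> t0 i.
have E xi : gs t xi * (fs f xi * cos (dotp xi y) - fc f xi * sin (dotp xi y)) =
    -1 * (gs t xi * Kc f (pi / 2) y xi) by rewrite KcE// cos_pihalf sin_pihalf; ring.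
have ik := integrable_gsKc (pi / 2) y t0 i.
split; first by under eq_fun do rewrite E; exact: integrableZlR.
by under eq_Rintegral do rewrite E; rewrite RintegralZl// phase_inversion// cos_pihalf mul0r mulr0.
Qed.

Let KcgE f g c xi : L1 f -> L1 g -> \int[mu]_y (g y * Kc f c y xi) =
  cos c * (fc f xi * fc g xi + fs f xi * fs g xi) -
  sin c * (fs f xi * fc g xi - fc f xi * fs g xi).
Proof.
move=> i ig; have ic := integrable_cosM xi ig; have is' := integrable_sinM xi ig.
pose a := cos c * fc f xi - sin c * fs f xi.
pose b := cos c * fs f xi + sin c * fc f xi.
transitivity (\int[mu]_y (a * (g y * cos (dotp xi y)) + b * (g y * sin (dotp xi y)))).
  by apply: eq_Rintegral => y _; rewrite KcE// /a /b; ring.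
rewrite RintegralD// ?RintegralZl//; [|exact: integrableZlR|exact: integrableZlR].
rewrite -/(fc g xi) -/(fs g xi) /a /b; ring.
Qed.

Let integrable_gsKcg f g c t : 0 < t -> L1 f -> L1 g ->
  L1 (fun xi => gs t xi * \int[mu]_y (g y * Kc f c y xi)).
Proof.
move=> t0 i ig; exact: (@integrable_Rintegral_kernel _ _ _ _ _ mu mu g (gs t) (Kc f c) _ ig
  (integrable_gs n t0) (mKc c i) (fun x y => Kc_bound c x y i)).
Qed.

Lemma parseval_cos f g t : 0 < t -> L1 f -> L1 g ->
  L1 (fun xi => gs t xi * (fc f xi * fc g xi + fs f xi * fs g xi)) /\
  \int[mu]_xi (gs t xi * (fc f xi * fc g xi + fs f xi * fs g xi)) =
  (2 * pi) ^+ n * \int[mu]_y (g y * hconv t f y).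
Proof.
move=> t0 i ig.
have E xi : gs t xi * (fc f xi * fc g xi + fs f xi * fs g xi) =
    gs t xi * \int[mu]_y (g y * Kc f 0 y xi).
  by rewrite KcgE// cos0 sin0 mul0r subr0 mul1r.
split; first by under eq_fun do rewrite E; exact: integrable_gsKcg.
by under eq_Rintegral do rewrite E; rewrite phase_parseval// cos0 mul1r.
Qed.

Lemma parseval_sin f g t : 0 < t -> L1 f -> L1 g ->
  L1 (fun xi => gs t xi * (fs f xi * fc g xi - fc f xi * fs g xi)) /\
  \int[mu]_xi (gs t xi * (fs f xi * fc g xi - fc f xi * fs g xi)) = 0.
Proof.
move=> t0 i ig.
have E xi : gs t xi * (fs f xi * fc g xi - fc f xi * fs g xi) =
    -1 * (gs t xi * \int[mu]_y (g y * Kc f (pi / 2) y xi)).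
  by rewrite KcgE// cos_pihalf sin_pihalf mul0r; ring.
have ik := integrable_gsKcg (pi / 2) t0 i ig.
split; first by under eq_fun do rewrite E; exact: integrableZlR.
by under eq_Rintegral do rewrite E; rewrite RintegralZl// phase_parseval// cos_pihalf mul0r mulr0.
Qed.

(* The real and imaginary parts of the integral of
   [(u1 + i u2) exp (- i x xi)]. *)
Definition FA u1 u2 (xi : V) : R := fc u1 xi + fs u2 xi.
Definition FB u1 u2 (xi : V) : R := fc u2 xi - fs u1 xi.

(** The real part of the regularized Parseval formula for u1 + i u2 and v1 + i v2. The like terms
    are given by [parseval_cos]; the mixed ones pair up into the combinations killed by
    [parseval_sin]. *)
Lemma parseval u1 u2 v1 v2 t : 0 < t -> L1 u1 -> L1 u2 -> L1 v1 -> L1 v2 ->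
  L1 (fun xi => gs t xi * (FA u1 u2 xi * FA v1 v2 xi + FB u1 u2 xi * FB v1 v2 xi)) /\
  \int[mu]_xi (gs t xi * (FA u1 u2 xi * FA v1 v2 xi + FB u1 u2 xi * FB v1 v2 xi)) =
  (2 * pi) ^+ n * \int[mu]_y (v1 y * hconv t u1 y + v2 y * hconv t u2 y).
Proof.
move=> t0 iu1 iu2 iv1 iv2.
have [i1 e1] := parseval_cos t0 iu1 iv1.
have [i2 e2] := parseval_cos t0 iu2 iv2.
have [i3 e3] := parseval_sin t0 iu2 iv1.
have [i4 e4] := parseval_sin t0 iv2 iu1.
pose s1 xi := gs t xi * (fc u1 xi * fc v1 xi + fs u1 xi * fs v1 xi) +
   gs t xi * (fc u2 xi * fc v2 xi + fs u2 xi * fs v2 xi).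
pose s2 xi := gs t xi * (fs u2 xi * fc v1 xi - fc u2 xi * fs v1 xi) +
   gs t xi * (fs v2 xi * fc u1 xi - fc v2 xi * fs u1 xi).
have E xi : gs t xi * (FA u1 u2 xi * FA v1 v2 xi + FB u1 u2 xi * FB v1 v2 xi) = s1 xi + s2 xi.
  by rewrite /s1 /s2 /FA /FB; ring.
have is1 : L1 s1 by have := integrableD measurableT i1 i2; apply: eq_integrable.
have is2 : L1 s2 by have := integrableD measurableT i3 i4; apply: eq_integrable.
split.
  by under eq_fun do rewrite E; have := integrableD measurableT is1 is2; apply: eq_integrable.
under eq_Rintegral do rewrite E.
rewrite RintegralD// /s1 RintegralD// /s2 RintegralD// e1 e2 e3 e4 !addr0.
rewrite RintegralD//; [|exact: integrable_hconvM|exact: integrable_hconvM].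
by rewrite [RHS]mulrDr.
Qed.

Lemma measurable_FA u1 u2 : L1 u1 -> L1 u2 -> measurable_fun setT (FA u1 u2).
Proof. by move=> i1 i2; apply: measurable_funD; [exact: measurable_fc|exact: measurable_fs]. Qed.

Lemma measurable_FB u1 u2 : L1 u1 -> L1 u2 -> measurable_fun setT (FB u1 u2).
Proof. by move=> i1 i2; apply: measurable_funB; [exact: measurable_fc|exact: measurable_fs]. Qed.

Lemma integrable_gsF (F : V -> R) (L t : R) : 0 < t ->
  measurable_fun setT F -> (forall x, `|F x| <= L) -> L1 (fun x => gs t x * F x).
Proof.
move=> t0 mF FL; apply: le_integrableR (integrableZlR L (integrable_gs n t0)).
  by apply: measurable_funM => //; exact: measurable_gs.
by move=> x; rewrite normrM (ger0_norm (gs_ge0 _ _)) mulrC ler_wpM2r ?gs_ge0.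
Qed.

Lemma FA_bound u1 u2 xi : L1 u1 -> L1 u2 ->
  `|FA u1 u2 xi| <= \int[mu]_x `|u1 x| + \int[mu]_x `|u2 x|.
Proof.
by move=> i1 i2; rewrite (le_trans (ler_normD _ _))// lerD ?fc_bound ?fs_bound.
Qed.

Lemma FB_bound u1 u2 xi : L1 u1 -> L1 u2 ->
  `|FB u1 u2 xi| <= \int[mu]_x `|u1 x| + \int[mu]_x `|u2 x|.
Proof.
by move=> i1 i2; rewrite (le_trans (ler_normB _ _))// addrC lerD ?fc_bound ?fs_bound.
Qed.

(* Fourier inversion of the Gaussian regularization; the inverse transform of
   [g] is the conjugate of the transform of the conjugate of [g]. *)
Lemma mollified_inversion u1 u2 t y : 0 < t -> L1 u1 -> L1 u2 ->
  let g1 xi := gs t xi * FA u1 u2 xi in let g2 xi := - (gs t xi * FB u1 u2 xi) in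
  FA g1 g2 y = (2 * pi) ^+ n * hconv t u1 y /\
  FB g1 g2 y = - ((2 * pi) ^+ n * hconv t u2 y).
Proof.
move=> t0 i1 i2 g1 g2.
have j1 : L1 g1.
  apply: integrable_gsF => //; first exact: measurable_FA.
  by move=> x; exact: FA_bound.
have j2 : L1 g2.
  have : L1 (fun xi => gs t xi * (- FB u1 u2 xi)).
    apply: integrable_gsF => //; first by apply: measurable_funN; exact: measurable_FB.
    by move=> x; rewrite normrN; exact: FB_bound.
  by apply: eq_integrable => // x _; rewrite mulrN.
have [a1 e1] := inversion_cos y t0 i1; have [a2 e2] := inversion_sin y t0 i2.
have [a3 e3] := inversion_cos y t0 i2; have [a4 e4] := inversion_sin y t0 i1.
have c1 := integrable_cosM y j1; have s1 := integrable_sinM y j1.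
have c2 := integrable_cosM y j2; have s2 := integrable_sinM y j2.
split.
  rewrite -[RHS]addr0 -e2 -e1 -RintegralD// [LHS]/FA [fc g1 _]/fc [fs g2 _]/fs -RintegralD//.
  by apply: eq_Rintegral => x _; rewrite /g1 /g2 /FA /FB (dotpC y); ring.
rewrite -[RHS]addr0 -e4 -e3 -mulN1r -RintegralZl// -RintegralD//; last exact: integrableZlR.
rewrite [LHS]/FB [fc g2 _]/fc [fs g1 _]/fs -RintegralB//.
by apply: eq_Rintegral => x _; rewrite /g1 /g2 /FA /FB (dotpC y); ring.
Qed.

Definition modulus u1 u2 (x : V) : R := Num.sqrt (u1 x ^+ 2 + u2 x ^+ 2).

Lemma modulus_ge0 u1 u2 x : 0 <= modulus u1 u2 x.
Proof. exact: sqrtr_ge0. Qed.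

Lemma measurable_modulus u1 u2 : measurable_fun setT u1 -> measurable_fun setT u2 ->
  measurable_fun setT (modulus u1 u2).
Proof.
move=> m1 m2; apply: (measurableT_comp (continuous_measurable_fun (@sqrt_continuous R))).
by apply: measurable_funD; apply: measurable_funX.
Qed.

Lemma modulus_CS u1 u2 v1 v2 x y :
  u1 x * v1 y + u2 x * v2 y <= modulus u1 u2 x * modulus v1 v2 y.
Proof.
rewrite /modulus -sqrtrM ?addr_ge0 ?sqr_ge0//.
apply: (le_trans (ler_norm _)); rewrite -sqrtr_sqr ler_wsqrtr//.
have := sqr_ge0 (u1 x * v2 y - u2 x * v1 y); nra.
Qed.

Lemma gauss_parseval_le u1 u2 t : 0 < t -> L1 u1 -> L1 u2 ->
  (\int[mu]_xi (gs t xi * (FA u1 u2 xi ^+ 2 + FB u1 u2 xi ^+ 2))%:E <=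
   ((2 * pi) ^+ n)%:E * \int[mu]_y \int[mu]_x
     (modulus u1 u2 x * modulus u1 u2 y * hk t (x - y))%:E)%E.
Proof.
move=> t0 i1 i2.
have [ip ep] := parseval t0 i1 i2 i1 i2.
have m1 : measurable_fun setT u1 by apply/measurable_EFinP; exact: measurable_int i1.
have m2 : measurable_fun setT u2 by apply/measurable_EFinP; exact: measurable_int i2.
have mr := measurable_modulus m1 m2.
have p0 : 0 <= (2 * pi : R) ^+ n by rewrite exprn_ge0// mulr_ge0// pi_ge0.
have -> : (\int[mu]_xi (gs t xi * (FA u1 u2 xi ^+ 2 + FB u1 u2 xi ^+ 2))%:E =
    ((2 * pi) ^+ n * \int[mu]_y (u1 y * hconv t u1 y + u2 y * hconv t u2 y))%:E)%E.
  rewrite -ep -EFin_Rintegral//.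
rewrite EFinM lee_wpmul2l//.
have j1 := integrable_hconvM t0 i1 i1; have j2 := integrable_hconvM t0 i2 i2.
have j : L1 (fun y => u1 y * hconv t u1 y + u2 y * hconv t u2 y).
  by have := integrableD measurableT j1 j2; apply: eq_integrable.
rewrite -EFin_Rintegral//.
have mF : measurable_fun [set: V * V] (fun p => modulus u1 u2 p.2 * modulus u1 u2 p.1 * hk t (p.2 - p.1)).
  apply: measurable_funM.
    by apply: measurable_funM; apply: (measurableT_comp mr).
  by under eq_fun do rewrite hkC; exact: measurable_hkB.
have F0 (y x : V) : 0 <= modulus u1 u2 x * modulus u1 u2 y * hk t (x - y).
  by rewrite !mulr_ge0 ?modulus_ge0 ?hk_ge0.
apply: (@le_trans _ _ (\int[mu]_y `|(u1 y * hconv t u1 y + u2 y * hconv t u2 y)%:E|)%E).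
  by apply: le_integral => //; [exact: integrable_abse|move=> x _; exact: lee_abs].
apply: ge0_le_integral => //.
- by apply: measurableT_comp => //; exact: measurable_int j.
- exact: (@measurable_integral_snd _ _ _ _ _ mu (fun y x => modulus u1 u2 x * modulus u1 u2 y * hk t (x - y)) mF F0).
move=> y _.
have k1 := integrable_hkM y t0 i1; have k2 := integrable_hkM y t0 i2.
have k : L1 (fun x => u1 y * (u1 x * hk t (x - y)) + u2 y * (u2 x * hk t (x - y))).
  by have := integrableD measurableT (integrableZlR (u1 y) k1) (integrableZlR (u2 y) k2); apply: eq_integrable.
have -> : u1 y * hconv t u1 y + u2 y * hconv t u2 y =
    \int[mu]_x (u1 y * (u1 x * hk t (x - y)) + u2 y * (u2 x * hk t (x - y))).
  by rewrite RintegralD// ?RintegralZl//; exact: integrableZlR.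
rewrite -EFin_Rintegral//; apply: (le_trans (le_abse_integral _ _ _)) => //.
  exact: measurable_int k.
apply: ge0_le_integral => //.
- by apply: measurableT_comp => //; exact: measurable_int k.
- by apply/measurable_EFinP; exact: (measurableT_comp mF (measurable_pair1 y)).
move=> x _; rewrite abse_EFin lee_fin.
have -> : u1 y * (u1 x * hk t (x - y)) + u2 y * (u2 x * hk t (x - y)) =
   (u1 x * u1 y + u2 x * u2 y) * hk t (x - y) by ring.
rewrite normrM (ger0_norm (hk_ge0 _ _)) ler_wpM2r ?hk_ge0// ler_norml modulus_CS andbT.
have := modulus_CS (fun x => - u1 x) (fun x => - u2 x) u1 u2 x y.
rewrite /modulus !sqrrN; lra.
Qed.

End fourier_real.

(** * Convergence of the Gaussian regularization *)

Section approximate_identity.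
Context {R : realType} (n : nat).
Local Notation mu := (@lebesgue_rV R n).
Local Notation V := 'rV[R]_n.
Local Notation L1 f := (mu.-integrable setT (fun x => (f x)%:E)).

Definition boxed (M : R) : set V := [set x | forall i, `|x ord0 i| <= M].

Lemma measurable_boxed M : measurable (boxed M).
Proof.
rewrite (_ : boxed M = \bigcap_(i in [set: 'I_n]) [set x : V | `|x ord0 i| <= M]); last first.
  by apply/seteqP; split => [x h i _|x h i]; exact: h.
apply: fin_bigcap_measurable => // i _.
rewrite (_ : mkset _ = (fun x : V => x ord0 i) @^-1` `[- M, M]%classic); last first.
  by apply/seteqP; split => x /=; rewrite in_itv/= ler_norml.
rewrite -[X in measurable X]setTI; exact: measurable_coord.
Qed.

Lemma boxed_lty M : (mu (boxed M) < +oo)%E.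
Proof.
rewrite (_ : boxed M = [set x | forall i, `[- M, M]%classic (x ord0 i)]); last first.
  by apply/seteqP; split => x h i; have := h i; rewrite /= in_itv/= ler_norml.
rewrite (@lebesgue_rV_box R n (fun=> `[- M, M]%classic))//.
suff : (\prod_(i < n) @lebesgue_measure R `[(- M)%R, M])%E \is a fin_num.
  by rewrite fin_numElt => /andP[].
elim/big_ind: _ => // [x y xf yf|i _]; first exact: fin_numM.
by rewrite lebesgue_measure_itv/=; case: ifPn.
Qed.

Lemma integrable_boxed (f : V -> R) (B M : R) : measurable_fun setT f ->
  (forall x, `|f x| <= B) -> (forall x, f x != 0 -> boxed M x) -> L1 f.
Proof.
move=> mf fB fM.
have i : L1 (fun x => B * \1_(boxed M) x).
  apply: integrableZlR; apply/integrableP; split.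
    by apply/measurable_EFinP; apply: measurable_indic; exact: measurable_boxed.
  under eq_integral do rewrite gee0_abs ?lee_fin//.
  by rewrite integral_indic//= ?setIT ?boxed_lty//; exact: measurable_boxed.
apply: le_integrableR i => // x.
have [->|fx] := eqVneq (f x) 0; last by rewrite indicE mem_set ?mulr1//; exact: fM.
by rewrite normr0 mulr_ge0// (le_trans _ (fB x)).
Qed.

(** Half of the exponent is left to the kernel at time [2 * e], which still has mass one; the other
    half gives smallness through exp(-a) <= 1/a, whence a bound linear in [e]. *)
Let hk_tail e (z : V) (dl : R) : 0 < e -> 0 < dl -> dl ^+ 2 <= n2 z ->
  hk e z <= Num.sqrt 2 ^+ n * (8 * e / dl ^+ 2) * hk (2 * e) z.
Proof.
move=> e0 d0 dz.
have E : hk e z = Num.sqrt 2 ^+ n * expR (- (n2 z / (8 * e))) * hk (2 * e) z.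
  rewrite !hkE mulrACA -exprMn -expRD; congr (_ ^+ _ * expR _).
    have -> : 4 * pi * (2 * e) = 2 * (4 * pi * e) by ring.
    rewrite (sqrtrM (4 * pi * e) (ler0n R 2)) invfM mulrA mulfV ?mul1r// gt_eqF// sqrtr_gt0//.
  by field; rewrite gt_eqF.
rewrite E ler_wpM2r ?hk_ge0// ler_wpM2l ?exprn_ge0 ?sqrtr_ge0//.
rewrite expRN -[leRHS]invrK lef_pV2 ?posrE ?expR_gt0 ?invr_gt0 ?divr_gt0 ?mulr_gt0//.
rewrite invf_div (le_trans _ (expR_ge1Dx _))// -[leLHS]add0r lerD//.
by rewrite ler_wpM2r// invr_ge0 mulr_ge0 ?ltW.
Qed.

Lemma Rintegral_hk e (y : V) : 0 < e -> \int[mu]_x hk e (x - y) = 1.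
Proof. by move=> e0; rewrite /Rintegral integral_hk. Qed.

Lemma integrable_hk e (y : V) : 0 < e -> L1 (fun x => hk e (x - y)).
Proof.
move=> e0; apply/integrableP; split.
  apply/measurable_EFinP; exact: (measurableT_comp (@measurable_hkB R n e) (measurable_pair2 y)).
under eq_integral do rewrite gee0_abs ?lee_fin ?hk_ge0//.
by rewrite integral_hk// ltry.
Qed.

Lemma cvg_hconv (f : V -> R) (B : R) (y : V) : continuous f ->
  (forall x, `|f x| <= B) -> hconv (harmonic m) f y @[m --> \oo] --> f y.
Proof.
move=> cf fB.
have B0 : 0 <= B by exact: le_trans (fB 0).
have mf := continuous_rV_measurable cf.
(* Near [y], continuity costs [eta]; away from it, the oscillation is at most [2 * B] and [hk_tail]
   makes the contribution linear in [e]. *)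
have key (eta : R) : 0 < eta -> exists2 K : R, 0 <= K & forall e, 0 < e ->
    `|hconv e f y - f y| <= eta + K * e.
  move=> eta0; have [dl d0 hd] := continuous_rV_dist y cf eta0.
  pose K := 2 * B * (Num.sqrt 2 ^+ n * (8 / dl ^+ 2)).
  have K0 : 0 <= K.
    apply: mulr_ge0; first exact: mulr_ge0.
    by rewrite mulr_ge0 ?exprn_ge0 ?sqrtr_ge0 ?divr_ge0 ?sqr_ge0.
  exists K => // e e0; have e20 : 0 < 2 * e by rewrite mulr_gt0.
  have i1 := integrable_hk y e0; have i2 := integrable_hk y e20.
  have mhk : measurable_fun setT (fun x : V => hk e (x - y)).
    by apply/measurable_EFinP; exact: measurable_int i1.
  have ifh : L1 (fun x => f x * hk e (x - y)).
    apply: le_integrableR (integrableZlR B i1); first exact: measurable_funM.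
    by move=> x; rewrite normrM (ger0_norm (hk_ge0 _ _)) ler_wpM2r ?hk_ge0.
  have -> : hconv e f y - f y = \int[mu]_x ((f x - f y) * hk e (x - y)).
    rewrite -[X in _ - X]mulr1 -(Rintegral_hk y e0) -RintegralZl// -RintegralB//; last exact: integrableZlR.
    by apply: eq_Rintegral => x _; rewrite mulrBl.
  have id : L1 (fun x => (f x - f y) * hk e (x - y)).
    have := integrableB measurableT ifh (integrableZlR (f y) i1).
    by apply: eq_integrable => // x _; rewrite mulrBl.
  apply: (le_trans (le_normr_Rintegral measurableT id)).
  have -> : eta + K * e = \int[mu]_x (eta * hk e (x - y) + K * e * hk (2 * e) (x - y)).
    by rewrite RintegralD// ?RintegralZl// ?Rintegral_hk ?mulr1//; exact: integrableZlR.
  apply: le_Rintegral => //; first by have := integrable_abse id.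
    by have := integrableD measurableT (integrableZlR eta i1) (integrableZlR (K * e) i2); apply: eq_integrable.
  move=> x _; rewrite normrM (ger0_norm (hk_ge0 _ _)).
  have h1 : 0 <= eta * hk e (x - y) by rewrite mulr_ge0 ?hk_ge0 ?ltW.
  have h2 : 0 <= K * e * hk (2 * e) (x - y).
    by apply: mulr_ge0 (hk_ge0 _ _); exact: mulr_ge0 K0 (ltW e0).
  have [near|] := pselect (forall i, `|y ord0 i - x ord0 i| < dl).
    apply: (@le_trans _ _ (eta * hk e (x - y))); last by rewrite lerDl.
    by rewrite ler_wpM2r ?hk_ge0// distrC ltW// hd.
  move=> /existsNP[i /negP]; rewrite -leNgt => dyx.
  have dz : dl ^+ 2 <= n2 (x - y).
    rewrite /n2 (bigD1 i)//= -[leLHS]addr0 lerD ?sumr_ge0//; last by move=> j _; exact: sqr_ge0.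
    by rewrite !mxE -(real_normK (num_real (_ - _))) distrC lerXn2r// ?nnegrE// ltW.
  apply: (@le_trans _ _ (K * e * hk (2 * e) (x - y))); last by rewrite lerDr.
  apply: (@le_trans _ _ (2 * B * hk e (x - y))).
    rewrite ler_wpM2r ?hk_ge0// (le_trans (ler_normB _ _))//.
    by have := fB x; have := fB y; lra.
  have -> : K * e * hk (2 * e) (x - y) =
     2 * B * (Num.sqrt 2 ^+ n * (8 * e / dl ^+ 2) * hk (2 * e) (x - y)) by rewrite /K; ring.
  by rewrite ler_wpM2l ?mulr_ge0// hk_tail.
apply/cvgrPdist_lt => eta eta0; have eta20 : 0 < eta / 2 by rewrite divr_gt0.
have [K K0 hK] := key _ eta20.
have K10 : 0 < eta / 2 / (K + 1) by rewrite divr_gt0// ltr_wpDl.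
have /cvgrPdist_lt/(_ _ K10) := @cvg_harmonic R.
apply: filterS => m; rewrite sub0r normrN ger0_norm ?harmonic_ge0// => hm.
rewrite distrC (le_lt_trans (hK _ (harmonic_gt0 m)))// [ltRHS](splitr eta) ltrD2l.
apply: (@le_lt_trans _ _ ((K + 1) * harmonic m)).
  by rewrite ler_wpM2r ?harmonic_ge0// lerDl.
by rewrite mulrC -ltr_pdivlMr// ltr_wpDl.
Qed.

Lemma hconv_le (f : V -> R) (B e : R) (y : V) : measurable_fun setT f ->
  (forall x, `|f x| <= B) -> 0 < e -> `|hconv e f y| <= B.
Proof.
move=> mf fB e0; have i1 := integrable_hk y e0.
have ifh : L1 (fun x => f x * hk e (x - y)).
  apply: le_integrableR (integrableZlR B i1).
    by apply: measurable_funM => //; apply/measurable_EFinP; exact: measurable_int i1.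
  by move=> x; rewrite normrM (ger0_norm (hk_ge0 _ _)) ler_wpM2r ?hk_ge0.
apply: (le_trans (le_normr_Rintegral measurableT ifh)).
rewrite -[leRHS]mulr1 -(Rintegral_hk y e0) -RintegralZl//.
apply: le_Rintegral => //; [by have := integrable_abse ifh|exact: integrableZlR|].
by move=> x _; rewrite normrM (ger0_norm (hk_ge0 _ _)) ler_wpM2r ?hk_ge0.
Qed.

End approximate_identity.

(** * The Schur test *)

Lemma ge0_RD (d : measure_display) (T : measurableType d) (R : realType)
    (m : {measure set T -> \bar R}) (f g : T -> R) :
  measurable_fun setT f -> measurable_fun setT g ->
  (forall x, 0 <= f x) -> (forall x, 0 <= g x) ->
  (\int[m]_x (f x + g x)%:E = \int[m]_x (f x)%:E + \int[m]_x (g x)%:E)%E.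
Proof.
move=> mf mg f0 g0; under eq_integral do rewrite EFinD.
by rewrite ge0_integralD//; [move=> x _; rewrite lee_fin|exact/measurable_EFinP|
  move=> x _; rewrite lee_fin|exact/measurable_EFinP].
Qed.

Lemma ge0_Rle (d : measure_display) (T : measurableType d) (R : realType)
    (m : {measure set T -> \bar R}) (f g : T -> R) :
  measurable_fun setT f -> measurable_fun setT g ->
  (forall x, 0 <= f x) -> (forall x, f x <= g x) ->
  (\int[m]_x (f x)%:E <= \int[m]_x (g x)%:E)%E.
Proof.
move=> mf mg f0 fg; apply: ge0_le_integral => //.
- by move=> x _; rewrite lee_fin.
- exact/measurable_EFinP.
- exact/measurable_EFinP.
- by move=> x _; rewrite lee_fin.
Qed.

Section schur.
Context {R : realType} (n : nat).
Local Notation mu := (@lebesgue_rV R n).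
Local Notation V := 'rV[R]_n.
Local Notation L1 f := (mu.-integrable setT (fun x => (f x)%:E)).
Local Notation muR := (@lebesgue_measure R).

Lemma lebesgue_rV_origin : (0 < n)%N -> mu [set (0 : V)] = 0%E.
Proof.
move=> n0; rewrite (_ : [set (0 : V)] = [set x : V | forall i, [set (0 : R)] (x ord0 i)]); last first.
  apply/seteqP; split => x /=; first by move=> -> i; rewrite mxE.
  by move=> h; apply/rowP => i; rewrite mxE.
rewrite (@lebesgue_rV_box R n (fun=> [set (0 : R)]))//.
by rewrite (bigD1 (Ordinal n0))//= lebesgue_measure_set1 mul0e.
Qed.

Lemma measurable_enorm : measurable_fun [set: V] enorm.
Proof.
apply: (measurableT_comp (continuous_measurable_fun (@sqrt_continuous R))).
exact: measurable_n2.
Qed.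

Lemma enormE (x : V) : enorm x = Num.sqrt (n2 x).
Proof. by []. Qed.

Lemma enorm_powR (x : V) (s : R) : enorm x `^ (2 * s) = n2 x `^ s.
Proof.
by rewrite enormE -powR12_sqrt ?n2_ge0// -powRrM mulKf.
Qed.

(** By Tonelli [a] and its transpose have the same double integral, so a bound by their mean
    suffices. This is how AM-GM is applied below: with the Schur weights, in Plancherel's
    inequality, and in the L^q estimate. *)
Lemma le_symmetrized_integral (F a : V -> V -> R) :
  measurable_fun [set: V * V] (fun p => F p.1 p.2) ->
  measurable_fun [set: V * V] (fun p => a p.1 p.2) ->
  (forall y x, 0 <= F y x) -> (forall y x, 0 <= a y x) ->
  (forall y x, F y x <= 2^-1 * (a y x + a x y)) ->
  (\int[mu]_y \int[mu]_x (F y x)%:E <= \int[mu]_y \int[mu]_x (a y x)%:E)%E.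
Proof.
move=> mF ma F0 a0 Fa.
have ms : measurable_fun [set: V * V] (fun p => a p.2 p.1).
  exact: (measurableT_comp ma (@measurable_swap _ _ V V)).
have mc : measurable_fun [set: V * V] (fun p => 2^-1 * (a p.1 p.2 + a p.2 p.1)).
  by apply: measurable_funM; [exact: measurable_cst|exact: measurable_funD].
have ha y : measurable_fun setT (a y) := measurableT_comp ma (measurable_pair1 y).
have hb y : measurable_fun setT (fun x => a x y) := measurableT_comp ma (measurable_pair2 y).
have h20 : (0 : R) <= 2^-1 by rewrite invr_ge0.
have c0 y x : 0 <= 2^-1 * (a y x + a x y) by rewrite mulr_ge0 ?addr_ge0.
apply: (@le_trans _ _ (\int[mu]_y \int[mu]_x (2^-1 * (a y x + a x y))%:E)%E).
  apply: ge0_le_integral; [exact: measurableT|..].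
  - by move=> y _; apply: integral_ge0 => x _; rewrite lee_fin.
  - exact: (measurable_integral_snd mu mF F0).
  - exact: (measurable_integral_snd mu mc c0).
  move=> y _; apply: ge0_Rle => //.
  - exact: (measurableT_comp mF (measurable_pair1 y)).
  - exact: (measurableT_comp mc (measurable_pair1 y)).
have cE y : (\int[mu]_x (2^-1 * (a y x + a x y))%:E =
    (2^-1)%:E * (\int[mu]_x (a y x)%:E + \int[mu]_x (a x y)%:E))%E.
  rewrite ge0_RZl; [|exact: measurable_funD|by move=> x; rewrite addr_ge0|exact: h20].
  by rewrite ge0_RD.
under eq_integral do rewrite cE.
have ga y : (0 <= \int[mu]_x (a y x)%:E)%E by apply: integral_ge0 => x _; rewrite lee_fin.
have gb y : (0 <= \int[mu]_x (a x y)%:E)%E by apply: integral_ge0 => x _; rewrite lee_fin.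
have mia := measurable_integral_snd mu ma a0.
have mib := measurable_integral_fst mu ma a0.
rewrite ge0_integralZl_EFin; last 4 first.
- exact: measurableT.
- by move=> y _; rewrite adde_ge0.
- exact: emeasurable_funD.
- exact: h20.
rewrite ge0_integralD; [|exact: measurableT|by move=> y _|by []|by move=> y _|by []].
rewrite -(tonelli mu mu ma a0).
have : (0 <= \int[mu]_y \int[mu]_x (a y x)%:E)%E by apply: integral_ge0 => y _.
move: (\int[mu]_y \int[mu]_x (a y x)%:E)%E => X X0.
by rewrite ge0_muleDr// -ge0_muleDl ?lee_fin// -EFinD (_ : 2^-1 + 2^-1 = 1) ?mul1e// [RHS]splitr mul1r.
Qed.

Variables (s : R) (h th : V -> R).
Hypothesis n0 : (0 < n)%N.
Hypothesis s0 : 0 < s.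
Hypothesis mh : measurable_fun setT h.
Hypothesis mth : measurable_fun setT th.
Hypothesis h0 : forall x, 0 < h x.
Hypothesis th0 : forall x, 0 <= th x.
(** Formally the integral of t^(s - 1) p_t over [t] is [Gamma s] times the kernel of
    (-Laplacian)^(-s), so this reads (-Laplacian)^(-s) h <= th h. The origin is excluded because the
    mixtures with power weights are infinite there. *)
Hypothesis hth : forall x : V, x != 0 ->
  (\int[muR]_t \int[mu]_y (pw s t * (h y * hk t (y - x)))%:E <=
   (Gamma s * th x * h x)%:E)%E.

(** The Schur test at a fixed time, before symmetrization: 2 r(x) r(y) <= r(y)^2 h(x) / h(y) +
    r(x)^2 h(y) / h(x). *)
Lemma double_integral_weight (r : V -> R) (t : R) : measurable_fun setT r ->
  (forall x, 0 <= r x) ->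
  (\int[mu]_y \int[mu]_x (r x * r y * hk t (x - y))%:E <=
   \int[mu]_y \int[mu]_x (r y ^+ 2 / h y * (h x * hk t (x - y)))%:E)%E.
Proof.
move=> mr r0.
have mk : measurable_fun [set: V * V] (fun p => hk t (p.2 - p.1)).
  by under eq_fun do rewrite hkC; exact: measurable_hkB.
have mphi : measurable_fun setT (fun y => r y ^+ 2 / h y).
  apply: measurable_funM; first exact: measurable_funX.
  exact: (measurableT_comp (@measurable_invr R) mh).
apply: (@le_symmetrized_integral (fun y x => r x * r y * hk t (x - y))
    (fun y x => r y ^+ 2 / h y * (h x * hk t (x - y)))).
- by apply: measurable_funM => //; apply: measurable_funM; apply: (measurableT_comp mr).
- apply: measurable_funM; first exact: (measurableT_comp mphi measurable_fst).
  by apply: measurable_funM => //; exact: (measurableT_comp mh measurable_snd).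
- by move=> y x; rewrite !mulr_ge0 ?hk_ge0.
- by move=> y x; rewrite !mulr_ge0 ?hk_ge0 ?invr_ge0 ?sqr_ge0 ?(ltW (h0 _)).
move=> y x; rewrite (hkC t y x).
have -> : 2^-1 * (r y ^+ 2 / h y * (h x * hk t (x - y)) + r x ^+ 2 / h x * (h y * hk t (x - y))) =
    (2^-1 * (r y ^+ 2 * (h x / h y) + r x ^+ 2 * (h y / h x))) * hk t (x - y) by ring.
rewrite ler_wpM2r ?hk_ge0//.
have q0 : 0 < h x / h y by rewrite divr_gt0.
have -> : h y / h x = (h x / h y)^-1 by rewrite invf_div.
move: (h x / h y) q0 => q q0.
have -> : r y ^+ 2 * q + r x ^+ 2 / q = (q * r y - r x) ^+ 2 / q + 2 * (r x * r y).
  by field; rewrite gt_eqF.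
rewrite [leRHS]mulrDr mulKf// lerDr; apply: mulr_ge0; first by rewrite invr_ge0.
by rewrite divr_ge0 ?sqr_ge0 ?ltW.
Qed.

(** Here [g1] and [g2] live on the frequency side and [x] is the variable of their transform. The
    potential is unfolded into Gaussians ([stepa]), Parseval and the weighted AM-GM act at each time
    ([stepb]), and integrating over time and over the argument of [h] brings in the supersolution
    inequality ([stepc]). *)
Lemma schur_step (g1 g2 : V -> R) : L1 g1 -> L1 g2 ->
  (\int[mu]_x (enorm x `^ (- (2 * s)) * (FA g1 g2 x ^+ 2 + FB g1 g2 x ^+ 2))%:E <=
   ((2 * pi) ^+ n)%:E * \int[mu]_x (th x * modulus g1 g2 x ^+ 2)%:E)%E.
Proof.
move=> i1 i2.
have Gs := Gamma_gt0 s0.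
have m1 : measurable_fun setT g1 by apply/measurable_EFinP; exact: measurable_int i1.
have m2 : measurable_fun setT g2 by apply/measurable_EFinP; exact: measurable_int i2.
pose r := modulus g1 g2; have mr : measurable_fun setT r := measurable_modulus m1 m2.
have r0 x : 0 <= r x := modulus_ge0 g1 g2 x.
pose Q x := FA g1 g2 x ^+ 2 + FB g1 g2 x ^+ 2.
have Q0 x : 0 <= Q x by rewrite addr_ge0 ?sqr_ge0.
have mQ : measurable_fun setT Q.
  apply: measurable_funD; apply: measurable_funX; [exact: measurable_FA|exact: measurable_FB].
have p0 : 0 <= (2 * pi : R) ^+ n by rewrite exprn_ge0// mulr_ge0// pi_ge0.
pose W (x : V) : R := enorm x `^ (- (2 * s)).
have mW : measurable_fun setT W.
  exact: (measurableT_comp (measurable_powR _) measurable_enorm).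
pose f (x : V) (t : R) := pw s t * (gs t x * Q x).
have f0 x t : 0 <= f x t by rewrite !mulr_ge0 ?pw_ge0 ?gs_ge0.
have mf : measurable_fun [set: V * R] (fun p => f p.1 p.2).
  apply: measurable_funM; first exact: (measurableT_comp (measurable_pw s) measurable_snd).
  apply: measurable_funM; last exact: (measurableT_comp mQ measurable_fst).
  exact: (measurableT_comp (@measurable_gsp R n) (@measurable_swap _ _ V R)).
have stepa : ((Gamma s)%:E * \int[mu]_x (W x * Q x)%:E <= \int[mu]_x \int[muR]_t (f x t)%:E)%E.
  rewrite -ge0_RZl ?(ltW Gs)//; last 2 first.
  - exact: measurable_funM.
  - by move=> x; rewrite mulr_ge0 ?powR_ge0.
  apply: ge0_le_integral => //.
  - by move=> x _; rewrite lee_fin !mulr_ge0 ?powR_ge0 ?(ltW Gs).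
  - by apply/measurable_EFinP; apply: measurable_funM => //; exact: measurable_funM.
  - exact: (measurable_integral_snd muR mf f0).
  (* At the origin the power has the default value 0, which makes the left side 0. *)
  move=> x _; have [->|x0] := eqVneq x 0.
    rewrite /W enormE n2_0 sqrtr0 powR0 ?mul0r ?mulr0.
      by apply: integral_ge0 => t _; rewrite lee_fin.
    by rewrite oppr_eq0 mulf_neq0// gt_eqF.
  have := integral_pw_expR s0 (n2_gt0 x0) => E.
  have -> : (\int[muR]_t (f x t)%:E = \int[muR]_t (Q x * (pw s t * expR (- (n2 x * t))))%:E)%E.
    by apply: eq_integral => t _; rewrite /f /gs (mulrC t); congr EFin; ring.
  rewrite ge0_RZl//; last 2 first.
  - apply: measurable_funM; first exact: measurable_pw.
    by apply: measurableT_comp => //; apply: measurableT_comp => //; exact: measurable_funM.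
  - by move=> t; rewrite mulr_ge0 ?pw_ge0 ?expR_ge0.
  rewrite E -EFinM lee_fin /W -mulrN enorm_powR le_eqVlt; apply/orP; left; apply/eqP; ring.
pose F (t : R) (y x : V) := pw s t * (r y ^+ 2 / h y * (h x * hk t (x - y))).
have F0 t y x : 0 <= F t y x.
  by rewrite !mulr_ge0 ?pw_ge0 ?hk_ge0 ?invr_ge0 ?sqr_ge0 ?(ltW (h0 _)).
have mphi : measurable_fun setT (fun y => r y ^+ 2 / h y).
  apply: measurable_funM; first exact: measurable_funX.
  exact: (measurableT_comp (@measurable_invr R) mh).
have mF : measurable_fun [set: (R * V) * V] (fun p => F p.1.1 p.1.2 p.2).
  apply: measurable_funM.
    exact: (measurableT_comp (measurable_pw s) (measurableT_comp measurable_fst measurable_fst)).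
  apply: measurable_funM.
    exact: (measurableT_comp mphi (measurableT_comp measurable_snd measurable_fst)).
  apply: measurable_funM; first exact: (measurableT_comp mh measurable_snd).
  pose z (p : (R * V) * V) : R * V := (p.1.1, p.2 - p.1.2).
  have mz : measurable_fun setT z.
    apply/measurable_fun_pairP; split.
      exact: (measurableT_comp measurable_fst measurable_fst).
    pose w (p : (R * V) * V) : V * V := (p.2, p.1.2).
    have mw : measurable_fun setT w.
      apply/measurable_fun_pairP; split; first exact: measurable_snd.
      exact: (measurableT_comp measurable_snd measurable_fst).
    exact: (measurableT_comp (@measurable_rVB R n) mw).
  exact: (measurableT_comp (@measurable_hk R n) mz).
have mF1 : measurable_fun [set: R * V] (fun p => \int[mu]_x (F p.1 p.2 x)%:E)%E.
  exact: (measurable_integral_snd mu mF (fun p x => F0 p.1 p.2 x)).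
have iF0 t y : (0 <= \int[mu]_x (F t y x)%:E)%E by apply: integral_ge0 => x _; rewrite lee_fin.
have maph t : measurable_fun [set: V * V] (fun p => r p.1 ^+ 2 / h p.1 * (h p.2 * hk t (p.2 - p.1))).
  apply: measurable_funM; first exact: (measurableT_comp mphi measurable_fst).
  apply: measurable_funM; first exact: (measurableT_comp mh measurable_snd).
  by under eq_fun do rewrite hkC; exact: measurable_hkB.
have aph0 t (y x : V) : 0 <= r y ^+ 2 / h y * (h x * hk t (x - y)).
  by rewrite !mulr_ge0 ?hk_ge0 ?invr_ge0 ?sqr_ge0 ?(ltW (h0 _)).
have mhh y : measurable_fun [set: R * V] (fun p => pw s p.1 * (h p.2 * hk p.1 (p.2 - y))).
  apply: measurable_funM; first exact: (measurableT_comp (measurable_pw s) measurable_fst).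
  apply: measurable_funM; first exact: (measurableT_comp mh measurable_snd).
  pose z (p : R * V) : R * V := (p.1, p.2 - y).
  have mz : measurable_fun setT z.
    apply/measurable_fun_pairP; split; first exact: measurable_fst.
    exact: (measurableT_comp (measurableT_comp (@measurable_rVB R n) (measurable_pair2 y)) measurable_snd).
  exact: (measurableT_comp (@measurable_hk R n) mz).
have hh0 y t x : 0 <= pw s t * (h x * hk t (x - y)).
  by rewrite !mulr_ge0 ?pw_ge0 ?hk_ge0 ?(ltW (h0 _)).
have stepb : (\int[mu]_x \int[muR]_t (f x t)%:E <=
    ((2 * pi) ^+ n)%:E * \int[muR]_t \int[mu]_y \int[mu]_x (F t y x)%:E)%E.
  rewrite (tonelli mu muR mf f0) -ge0_integralZl_EFin//; last 2 first.
  - by move=> t _; apply: integral_ge0 => y _; exact: iF0.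
  - exact: (@measurable_fun_fubini_tonelli_F _ _ _ _ _ mu
      (fun p : R * V => \int[mu]_x (F p.1 p.2 x)%:E)%E mF1 (fun p => iF0 p.1 p.2)).
  apply: ge0_le_integral => //.
  - by move=> t _; apply: integral_ge0 => x _; rewrite lee_fin.
  - exact: (measurable_integral_fst mu mf f0).
  - apply: measurable_funeM; exact: (@measurable_fun_fubini_tonelli_F _ _ _ _ _ mu
      (fun p : R * V => \int[mu]_x (F p.1 p.2 x)%:E)%E mF1 (fun p => iF0 p.1 p.2)).
  move=> t _; have [t0|t0] := ltP 0 t; last first.
    rewrite integral0_eq => [|x _]; last by rewrite /f /pw ltNge t0/= mul0r.
    by rewrite mule_ge0// integral_ge0// => y _; exact: iF0.
  rewrite /f ge0_RZl ?pw_ge0//; last 2 first.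
  - by apply: measurable_funM => //; exact: measurable_gs.
  - by move=> x; rewrite mulr_ge0 ?gs_ge0.
  have pwe : (0 <= (pw s t)%:E)%E by rewrite lee_fin pw_ge0.
  apply: (le_trans (lee_wpmul2l pwe (gauss_parseval_le t0 i1 i2))).
  rewrite muleCA; apply: lee_wpmul2l; first by rewrite lee_fin.
  apply: (le_trans (lee_wpmul2l pwe (double_integral_weight t mr r0))).
  rewrite -ge0_integralZl_EFin; last 4 first.
  - exact: measurableT.
  - by move=> y _; apply: integral_ge0 => x _; rewrite lee_fin.
  - exact: (measurable_integral_snd mu (maph t) (aph0 t)).
  - exact: pw_ge0.
  rewrite le_eqVlt; apply/orP; left; apply/eqP; apply: eq_integral => y _.
  rewrite -ge0_RZl; last 3 first.
  - exact: (measurableT_comp (maph t) (measurable_pair1 y)).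
  - exact: aph0.
  - exact: pw_ge0.
  by apply: eq_integral => x _.
have stepc : (\int[muR]_t \int[mu]_y \int[mu]_x (F t y x)%:E <=
    (Gamma s)%:E * \int[mu]_x (th x * r x ^+ 2)%:E)%E.
  rewrite (@fubini_tonelli _ _ _ _ _ muR mu (fun p => \int[mu]_x (F p.1 p.2 x)%:E)%E mF1
    (fun p => iF0 p.1 p.2)).
  rewrite -ge0_RZl; last 3 first.
  - by apply: measurable_funM => //; exact: measurable_funX.
  - by move=> x; rewrite mulr_ge0 ?sqr_ge0.
  - exact: ltW.
  apply: ae_ge0_le_integral.
  - exact: measurableT.
  - by move=> y _; apply: integral_ge0 => t _; exact: iF0.
  - exact: (@measurable_fun_fubini_tonelli_G _ _ _ _ _ muR
      (fun p : R * V => \int[mu]_x (F p.1 p.2 x)%:E)%E mF1 (fun p => iF0 p.1 p.2)).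
  - by move=> y _; rewrite lee_fin mulr_ge0 ?(ltW Gs)// mulr_ge0 ?sqr_ge0.
  - apply/measurable_EFinP; apply: measurable_funM; first exact: measurable_cst.
    by apply: measurable_funM => //; exact: measurable_funX.
  (* The supersolution inequality holds off the origin, which is a null set in positive
     dimension. *)
  exists [set (0 : V)]; split; [|exact: lebesgue_rV_origin|].
    rewrite (_ : [set 0] = boxed 0 :> set V); first exact: measurable_boxed.
    apply/seteqP; split => x /=; first by move=> -> i; rewrite mxE normr0.
    by move=> h1; apply/rowP => i; rewrite mxE; apply/eqP; rewrite -normr_le0; exact: h1.
  move=> y /=; apply: contra_notP => y0 _.
  have {}y0 : y != 0 by apply/eqP.
  have ph0 : 0 <= r y ^+ 2 / h y by rewrite divr_ge0 ?sqr_ge0 ?(ltW (h0 _)).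
  have -> : (\int[muR]_t \int[mu]_x (F t y x)%:E = (r y ^+ 2 / h y)%:E *
      \int[muR]_t \int[mu]_x (pw s t * (h x * hk t (x - y)))%:E)%E.
    rewrite -ge0_integralZl_EFin; last 4 first.
    - exact: measurableT.
    - by move=> t _; apply: integral_ge0 => x _; rewrite lee_fin.
    - exact: (measurable_integral_snd mu (mhh y) (hh0 y)).
    - exact: ph0.
    apply: eq_integral => t _; rewrite -ge0_RZl; last 3 first.
    - exact: (measurableT_comp (mhh y) (measurable_pair1 t)).
    - exact: hh0.
    - exact: ph0.
    by apply: eq_integral => x _; rewrite /F mulrCA.
  have phe : (0 <= (r y ^+ 2 / h y)%:E)%E by rewrite lee_fin.
  apply: (le_trans (lee_wpmul2l phe (hth y0))).
  rewrite -EFinM lee_fin le_eqVlt; apply/orP; left; apply/eqP.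
  by field; rewrite gt_eqF.
have : ((Gamma s)%:E * \int[mu]_x (W x * Q x)%:E <=
    (Gamma s)%:E * (((2 * pi) ^+ n)%:E * \int[mu]_x (th x * r x ^+ 2)%:E))%E.
  apply: (le_trans stepa); apply: (le_trans stepb).
  by rewrite muleCA lee_wpmul2l ?lee_fin.
by rewrite lee_pmul2l.
Qed.

End schur.

Lemma fatou_cvg_le (d : measure_display) (T : measurableType d) (R : realType)
    (m : {measure set T -> \bar R}) (f : nat -> T -> R) (g : T -> R) (K : \bar R) :
  (forall i, measurable_fun setT (f i)) -> (forall i x, 0 <= f i x) ->
  (forall x, f i x @[i --> \oo] --> g x) ->
  (forall i, \int[m]_x (f i x)%:E <= K)%E -> (\int[m]_x (g x)%:E <= K)%E.
Proof.
move=> mf f0 fg fK.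
have := @fatou _ _ _ m setT measurableT (fun i x => (f i x)%:E).
move=> /(_ (fun i => (measurable_EFinP _ _).2 (mf i)) (fun i x _ => f0 i x)).
have -> : (\int[m]_x limn_einf (fun i => (f i x)%:E) = \int[m]_x (g x)%:E)%E.
  apply: eq_integral => x _.
  have h : ((f i x)%:E @[i --> \oo] --> (g x)%:E)%E by apply: cvg_EFin; [exact: nearW|exact: fg].
  by have [] := cvg_limn_einf_sup h.
move=> h; apply: (le_trans h).
rewrite limn_einf_lim; apply: lime_le; first exact: is_cvg_einfs.
apply: nearW => i; apply: (le_trans _ (fK i)).
by apply: ereal_inf_lbound; exists i => /=.
Qed.

(** * Removal of the Gaussian regularization for continuous functions supported in a box *)

Section schur_limit.
Context {R : realType} (n : nat).
Local Notation mu := (@lebesgue_rV R n).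
Local Notation V := 'rV[R]_n.
Local Notation L1 f := (mu.-integrable setT (fun x => (f x)%:E)).
Local Notation muR := (@lebesgue_measure R).

Variables (u1 u2 : V -> R) (B M : R).
Hypothesis c1 : continuous u1.
Hypothesis c2 : continuous u2.
Hypothesis b1 : forall x, `|u1 x| <= B.
Hypothesis b2 : forall x, `|u2 x| <= B.
Hypothesis k1 : forall x, u1 x != 0 -> boxed M x.
Hypothesis k2 : forall x, u2 x != 0 -> boxed M x.

Let m1 : measurable_fun setT u1 := continuous_rV_measurable c1.
Let m2 : measurable_fun setT u2 := continuous_rV_measurable c2.
Let i1 : L1 u1 := integrable_boxed m1 b1 k1.
Let i2 : L1 u2 := integrable_boxed m2 b2 k2.

Let S x : R := FA u1 u2 x ^+ 2 + FB u1 u2 x ^+ 2.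

Let S0 x : 0 <= S x. Proof. by rewrite addr_ge0 ?sqr_ge0. Qed.

Let mS : measurable_fun setT S.
Proof.
by apply: measurable_funD; apply: measurable_funX; [exact: measurable_FA|exact: measurable_FB].
Qed.

Let p0 : 0 < (2 * pi : R) ^+ n.
Proof. by rewrite exprn_gt0// mulr_gt0// pi_gt0. Qed.

(* Plancherel, as an inequality: AM-GM in the Gaussian-regularized Parseval formula. *)
Lemma plancherel_le :
  (\int[mu]_xi (S xi)%:E <= ((2 * pi) ^+ n)%:E * \int[mu]_x (u1 x ^+ 2 + u2 x ^+ 2)%:E)%E.
Proof.
apply: (@fatou_cvg_le _ _ _ mu (fun i xi => gs (harmonic i) xi * S xi)).
- by move=> i; apply: measurable_funM; [exact: measurable_gs|exact: mS].
- by move=> i x; rewrite mulr_ge0 ?gs_ge0.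
- move=> x; rewrite -[X in _ --> X]mul1r; apply: cvgMl.
  rewrite -expR0; apply: (@continuous_cvg _ _ _ _ _ (fun i => - (harmonic i * n2 x))).
    exact: continuous_expR.
  by rewrite -oppr0 -[X in _ --> - X](mul0r (n2 x)); apply: cvgN; apply: cvgMl; exact: cvg_harmonic.
move=> i; apply: (le_trans (gauss_parseval_le (harmonic_gt0 i) i1 i2)).
have pe : (0 <= ((2 * pi : R) ^+ n)%:E)%E by rewrite lee_fin ltW.
apply: lee_wpmul2l => //.
pose r := modulus u1 u2.
have mr : measurable_fun setT r := measurable_modulus m1 m2.
have r0 x : 0 <= r x := modulus_ge0 u1 u2 x.
pose a (y x : V) := r y ^+ 2 * hk (harmonic i) (x - y).
have mk : measurable_fun [set: V * V] (fun p => hk (harmonic i) (p.2 - p.1)).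
  by under eq_fun do rewrite hkC; exact: measurable_hkB.
have ma : measurable_fun [set: V * V] (fun p => a p.1 p.2).
  apply: measurable_funM; last exact: mk.
  exact: (measurableT_comp (measurable_funX _ mr) measurable_fst).
have a0 y x : 0 <= a y x by rewrite mulr_ge0 ?hk_ge0 ?sqr_ge0.
apply: (@le_trans _ _ (\int[mu]_y \int[mu]_x (a y x)%:E)%E).
  apply: (le_symmetrized_integral (F := fun y x => r x * r y * hk (harmonic i) (x - y)) _ ma _ a0).
  - by apply: measurable_funM => //; apply: measurable_funM; apply: (measurableT_comp mr).
  - by move=> y x; rewrite !mulr_ge0 ?hk_ge0.
  move=> y x; rewrite /a (hkC _ y x) -mulrDl mulrA ler_wpM2r ?hk_ge0//.
  have := sqr_ge0 (r x - r y); nra.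
rewrite le_eqVlt; apply/orP; left; apply/eqP; apply: eq_integral => y _.
rewrite /a ge0_RZl; last 3 first.
- by apply/measurable_EFinP; exact: measurable_int (integrable_hk y (harmonic_gt0 i)).
- by move=> x; exact: hk_ge0.
- exact: sqr_ge0.
by rewrite integral_hk ?harmonic_gt0// mule1 /r /modulus sqr_sqrtr ?addr_ge0 ?sqr_ge0.
Qed.

(** [schur_step] wants integrable data on the frequency side, while the transform of [u] is only
    known to be bounded. It is multiplied by a Gaussian; transforming back gives heat
    regularizations of [u], which converge pointwise, and Fatou's lemma removes the
    regularization. *)
Lemma schur (s : R) (h th : V -> R) : (0 < n)%N -> 0 < s ->
  measurable_fun setT h -> measurable_fun setT th ->
  (forall x, 0 < h x) -> (forall x, 0 <= th x) ->
  (forall x : V, x != 0 ->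
    (\int[muR]_t \int[mu]_y (pw s t * (h y * hk t (y - x)))%:E <=
     (Gamma s * th x * h x)%:E)%E) ->
  (((2 * pi) ^+ n)%:E * \int[mu]_x (enorm x `^ (- (2 * s)) * (u1 x ^+ 2 + u2 x ^+ 2))%:E <=
   \int[mu]_xi (th xi * S xi)%:E)%E.
Proof.
move=> n0 s0 mh mth h0 th0 hth.
have mW : measurable_fun setT (fun x : V => enorm x `^ (- (2 * s))).
  exact: (measurableT_comp (measurable_powR _) (@measurable_enorm R n)).
rewrite -ge0_RZl; last 3 first.
- apply: measurable_funM => //; by apply: measurable_funD; apply: measurable_funX.
- by move=> x; rewrite mulr_ge0 ?powR_ge0 ?addr_ge0 ?sqr_ge0.
- exact: ltW.
apply: (@fatou_cvg_le _ _ _ mu (fun i x => (2 * pi) ^+ n * (enorm x `^ (- (2 * s)) *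
   (hconv (harmonic i) u1 x ^+ 2 + hconv (harmonic i) u2 x ^+ 2)))).
- move=> i; apply: measurable_funM; first exact: measurable_cst.
  apply: measurable_funM => //; apply: measurable_funD; apply: measurable_funX; exact: measurable_hconv.
- by move=> i x; rewrite mulr_ge0 ?(ltW p0)// mulr_ge0 ?powR_ge0 ?addr_ge0 ?sqr_ge0.
- move=> x; apply: cvgMr; apply: cvgMr.
  have h1 := @cvg_hconv R n u1 B x c1 b1; have h2 := @cvg_hconv R n u2 B x c2 b2.
  by apply: cvgD; rewrite !expr2; apply: cvgM.
move=> i; have e0 : 0 < (harmonic i : R) := harmonic_gt0 i.
pose g1 xi := gs (harmonic i) xi * FA u1 u2 xi.
pose g2 xi := - (gs (harmonic i) xi * FB u1 u2 xi).
have j1 : L1 g1.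
  by apply: (integrable_gsF e0 (measurable_FA i1 i2)) => x; exact: FA_bound.
have j2 : L1 g2.
  have : L1 (fun xi => gs (harmonic i) xi * (- FB u1 u2 xi)).
    apply: (integrable_gsF e0 (measurable_funN (measurable_FB i1 i2))) => x.
    by rewrite normrN; exact: FB_bound.
  by apply: eq_integrable => // x _; rewrite mulrN.
have step := schur_step n0 s0 mh mth h0 th0 hth j1 j2.
have E x : (2 * pi) ^+ n * (enorm x `^ (- (2 * s)) *
   (hconv (harmonic i) u1 x ^+ 2 + hconv (harmonic i) u2 x ^+ 2)) =
   ((2 * pi) ^+ n)^-1 * (enorm x `^ (- (2 * s)) * (FA g1 g2 x ^+ 2 + FB g1 g2 x ^+ 2)).
  have [-> ->] := mollified_inversion x e0 i1 i2.
  by field; rewrite gt_eqF.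
under eq_integral do rewrite E.
rewrite ge0_RZl; last 3 first.
- apply: measurable_funM => //; apply: measurable_funD; apply: measurable_funX; [exact: measurable_FA|exact: measurable_FB].
- by move=> x; rewrite mulr_ge0 ?powR_ge0 ?addr_ge0 ?sqr_ge0.
- by rewrite invr_ge0 ltW.
have pe : (0 <= (((2 * pi : R) ^+ n)^-1)%:E)%E by rewrite lee_fin invr_ge0 ltW.
apply: (le_trans (lee_wpmul2l pe step)).
rewrite muleA -EFinM mulVf ?mul1e ?gt_eqF//.
have mg1 : measurable_fun setT g1 by apply/measurable_EFinP; exact: measurable_int j1.
have mg2 : measurable_fun setT g2 by apply/measurable_EFinP; exact: measurable_int j2.
apply: ge0_Rle.
- by apply: measurable_funM => //; apply: measurable_funX; exact: measurable_modulus.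
- exact: measurable_funM.
- by move=> x; rewrite mulr_ge0 ?sqr_ge0.
move=> x; rewrite ler_wpM2l// /modulus sqr_sqrtr ?addr_ge0 ?sqr_ge0//.
rewrite /g1 /g2 sqrrN !exprMn -mulrDr ler_piMl//; first exact: S0.
by rewrite expr_le1 ?gs_ge0// gs_le1// harmonic_ge0.
Qed.

(* [|x|^(-2s)] is an average of Gaussians; small widths are controlled by their
   total mass and large widths by the volume of the box. *)
Lemma potential_lty (s : R) : 0 < s -> s < n%:R / 2 ->
  (\int[mu]_x (enorm x `^ (- (2 * s)) * (u1 x ^+ 2 + u2 x ^+ 2))%:E < +oo)%E.
Proof.
move=> s0 sn.
have Gs := Gamma_gt0 s0.
have B0 : 0 <= B by exact: le_trans (b1 0).
have p1 := @pi_gt0 R.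
pose I (x : V) : R := \1_(boxed M) x.
have mI : measurable_fun setT I by apply: measurable_indic; exact: measurable_boxed.
pose C := 2 * B ^+ 2.
have C0 : 0 <= C by rewrite mulr_ge0 ?sqr_ge0.
have uI x : u1 x ^+ 2 + u2 x ^+ 2 <= C * I x.
  have sqb (a : R) : `|a| <= B -> a ^+ 2 <= B ^+ 2.
    by move=> ab; rewrite -(real_normK (num_real a)) lerXn2r// ?nnegrE.
  have [xM|xM] := pselect (boxed M x).
    by rewrite /I indicE mem_set// mulr1 /C; have := sqb _ (b1 x); have := sqb _ (b2 x); lra.
  have z1 : u1 x = 0 by apply/eqP; apply: contra_notT xM; exact: k1.
  have z2 : u2 x = 0 by apply/eqP; apply: contra_notT xM; exact: k2.
  by rewrite z1 z2 expr0n/= addr0 mulr_ge0.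
have mW : measurable_fun setT (fun x : V => enorm x `^ (- (2 * s))).
  exact: (measurableT_comp (measurable_powR _) (@measurable_enorm R n)).
pose f (x : V) (t : R) := pw s t * (gs t x * I x).
have f0 x t : 0 <= f x t by rewrite !mulr_ge0 ?pw_ge0 ?gs_ge0.
have mf : measurable_fun [set: V * R] (fun p => f p.1 p.2).
  apply: measurable_funM; first exact: (measurableT_comp (measurable_pw s) measurable_snd).
  apply: measurable_funM; last exact: (measurableT_comp mI measurable_fst).
  exact: (measurableT_comp (@measurable_gsp R n) (@measurable_swap _ _ V R)).
have stepa : (\int[mu]_x (enorm x `^ (- (2 * s)) * (u1 x ^+ 2 + u2 x ^+ 2))%:E <=
    (C / Gamma s)%:E * \int[mu]_x \int[muR]_t (f x t)%:E)%E.
  have mif := measurable_integral_snd muR mf f0.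
  rewrite -ge0_integralZl_EFin; last 4 first.
  - exact: measurableT.
  - by move=> x _; apply: integral_ge0 => t _; rewrite lee_fin.
  - exact: mif.
  - by rewrite divr_ge0// ltW.
  apply: ge0_le_integral; [exact: measurableT|..].
  - by move=> x _; rewrite lee_fin mulr_ge0 ?powR_ge0 ?addr_ge0 ?sqr_ge0.
  - by apply/measurable_EFinP; apply: measurable_funM => //; apply: measurable_funD; apply: measurable_funX.
  - exact: measurable_funeM.
  move=> x _; have [->|x0] := eqVneq x 0.
    rewrite enormE n2_0 sqrtr0 powR0 ?mul0r; last by rewrite oppr_eq0 mulf_neq0// gt_eqF.
    rewrite mule_ge0 ?lee_fin ?divr_ge0 ?(ltW Gs)//.
    by apply: integral_ge0 => t _; rewrite lee_fin.
  have E := integral_pw_expR s0 (n2_gt0 x0).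
  have -> : (\int[muR]_t (f x t)%:E = \int[muR]_t (I x * (pw s t * expR (- (n2 x * t))))%:E)%E.
    by apply: eq_integral => t _; rewrite /f /gs (mulrC t); congr EFin; ring.
  rewrite ge0_RZl; last 3 first.
  - apply: measurable_funM; first exact: measurable_pw.
    by apply: measurableT_comp => //; apply: measurableT_comp => //; exact: measurable_funM.
  - by move=> t; rewrite mulr_ge0 ?pw_ge0 ?expR_ge0.
  - by [].
  rewrite E -!EFinM lee_fin -mulrN enorm_powR.
  have -> : C / Gamma s * (I x * (Gamma s * n2 x `^ (- s))) = n2 x `^ (- s) * (C * I x).
    by field; rewrite gt_eqF.
  by rewrite ler_wpM2l ?powR_ge0.
apply: (le_lt_trans stepa); rewrite (tonelli mu muR mf f0).
have [v v0 vE] : exists2 v : R, 0 <= v & mu (boxed M) = v%:E.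
  exists (fine (mu (boxed M))); first exact: fine_ge0.
  by rewrite fineK// ge0_fin_numE// boxed_lty.
pose S1 : R := Num.sqrt pi ^+ n.
have S10 : 0 <= S1 by rewrite exprn_ge0 ?sqrtr_ge0.
(* A Gaussian of parameter [t] has mass of order t^(-n/2), which turns t^(s-1) into t^(e-1); this is
   integrable at infinity because [s < n / 2]. *)
pose e := s - n%:R / 2.
have e0 : e < 0 by rewrite subr_lt0.
pose G (t : R) := v * (pw s t * (t <= 1)%R%:R) + S1 * (t `^ (e - 1) * (1 <= t)%R%:R).
have mG1 : measurable_fun [set: R] (fun t => pw s t * (t <= 1)%R%:R).
  by apply: measurable_funM; [exact: measurable_pw|exact: measurable_ler_nat].
have mG2 : measurable_fun [set: R] (fun t => t `^ (e - 1) * (1 <= t)%R%:R).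
  by apply: measurable_funM; [exact: measurable_powR|exact: measurable_ler_nat].
have GE : (\int[muR]_t (G t)%:E = (v * (pw (s + 1) 1 / s) + S1 * - (1 `^ e / e))%:E)%E.
  rewrite ge0_RD; last 4 first.
  - exact: measurable_funM.
  - exact: measurable_funM.
  - by move=> t; rewrite mulr_ge0// mulr_ge0 ?pw_ge0.
  - by move=> t; rewrite mulr_ge0// mulr_ge0 ?powR_ge0.
  rewrite ge0_RZl//; last by move=> t; rewrite mulr_ge0 ?pw_ge0.
  rewrite ge0_RZl//; last by move=> t; rewrite mulr_ge0 ?powR_ge0.
  by rewrite integral_pw_le// integral_powR_ge// -!EFinM -EFinD.
have fG : (\int[muR]_t \int[mu]_x (f x t)%:E <= \int[muR]_t (G t)%:E)%E.
  apply: ge0_le_integral; [exact: measurableT|..].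
  - by move=> t _; apply: integral_ge0 => x _; rewrite lee_fin.
  - exact: (measurable_integral_fst mu mf f0).
  - by apply/measurable_EFinP; apply: measurable_funD; apply: measurable_funM.
  move=> t _; case: (ltP 0 t) => t0; last first.
    rewrite integral0_eq => [|x _]; last by rewrite /f /pw ltNge t0/= mul0r.
    by rewrite lee_fin addr_ge0 ?mulr_ge0 ?pw_ge0 ?powR_ge0.
  have g1 : 0 <= v * (pw s t * (t <= 1)%R%:R) by rewrite mulr_ge0// mulr_ge0 ?pw_ge0.
  have g2 : 0 <= S1 * (t `^ (e - 1) * (1 <= t)%R%:R) by rewrite mulr_ge0// mulr_ge0 ?powR_ge0.
  case: (leP t 1) => t1.
    apply: (@le_trans _ _ (\int[mu]_x (pw s t * I x)%:E)%E).
      apply: ge0_Rle.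
      - exact: (measurableT_comp mf (measurable_pair2 t)).
      - exact: measurable_funM.
      - by move=> x; exact: f0.
      - by move=> x; rewrite ler_wpM2l ?pw_ge0// ler_piMl// gs_le1// ltW.
    rewrite ge0_RZl//; last exact: pw_ge0.
    rewrite integral_indic ?setIT//; last exact: measurable_boxed.
    change ((pw s t)%:E * mu (boxed M) <= (G t)%:E)%E.
    rewrite vE -EFinM lee_fin /G t1 mulr1; move: g2; rewrite [v * _]mulrC; lra.
  apply: (@le_trans _ _ (\int[mu]_x (pw s t * gs t x)%:E)%E).
    apply: ge0_Rle.
    - exact: (measurableT_comp mf (measurable_pair2 t)).
    - by apply: measurable_funM => //; exact: measurable_gs.
    - by move=> x; exact: f0.
    - move=> x; rewrite ler_wpM2l ?pw_ge0// ler_piMr ?gs_ge0// /I indicE.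
      by case: (_ \in _).
  rewrite ge0_RZl; [|exact: measurable_gs|by move=> x; exact: gs_ge0|exact: pw_ge0].
  rewrite integral_gs// -EFinM lee_fin /G (ltW t1) mulr1.
  suff -> : pw s t * Num.sqrt (pi / t) ^+ n = S1 * t `^ (e - 1) by move: g1; lra.
  rewrite /S1 sqrtrM ?(ltW p1)// exprMn mulrCA; congr (_ * _).
  rewrite /pw t0 -powR12_sqrt ?invr_ge0 ?(ltW t0)// -powR_inv1 ?(ltW t0)//.
  rewrite -powR_mulrn ?powR_ge0// -!powRrM -powRD; last by rewrite (gt_eqF t0) implybT.
  by congr (_ `^ _); rewrite /e; field.
apply: (@le_lt_trans _ _ ((C / Gamma s)%:E * \int[muR]_t (G t)%:E)%E).
  by apply: lee_wpmul2l => //; rewrite lee_fin divr_ge0// ltW.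
by rewrite GE -EFinM ltry.
Qed.

End schur_limit.

(** * Subcritical Sobolev embedding *)

Lemma dominated_Rintegral_le (d : measure_display) (T : measurableType d) (R : realType)
    (m : {measure set T -> \bar R}) (f : nat -> T -> R) (g D : T -> R) (K : R) :
  (forall i, measurable_fun setT (f i)) -> measurable_fun setT g ->
  (forall x, f i x @[i --> \oo] --> g x) ->
  m.-integrable setT (fun x => (D x)%:E) -> (forall i x, `|f i x| <= D x) ->
  (forall i, \int[m]_x f i x <= K) -> \int[m]_x g x <= K.
Proof.
move=> mf mg fg iD fD fK.
have c1 : {ae m, forall x, [set: T] x -> (f i x)%:E @[i --> \oo] --> (g x)%:E}.
  by apply: aeW => x _; apply: cvg_EFin; [exact: nearW|exact: fg].
have c3 : {ae m, forall x i, [set: T] x -> (`|(f i x)%:E| <= (D x)%:E)%E}.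
  by apply: aeW => x i _; rewrite abse_EFin lee_fin.
have [ig _ h] := @dominated_convergence _ T R m [set: T] measurableT
  (fun i x => (f i x)%:E) (fun x => (g x)%:E) (fun x => (D x)%:E)
  (fun i => (measurable_EFinP _ _).2 (mf i)) ((measurable_EFinP _ _).2 mg) c1 iD c3.
rewrite -lee_fin -EFin_Rintegral// -(cvg_lim _ h)//.
apply: lime_le; first by apply/cvg_ex; eexists; exact: h.
apply: nearW => i /=; rewrite EFin_Rintegral ?lee_fin//.
by apply: (le_integrableR (mf i) (fD i) iD).
Qed.

Section sobolev.
Context {R : realType} (n : nat).
Local Notation mu := (@lebesgue_rV R n).
Local Notation V := 'rV[R]_n.
Local Notation L1 f := (mu.-integrable setT (fun x => (f x)%:E)).
Local Notation muR := (@lebesgue_measure R).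

(** For r <= 1 / (1 + |xi|^2) the Gaussian is at least exp(-1); only that range of [r] is kept, and
    r^(t-1) is integrated over it. *)
Lemma gauss_average_ge (t : R) (xi : V) : 0 < t ->
  ((expR (-1) / t * (1 + n2 xi) `^ (- t))%:E <=
   \int[muR]_r (pw t r * (r <= 1)%R%:R * gs r xi)%:E)%E.
Proof.
move=> t0; have z0 := n2_ge0 xi.
have z1 : 0 < 1 + n2 xi by rewrite ltr_pwDl.
pose dl := (1 + n2 xi)^-1.
have d0 : 0 < dl by rewrite invr_gt0.
have d1 : dl <= 1 by rewrite invf_le1// lerDl.
have m1 : measurable_fun [set: R] (fun r => pw t r * (r <= dl)%R%:R).
  by apply: measurable_funM; [exact: measurable_pw|exact: measurable_ler_nat].
have m2 : measurable_fun [set: R] (fun r => pw t r * (r <= 1)%R%:R * gs r xi).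
  apply: measurable_funM.
    by apply: measurable_funM; [exact: measurable_pw|exact: measurable_ler_nat].
  exact: (measurableT_comp (@measurable_gsp R n) (measurable_pair2 xi)).
apply: (@le_trans _ _ (\int[muR]_r (expR (-1) * (pw t r * (r <= dl)%R%:R))%:E)%E).
  rewrite ge0_RZl; [|exact: m1|by move=> r; rewrite mulr_ge0 ?pw_ge0|exact: expR_ge0].
  rewrite integral_pw_le// -EFinM lee_fin /pw d0 addrK -mulrA ler_wpM2l ?expR_ge0//.
  have -> : dl `^ t = (1 + n2 xi) `^ (- t).
    by rewrite /dl -powR_inv1 ?(ltW z1)// -powRrM mulN1r.
  by rewrite mulrC.
apply: ge0_Rle => //.
- exact: measurable_funM.
- by move=> r; rewrite mulr_ge0 ?expR_ge0// mulr_ge0 ?pw_ge0.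
move=> r; case: (leP r dl) => rd; last by rewrite !mulr0 mulr_ge0 ?gs_ge0// mulr_ge0 ?pw_ge0.
rewrite (le_trans rd d1) !mulr1 mulrC.
have [r0|r0] := ltP 0 r; last by rewrite /pw ltNge r0/= !mul0r.
rewrite ler_wpM2l ?pw_ge0// ler_expR lerN2.
apply: (@le_trans _ _ (dl * n2 xi)); first by rewrite ler_wpM2r.
by rewrite /dl mulrC ler_pdivrMr// mul1r lerDr.
Qed.

(** [b = n (1/2 - 1/q)] is the critical Sobolev regularity for L^q. The factors are, in order, the
    loss in [W_conv], the maximum of the heat kernel, the integral of tau^(t-b-1) over ]0, 1], the
    Fourier normalization and the loss in [gauss_average_ge]. *)
Definition lq_const (q t : R) : R :=
  let b := n%:R / 2 * ((q - 2) / q) in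
  2 * (4 * pi) `^ (- b) / (t - b) / (2 * pi) ^+ n / (expR (-1) / t).

Section fixed_function.
Variables (u1 u2 : V -> R) (B M : R).
Hypothesis c1 : continuous u1.
Hypothesis c2 : continuous u2.
Hypothesis b1 : forall x, `|u1 x| <= B.
Hypothesis b2 : forall x, `|u2 x| <= B.
Hypothesis k1 : forall x, u1 x != 0 -> boxed M x.
Hypothesis k2 : forall x, u2 x != 0 -> boxed M x.

Let m1 : measurable_fun setT u1 := continuous_rV_measurable c1.
Let m2 : measurable_fun setT u2 := continuous_rV_measurable c2.
Let i1 : L1 u1 := integrable_boxed m1 b1 k1.
Let i2 : L1 u2 := integrable_boxed m2 b2 k2.

Let r := modulus u1 u2.
Let r0 x : 0 <= r x := modulus_ge0 u1 u2 x.
Let mr : measurable_fun setT r := measurable_modulus m1 m2.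

Let B0 : 0 <= B. Proof. exact: le_trans (b1 0). Qed.

Let r2E x : r x ^+ 2 = u1 x ^+ 2 + u2 x ^+ 2.
Proof. by rewrite sqr_sqrtr// addr_ge0 ?sqr_ge0. Qed.

Let rB x : r x <= 2 * B.
Proof.
rewrite -(@ler_pXn2r _ 2)// ?nnegrE ?mulr_ge0// r2E.
have sqb (a : R) : `|a| <= B -> a ^+ 2 <= B ^+ 2.
  by move=> ab; rewrite -(real_normK (num_real a)) lerXn2r// ?nnegrE.
have := sqb _ (b1 x); have := sqb _ (b2 x); have := sqr_ge0 B; nra.
Qed.

Let rk x : r x != 0 -> boxed M x.
Proof.
move=> rx; have [z1|] := eqVneq (u1 x) 0; last exact: k1.
have [z2|] := eqVneq (u2 x) 0; last exact: k2.
by move: rx; rewrite /r /modulus z1 z2 expr0n/= addr0 sqrtr0 eqxx.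
Qed.

Lemma measurable_modulus_powR (p : R) : measurable_fun setT (fun x => modulus u1 u2 x `^ p).
Proof. exact: (measurableT_comp (measurable_powR p) mr). Qed.

Lemma integrable_modulus_powR (p : R) : 0 < p -> L1 (fun x => modulus u1 u2 x `^ p).
Proof.
move=> p0; apply: (@integrable_boxed _ _ _ ((2 * B) `^ p) M); first exact: measurable_modulus_powR.
  move=> x; rewrite ger0_norm ?powR_ge0//.
  by apply: ge0_ler_powR; rewrite ?nnegrE ?mulr_ge0 ?(ltW p0)//.
by move=> x; rewrite powR_eq0 negb_and (gt_eqF p0) orbF; exact: rk.
Qed.

Let S x : R := FA u1 u2 x ^+ 2 + FB u1 u2 x ^+ 2.

Variables (q t : R).
Hypothesis q2 : 2 < q.
Hypothesis t0 : 0 < t.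
Hypothesis tq : n%:R * (q - 2) / (2 * q) < t.

Let q0 : 0 < q. Proof. by rewrite (lt_trans _ q2). Qed.

Let X := \int[mu]_x (r x `^ q).

Let XE : (\int[mu]_x (r x `^ q)%:E = X%:E)%E.
Proof. by rewrite EFin_Rintegral//; exact: integrable_modulus_powR. Qed.

Let a := (q - 2) / q.
Let a0 : 0 < a. Proof. by rewrite divr_gt0// subr_gt0. Qed.

Let W x := r x `^ (q - 2).
Let W0 x : 0 <= W x. Proof. exact: powR_ge0. Qed.
Let mW : measurable_fun setT W. Proof. exact: measurable_modulus_powR. Qed.

Let k0 tau : R := (Num.sqrt (4 * pi * tau))^-1 ^+ n.

(** Up to the factor 2, this is Hoelder's inequality for [W] in L^(1/a) against a kernel of mass one
    and maximum [k0 tau]. Where [W <= be] the mass is used; where [W > be] one has [W <= c * r ^ q],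
    and the maximum is used. The threshold [be] makes the two contributions equal. *)
Let W_conv tau (y : V) : 0 < tau -> 0 < X ->
  (\int[mu]_x (W x * hk tau (x - y))%:E <= (2 * (k0 tau * X) `^ a)%:E)%E.
Proof.
move=> tau0 X0.
have p1 := @pi_gt0 R.
have k00 : 0 < k0 tau by rewrite exprn_gt0// invr_gt0 sqrtr_gt0 !mulr_gt0.
pose be := (k0 tau * X) `^ a.
have be0 : 0 < be by rewrite powR_gt0// mulr_gt0.
pose c := be `^ (1 - a^-1).
have c0 : 0 < c by exact: powR_gt0.
have cE : c * (k0 tau * X) = be.
  rewrite /c /be -powRrM mulrBr mulr1 divff ?gt_eqF//.
  have kx : k0 tau * X != 0 by rewrite gt_eqF// mulr_gt0.
  by rewrite powRB ?kx ?implybT// powRr1 ?mulfVK// ltW// mulr_gt0.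
have Wle x : W x <= be + c * r x `^ q.
  have [h|h] := leP (W x) be.
    by rewrite (le_trans h)// lerDl mulr_ge0 ?powR_ge0// ltW.
  have W1 : 0 < W x by exact: lt_trans h.
  apply: (@le_trans _ _ (c * r x `^ q)); last by rewrite lerDr ltW.
  have -> : r x `^ q = W x `^ a^-1.
    by rewrite /W -powRrM /a invf_div; congr (_ `^ _); field; rewrite gt_eqF// subr_gt0.
  have Wn : W x != 0 by rewrite gt_eqF.
  have -> : W x `^ a^-1 = W x * W x `^ (a^-1 - 1).
    rewrite -{2}(powRr1 (ltW W1)) -powRD ?Wn ?implybT//; congr (_ `^ _); ring.
  rewrite mulrCA ler_peMr ?(ltW W1)//.
  have ch : c * be `^ (a^-1 - 1) = 1.
    have ben : be != 0 by rewrite gt_eqF.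
    rewrite /c -powRD ?ben ?implybT// (_ : 1 - a^-1 + (a^-1 - 1) = 0) ?powRr0//; ring.
  rewrite -[leLHS]ch; apply: ler_wpM2l; first exact: ltW.
  apply: ge0_ler_powR; rewrite ?nnegrE ?(ltW be0) ?(ltW W1) ?(ltW h)//.
  by rewrite subr_ge0 -[leLHS]invr1 lef_pV2 ?posrE// /a ler_pdivrMr// mul1r lerBlDr lerDl.
have ik := integrable_hk y tau0.
have mk : measurable_fun setT (fun x : V => hk tau (x - y)) by apply/measurable_EFinP; exact: measurable_int ik.
have mq : measurable_fun setT (fun x => r x `^ q) by exact: measurable_modulus_powR.
apply: (@le_trans _ _ (\int[mu]_x (be * hk tau (x - y) + c * k0 tau * r x `^ q)%:E)%E).
  apply: ge0_Rle.
  - exact: measurable_funM.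
  - by apply: measurable_funD; apply: measurable_funM.
  - by move=> x; rewrite mulr_ge0 ?hk_ge0.
  move=> x; apply: (@le_trans _ _ ((be + c * r x `^ q) * hk tau (x - y))).
    by rewrite ler_wpM2r ?hk_ge0.
  rewrite mulrDl lerD2l.
  have -> : c * k0 tau * r x `^ q = c * r x `^ q * k0 tau by ring.
  apply: ler_wpM2l; first by rewrite mulr_ge0 ?powR_ge0// ltW.
  by apply: (le_trans (ler_norm _)); exact: hk_bound.
rewrite ge0_RD; last 4 first.
- exact: measurable_funM.
- exact: measurable_funM.
- by move=> x; apply: mulr_ge0; [exact: ltW|exact: hk_ge0].
- by move=> x; apply: mulr_ge0; [apply: mulr_ge0; exact: ltW|exact: powR_ge0].
rewrite ge0_RZl; [|exact: mk|by move=> x; exact: hk_ge0|exact: ltW].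
rewrite integral_hk// mule1 ge0_RZl; [|exact: mq|by move=> x; exact: powR_ge0|by apply: mulr_ge0; exact: ltW].
rewrite XE -EFinM -EFinD lee_fin -mulrA cE /be; lra.
Qed.

Let v1 x := W x * u1 x.
Let v2 x := W x * u2 x.
Let mv1 : measurable_fun setT v1. Proof. exact: measurable_funM. Qed.
Let mv2 : measurable_fun setT v2. Proof. exact: measurable_funM. Qed.
Let L : R := (2 * B) `^ (q - 2) * B.

Let WL x : W x <= (2 * B) `^ (q - 2).
Proof. by apply: ge0_ler_powR; rewrite ?nnegrE ?mulr_ge0 ?subr_ge0 ?(ltW q2). Qed.

Let vL (w : V -> R) x : (forall x, `|w x| <= B) -> `|W x * w x| <= L.
Proof. by move=> wB; rewrite normrM (ger0_norm (W0 x)) ler_pM. Qed.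

Let vk (w : V -> R) x : (forall x, w x != 0 -> boxed M x) -> W x * w x != 0 -> boxed M x.
Proof. by move=> wk; rewrite mulf_eq0 negb_or => /andP[_]; exact: wk. Qed.

Let iv1 : L1 v1 := integrable_boxed mv1 (fun x => vL x b1) (fun x => @vk u1 x k1).
Let iv2 : L1 v2 := integrable_boxed mv2 (fun x => vL x b2) (fun x => @vk u2 x k2).

Let Sv x : R := FA v1 v2 x ^+ 2 + FB v1 v2 x ^+ 2.
Let Sv0 x : 0 <= Sv x. Proof. by rewrite addr_ge0 ?sqr_ge0. Qed.
Let mSv : measurable_fun setT Sv.
Proof. by apply: measurable_funD; apply: measurable_funX; [exact: measurable_FA|exact: measurable_FB]. Qed.

Let Wr2 x : W x * r x ^+ 2 = r x `^ q.
Proof.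
have [rx|rx] := eqVneq (r x) 0.
  by rewrite rx expr0n/= mulr0 powR0// gt_eqF.
rewrite /W -powR_mulrn// -powRD ?rx ?implybT//; congr (_ `^ _); ring.
Qed.

Let modulus_v x : modulus v1 v2 x = W x * r x.
Proof.
rewrite /modulus /v1 /v2 !exprMn -mulrDr sqrtrM ?sqr_ge0//.
by rewrite sqrtr_sqr ger0_norm.
Qed.

(** The modulus of [v] is [W r]. AM-GM on r(x) r(y), followed by [W r^2 = r^q], leaves r(y)^q times
    the heat convolution of [W] at [y], which [W_conv] bounds uniformly in [y]. *)
Let gauss_Sv tau : 0 < tau -> 0 < X ->
  (\int[mu]_xi (gs tau xi * Sv xi)%:E <=
   ((2 * pi) ^+ n * (2 * (k0 tau * X) `^ a * X))%:E)%E.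
Proof.
move=> tau0 X0; apply: (le_trans (gauss_parseval_le tau0 iv1 iv2)).
have p0 : 0 <= (2 * pi : R) ^+ n by rewrite exprn_ge0// mulr_ge0// pi_ge0.
rewrite (EFinM ((2 * pi) ^+ n)); apply: lee_wpmul2l; first by rewrite lee_fin.
have mk : measurable_fun [set: V * V] (fun p => hk tau (p.2 - p.1)).
  by under eq_fun do rewrite hkC; exact: measurable_hkB.
have mc1 (f : V -> R) : measurable_fun setT f -> measurable_fun [set: V * V] (fun p => f p.1).
  by move=> mf; exact: (measurableT_comp mf measurable_fst).
have mc2 (f : V -> R) : measurable_fun setT f -> measurable_fun [set: V * V] (fun p => f p.2).
  by move=> mf; exact: (measurableT_comp mf measurable_snd).
have mq : measurable_fun setT (fun x => r x `^ q) by exact: measurable_modulus_powR.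
have mkx y : measurable_fun setT (fun x : V => hk tau (x - y)).
  by apply/measurable_EFinP; exact: measurable_int (integrable_hk y tau0).
apply: (@le_trans _ _ (\int[mu]_y \int[mu]_x (r y `^ q * (W x * hk tau (x - y)))%:E)%E).
  apply: (@le_symmetrized_integral R n
    (fun y x => modulus v1 v2 x * modulus v1 v2 y * hk tau (x - y))
    (fun y x => r y `^ q * (W x * hk tau (x - y)))).
  - apply: measurable_funM => //; apply: measurable_funM.
    + exact: (mc2 _ (measurable_modulus mv1 mv2)).
    + exact: (mc1 _ (measurable_modulus mv1 mv2)).
  - by apply: measurable_funM; [exact: (mc1 _ mq)|apply: measurable_funM => //; exact: (mc2 _ mW)].
  - by move=> y x; rewrite !mulr_ge0 ?modulus_ge0 ?hk_ge0.
  - by move=> y x; rewrite !mulr_ge0 ?powR_ge0 ?hk_ge0.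
  move=> y x; rewrite (hkC tau y x) !modulus_v -!Wr2.
  have := mulr_ge0 (mulr_ge0 (mulr_ge0 (W0 x) (W0 y)) (hk_ge0 tau (x - y))) (sqr_ge0 (r x - r y)).
  lra.
apply: (@le_trans _ _ (\int[mu]_y (2 * (k0 tau * X) `^ a * r y `^ q)%:E)%E).
  apply: ge0_le_integral; [exact: measurableT|by move=> y _; apply: integral_ge0 => x _;
     rewrite lee_fin !mulr_ge0 ?powR_ge0 ?hk_ge0| | |].
  - apply: (@measurable_integral_snd _ _ _ _ _ mu (fun y x : V => r y `^ q * (W x * hk tau (x - y)))).
    + by apply: measurable_funM; [exact: (mc1 _ mq)|apply: measurable_funM => //; exact: (mc2 _ mW)].
    + by move=> y x; rewrite !mulr_ge0 ?powR_ge0 ?hk_ge0.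
  - by apply/measurable_EFinP; exact: measurable_funM.
  move=> y _; rewrite ge0_RZl; last 3 first.
  - exact: measurable_funM.
  - by move=> x; apply: mulr_ge0; [exact: W0|exact: hk_ge0].
  - exact: powR_ge0.
  rewrite mulrC EFinM; apply: lee_wpmul2l; first by rewrite lee_fin powR_ge0.
  exact: W_conv.
rewrite ge0_RZl; last 3 first.
- exact: mq.
- by move=> x; exact: powR_ge0.
- by apply: mulr_ge0 => //; exact: powR_ge0.
by rewrite XE -EFinM.
Qed.

Let b := n%:R / 2 * a.
Let bt : b < t.
Proof. by rewrite /b /a mulf_div. Qed.

Let k0E tau : 0 < tau -> k0 tau `^ a = (4 * pi) `^ (- b) * tau `^ (- b).
Proof.
move=> tau0; have p1 := @pi_gt0 R.
have h : 0 <= 4 * pi * tau :> R by rewrite !mulr_ge0// ltW.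
rewrite /k0 -(powR12_sqrt h) -(powR_inv1 (powR_ge0 _ _)) -powR_mulrn ?powR_ge0//.
rewrite -!powRrM -powRM ?(ltW tau0) ?mulr_ge0// ?(ltW p1)//.
by congr (_ `^ _); rewrite /b; field.
Qed.

Let K1 : R := (2 * pi) ^+ n * (2 * (4 * pi) `^ (- b) / (t - b)).

Let K10 : 0 < K1.
Proof.
have p1 := @pi_gt0 R.
by rewrite mulr_gt0 ?exprn_gt0 ?mulr_gt0 ?invr_gt0 ?subr_gt0 ?powR_gt0 ?mulr_gt0.
Qed.

Let G (xi : V) := expR (-1) / t * (1 + n2 xi) `^ (- t).
Let G0 xi : 0 < G xi.
Proof. by rewrite mulr_gt0 ?divr_gt0 ?expR_gt0 ?powR_gt0 ?ltr_pwDl ?n2_ge0. Qed.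
Let mG : measurable_fun setT G.
Proof.
apply: measurable_funM => //; apply: (measurableT_comp (measurable_powR _)).
by apply: measurable_funD => //; exact: measurable_n2.
Qed.

(** [G] lies below a Gaussian average over tau <= 1. After Tonelli the bound at time tau behaves
    like tau^(t-1-b), integrable at 0 because [t > b]: subcriticality enters here. *)
Let weighted_Sv : 0 < X -> (\int[mu]_xi (G xi * Sv xi)%:E <= (K1 * X `^ a * X)%:E)%E.
Proof.
move=> X0.
pose c (tau : R) := pw t tau * (tau <= 1)%R%:R.
have mc : measurable_fun setT c.
  by apply: measurable_funM; [exact: measurable_pw|exact: measurable_ler_nat].
have c0 tau : 0 <= c tau by rewrite mulr_ge0 ?pw_ge0.
have mJ : measurable_fun [set: V * R] (fun p => Sv p.1 * (c p.2 * gs p.2 p.1)).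
  apply: measurable_funM; first exact: (measurableT_comp mSv measurable_fst).
  apply: measurable_funM; first exact: (measurableT_comp mc measurable_snd).
  exact: (measurableT_comp (@measurable_gsp R n) (@measurable_swap _ _ V R)).
have J0 x tau : 0 <= Sv x * (c tau * gs tau x) by apply: mulr_ge0 => //; apply: mulr_ge0 => //; exact: gs_ge0.
apply: (@le_trans _ _ (\int[mu]_xi \int[muR]_tau (Sv xi * (c tau * gs tau xi))%:E)%E).
  apply: ge0_le_integral; [exact: measurableT|by move=> x _; rewrite lee_fin mulr_ge0// ltW| | |].
  - by apply/measurable_EFinP; exact: measurable_funM.
  - exact: (@measurable_integral_snd _ _ _ _ _ muR (fun x tau => Sv x * (c tau * gs tau x))).
  move=> xi _; rewrite ge0_RZl; last 3 first.
  - apply: measurable_funM => //.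
    exact: (measurableT_comp (@measurable_gsp R n) (measurable_pair2 xi)).
  - by move=> tau; apply: mulr_ge0 => //; exact: gs_ge0.
  - exact: Sv0.
  rewrite mulrC EFinM; apply: lee_wpmul2l; first by rewrite lee_fin.
  exact: gauss_average_ge.
rewrite (@tonelli _ _ _ _ _ mu muR (fun x tau => Sv x * (c tau * gs tau x)))//.
pose d := (2 * pi) ^+ n * 2 * (4 * pi) `^ (- b) * X `^ a * X.
have d0 : 0 <= d by rewrite !mulr_ge0 ?powR_ge0 ?exprn_ge0 ?mulr_ge0 ?pi_ge0// ltW.
apply: (@le_trans _ _ (\int[muR]_tau (d * (pw (t - b) tau * (tau <= 1)%R%:R))%:E)%E).
  apply: ge0_le_integral; [exact: measurableT|by move=> y _; apply: integral_ge0 => x _;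
     rewrite lee_fin| | |].
  - exact: (@measurable_integral_fst _ _ _ _ _ mu (fun x tau => Sv x * (c tau * gs tau x))).
  - apply/measurable_EFinP; apply: measurable_funM => //.
    by apply: measurable_funM; [exact: measurable_pw|exact: measurable_ler_nat].
  move=> tau _.
  have [tau0|tau0] := ltP 0 tau; last first.
    rewrite /c /pw ltNge tau0/= !mul0r mulr0.
    by under eq_integral do rewrite mul0r mulr0; rewrite integral0.
  under eq_integral do rewrite mulrCA (mulrC (Sv _)).
  rewrite ge0_RZl; last 3 first.
  - by apply: measurable_funM => //; exact: measurable_gs.
  - by move=> x; apply: mulr_ge0 => //; exact: gs_ge0.
  - exact: c0.
  apply: (@le_trans _ _ ((c tau)%:E * ((2 * pi) ^+ n * (2 * (k0 tau * X) `^ a * X))%:E)%E).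
    by apply: lee_wpmul2l; [rewrite lee_fin|exact: gauss_Sv].
  rewrite -EFinM lee_fin le_eqVlt; apply/orP; left; apply/eqP.
  rewrite powRM ?(ltW X0) ?exprn_ge0 ?invr_ge0 ?sqrtr_ge0// k0E// /c /pw tau0.
  have -> : tau `^ (t - b - 1) = tau `^ (t - 1) * tau `^ (- b).
    rewrite -powRD ?(gt_eqF tau0) ?implybT//; congr (_ `^ _); ring.
  rewrite /d; ring.
rewrite ge0_RZl; last 3 first.
- by apply: measurable_funM; [exact: measurable_pw|exact: measurable_ler_nat].
- by move=> x; apply: mulr_ge0; [exact: pw_ge0|exact: ler0n].
- exact: d0.
rewrite integral_pw_le ?subr_gt0// -EFinM lee_fin /pw ltr01 powR1 /d /K1.
by rewrite le_eqVlt; apply/orP; left; apply/eqP; ring.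
Qed.

Let S0 x : 0 <= S x. Proof. by rewrite addr_ge0 ?sqr_ge0. Qed.
Let mS : measurable_fun setT S.
Proof. by apply: measurable_funD; apply: measurable_funX; [exact: measurable_FA|exact: measurable_FB]. Qed.

(** Pairing [u] with [v] gives back [X]. On the Fourier side the pairing is split by AM-GM with the
    weights [G^-1] and [G]; the parameter [al] is left free for the final optimization. *)
Let duality (N al : R) : 0 < al -> 0 < X ->
  (\int[mu]_xi ((G xi)^-1 * S xi)%:E = N%:E)%E ->
  (2 * pi) ^+ n * X <= 2^-1 * al * N + 2^-1 / al * (K1 * X `^ a * X).
Proof.
move=> al0 X0 NE.
have P0 : 0 < (2 * pi : R) ^+ n by rewrite exprn_gt0// mulr_gt0// pi_gt0.
rewrite mulrC -ler_pdivlMr//.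
rewrite [leLHS](_ : _ = \int[mu]_y (v1 y * u1 y + v2 y * u2 y)); last first.
  by apply: eq_Rintegral => y _; rewrite -Wr2 r2E /v1 /v2; ring.
(* The bound is proved for the heat regularizations of [u], which stay below [B] and converge
   pointwise; [v] is integrable, so the limit may be taken. *)
apply: (@dominated_Rintegral_le _ _ _ mu
  (fun i y => v1 y * hconv (harmonic i) u1 y + v2 y * hconv (harmonic i) u2 y) _
  (fun y => B * `|v1 y| + B * `|v2 y|)).
- by move=> i; apply: measurable_funD; apply: measurable_funM => //; exact: measurable_hconv.
- by apply: measurable_funD; apply: measurable_funM.
- move=> y; apply: cvgD; apply: cvgMr.
    exact: (@cvg_hconv R n u1 B y c1 b1).
  exact: (@cvg_hconv R n u2 B y c2 b2).
- have iabs v : L1 v -> L1 (fun y => B * `|v y|).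
    move=> iv; apply: integrableZlR.
    by have := integrable_norm iv.
  have := integrableD measurableT (iabs _ iv1) (iabs _ iv2).
  by apply: eq_integrable => // x _; rewrite EFinD.
- move=> i y; apply: (le_trans (ler_normD _ _)); rewrite !normrM.
  by apply: lerD; rewrite mulrC ler_wpM2r// hconv_le// ; exact: harmonic_gt0.
move=> i; have h0 : 0 < harmonic i :> R by exact: harmonic_gt0.
have [ip ep] := parseval h0 i1 i2 iv1 iv2.
rewrite ler_pdivlMr// mulrC -ep -lee_fin -EFin_Rintegral//.
have mF : measurable_fun setT (fun xi => (G xi)^-1 * S xi).
  by apply: measurable_funM => //; exact: (measurableT_comp (@measurable_invr R) mG).
have mH : measurable_fun setT (fun xi => G xi * Sv xi) by exact: measurable_funM.
have F0 xi : 0 <= (G xi)^-1 * S xi by rewrite mulr_ge0// invr_ge0 ltW.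
have H0 xi : 0 <= G xi * Sv xi by rewrite mulr_ge0// ltW.
have ge0_L1 (f : V -> R) : measurable_fun setT f -> (forall x, 0 <= f x) ->
    (\int[mu]_x (f x)%:E < +oo)%E -> L1 f.
  move=> mf f0 foo; apply/integrableP; split; first exact/measurable_EFinP.
  by under eq_integral do rewrite gee0_abs ?lee_fin//.
have iF : L1 (fun xi => (G xi)^-1 * S xi) by apply: ge0_L1; rewrite ?NE ?ltry.
have iH : L1 (fun xi => G xi * Sv xi).
  by apply: ge0_L1 => //; rewrite (le_lt_trans (weighted_Sv X0)) ?ltry.
have al1 : 0 <= 2^-1 * al by rewrite mulr_ge0 ?invr_ge0 ?(ltW al0).
have al2 : 0 <= 2^-1 / al by rewrite mulr_ge0 ?invr_ge0 ?(ltW al0).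
apply: (@le_trans _ _ (\int[mu]_xi (2^-1 * al * ((G xi)^-1 * S xi) + 2^-1 / al * (G xi * Sv xi))%:E)%E).
  apply: le_integral => //.
    have := integrableD measurableT (integrableZlR (2^-1 * al) iF) (integrableZlR (2^-1 / al) iH).
    by apply: eq_integrable => // x _; rewrite EFinD.
  move=> xi _; rewrite lee_fin.
  set A1 := FA u1 u2 xi; set A2 := FA v1 v2 xi; set B1 := FB u1 u2 xi; set B2 := FB v1 v2 xi.
  have g1 : gs (harmonic i) xi <= 1 by apply: gs_le1; exact: ltW.
  have amgm (x y : R) : x * y <= 2^-1 * al * ((G xi)^-1 * x ^+ 2) + 2^-1 / al * (G xi * y ^+ 2).
    rewrite -subr_ge0 (_ : _ - _ = 2^-1 * (al / G xi) * (x - G xi / al * y) ^+ 2).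
      by rewrite mulr_ge0 ?sqr_ge0// mulr_ge0 ?invr_ge0// divr_ge0 ?ltW.
    by field; rewrite !gt_eqF.
  have le_rhs : A1 * A2 + B1 * B2 <=
      2^-1 * al * ((G xi)^-1 * S xi) + 2^-1 / al * (G xi * Sv xi).
    have := amgm A1 A2; have := amgm B1 B2; rewrite /S /Sv -/A1 -/A2 -/B1 -/B2; lra.
  have rhs0 : 0 <= 2^-1 * al * ((G xi)^-1 * S xi) + 2^-1 / al * (G xi * Sv xi).
    by apply: addr_ge0; exact: mulr_ge0.
  (* The Gaussian factor is at most 1, so it decreases a nonnegative pairing; a negative one lies
     below the nonnegative right side anyway. *)
  have [p0|p0] := leP 0 (A1 * A2 + B1 * B2).
    by apply: le_trans le_rhs; rewrite ler_piMl.
  by apply: le_trans rhs0; rewrite mulr_ge0_le0 ?gs_ge0// ltW.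
rewrite ge0_RD; last 4 first.
- exact: measurable_funM.
- exact: measurable_funM.
- by move=> x; exact: mulr_ge0.
- by move=> x; exact: mulr_ge0.
rewrite ge0_RZl; last 3 first.
- exact: mF.
- exact: F0.
- exact: al1.
rewrite NE ge0_RZl; last 3 first.
- exact: mH.
- exact: H0.
- exact: al2.
rewrite -EFinM EFinD; apply: leeD2l.
rewrite (EFinM (2^-1 / al)); apply: lee_wpmul2l; last exact: (weighted_Sv X0).
by rewrite lee_fin.
Qed.

Lemma lq_bound : ((X `^ (2 / q))%:E <=
  (lq_const q t)%:E * \int[mu]_xi ((1 + n2 xi) `^ t * S xi)%:E)%E.
Proof.
have P0 : 0 < (2 * pi : R) ^+ n by rewrite exprn_gt0// mulr_gt0// pi_gt0.
have cE : lq_const q t = K1 / (2 * pi) ^+ n ^+ 2 / (expR (-1) / t).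
  rewrite /lq_const -/a -/b /K1; field.
  by rewrite !gt_eqF ?expR_gt0 ?subr_gt0.
have e0 : 0 < expR (-1) / t by rewrite divr_gt0 ?expR_gt0.
have cst0 : 0 < lq_const q t by rewrite cE; apply: divr_gt0 => //; apply: divr_gt0 => //; exact: exprn_gt0.
have mF : measurable_fun setT (fun xi => (1 + n2 xi) `^ t * S xi).
  apply: measurable_funM => //; apply: (measurableT_comp (measurable_powR _)).
  by apply: measurable_funD => //; exact: measurable_n2.
have F0 xi : 0 <= (1 + n2 xi) `^ t * S xi by rewrite mulr_ge0 ?powR_ge0.
have X1 : 0 <= X by apply: Rintegral_ge0 => x _; exact: powR_ge0.
have I0 : (0 <= \int[mu]_xi ((1 + n2 xi) `^ t * S xi)%:E)%E.
  by apply: integral_ge0 => x _; rewrite lee_fin.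
move: X1; rewrite le_eqVlt => /orP[/eqP<-|X0].
  rewrite powR0 ?mule_ge0 ?lee_fin ?(ltW cst0)//.
  by rewrite mulf_neq0 ?invr_eq0 ?gt_eqF.
have GE xi : (G xi)^-1 * S xi = (expR (-1) / t)^-1 * ((1 + n2 xi) `^ t * S xi).
  by rewrite /G invfM -powRN opprK mulrA.
have := I0; case IE : (\int[mu]_xi _)%E => [N| |]// _; last first.
  by rewrite gt0_muley ?lte_fin// leey.
(* With this value the second term of [duality] is exactly half of its left side and can be
   absorbed, [X] being finite. *)
pose al := K1 * X `^ a / (2 * pi) ^+ n.
have al0 : 0 < al by rewrite divr_gt0// mulr_gt0// powR_gt0.
have NE : (\int[mu]_xi ((G xi)^-1 * S xi)%:E = ((expR (-1) / t)^-1 * N)%:E)%E.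
  under eq_integral do rewrite GE.
  rewrite ge0_RZl; last 3 first.
  - exact: mF.
  - exact: F0.
  - by rewrite invr_ge0 ltW.
  by rewrite IE EFinM.
have := duality al0 X0 NE; rewrite -EFinM lee_fin.
have -> : 2^-1 / al * (K1 * X `^ a * X) = 2^-1 * ((2 * pi) ^+ n * X).
  by rewrite /al; field; rewrite !gt_eqF ?powR_gt0.
move=> h.
have {}h : (2 * pi) ^+ n * X <= al * ((expR (-1) / t)^-1 * N) by move: h; lra.
(* The estimate so far reads X <= const X^a N; dividing by X^a leaves the square of the L^q norm. *)
have XE2 : X = X `^ (2 / q) * X `^ a.
  rewrite -powRD ?(gt_eqF X0) ?implybT// (_ : 2 / q + a = 1) ?powRr1 ?(ltW X0)//.
  by rewrite /a; field; rewrite gt_eqF.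
have Xa : 0 < X `^ a by exact: powR_gt0.
rewrite -(ler_pM2r Xa) -XE2 -(ler_pM2l P0).
apply: (le_trans h); rewrite le_eqVlt; apply/orP; left; apply/eqP.
rewrite cE /al; field; by rewrite !gt_eqF ?expR_gt0.
Qed.

End fixed_function.
End sobolev.

(** * Hardy inequalities with and without remainder *)

Section weights.
Context {R : realType} (n : nat).
Local Notation mu := (@lebesgue_rV R n).
Local Notation V := 'rV[R]_n.
Local Notation muR := (@lebesgue_measure R).

(** The heat kernel as a function of time and of z = |x|^2: all supersolutions are radial, so their
    estimates are done on this scalar profile. *)
Definition hz (r z : R) : R := (Num.sqrt (4 * pi * r))^-1 ^+ n * expR (- (z / (4 * r))).

Lemma hk_hz r (x : V) : hk r x = hz r (n2 x).
Proof. exact: hkE. Qed.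

Lemma hz_ge0 r z : 0 <= hz r z.
Proof. by rewrite mulr_ge0 ?expR_ge0// exprn_ge0// invr_ge0 sqrtr_ge0. Qed.

Lemma hz_le r z z' : 0 < r -> z <= z' -> hz r z' <= hz r z.
Proof.
move=> r0 zz; rewrite ler_wpM2l ?exprn_ge0 ?invr_ge0 ?sqrtr_ge0// ler_expR lerN2.
by rewrite ler_pM2r// invr_gt0 mulr_gt0.
Qed.

(* Uniform in [r >= 1]: the low frequencies are compared with one frequency. *)
Lemma hz_ge r z z' : 1 <= r -> 0 <= z -> 0 <= z' -> hz r z <= expR (z' / 4) * hz r z'.
Proof.
move=> r1 z0 z0'; rewrite mulrCA ler_wpM2l ?exprn_ge0 ?invr_ge0 ?sqrtr_ge0//.
have r0 : 0 < r by exact: lt_le_trans r1.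
rewrite -expRD ler_expR; apply: (@le_trans _ _ 0).
  by rewrite oppr_le0 divr_ge0// mulr_ge0// ltW.
by rewrite subr_ge0 ler_wpM2l// lef_pV2 ?posrE ?mulr_gt0// ler_peMr.
Qed.

Lemma measurable_hz z : measurable_fun [set: R] (fun r => hz r z).
Proof.
apply: measurable_funM.
  apply: measurable_funX; apply: (measurableT_comp (@measurable_invr R)).
  apply: (measurableT_comp (continuous_measurable_fun (@sqrt_continuous R))).
  exact: measurable_funM.
apply: measurableT_comp => //; apply: measurableT_comp => //.
apply: measurable_funM => //; apply: (measurableT_comp (@measurable_invr R)).
exact: measurable_funM.
Qed.

Variable s : R.

Definition hw (w : R -> R) z := (\int[muR]_r (w r * hz r z)%:E)%E.

(** By the semigroup law this is the left side of the Schur condition for the mixture of heat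
    kernels with weight [w]. Both [hw] and [Hw] are additive and monotone in [w], so power weights
    determine the estimates. *)
Definition Hw (w : R -> R) z :=
  (\int[muR]_t \int[muR]_r (pw s t * (w r * hz (t + r) z))%:E)%E.

Section one_weight.
Variable w : R -> R.
Hypothesis mw : measurable_fun setT w.
Hypothesis w0 : forall r, 0 <= w r.

Lemma measurable_hw_fun z : measurable_fun setT (fun r => w r * hz r z).
Proof. by apply: measurable_funM => //; exact: measurable_hz. Qed.

Lemma hw_fun_ge0 z r : 0 <= w r * hz r z.
Proof. by rewrite mulr_ge0 ?hz_ge0. Qed.

Lemma measurable_Hw_fun z :
  measurable_fun [set: R * R] (fun p => pw s p.1 * (w p.2 * hz (p.1 + p.2) z)).
Proof.
apply: measurable_funM; first exact: (measurableT_comp (measurable_pw s) measurable_fst).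
apply: measurable_funM; first exact: (measurableT_comp mw measurable_snd).
by apply: (measurableT_comp (measurable_hz z)); exact: measurable_funD.
Qed.

Lemma Hw_fun_ge0 z t r : 0 <= pw s t * (w r * hz (t + r) z).
Proof. by rewrite !mulr_ge0 ?pw_ge0 ?hz_ge0. Qed.

Lemma measurable_Hw_in z :
  measurable_fun setT (fun t => \int[muR]_r (pw s t * (w r * hz (t + r) z))%:E)%E.
Proof.
exact: (measurable_integral_snd muR (measurable_Hw_fun z) (Hw_fun_ge0 z)).
Qed.

Lemma Hw_in_ge0 z t : (0 <= \int[muR]_r (pw s t * (w r * hz (t + r) z))%:E)%E.
Proof. by apply: integral_ge0 => r _; rewrite lee_fin Hw_fun_ge0. Qed.

Lemma hw_ge0 z : (0 <= hw w z)%E.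
Proof. by apply: integral_ge0 => r _; rewrite lee_fin hw_fun_ge0. Qed.

Lemma measurable_hw : measurable_fun setT (fun x : V => hw w (n2 x)).
Proof.
have m : measurable_fun [set: R * V] (fun p => w p.1 * hk p.1 p.2).
  apply: measurable_funM; last exact: measurable_hk.
  exact: (measurableT_comp mw measurable_fst).
have := measurable_integral_fst muR m (fun r x => mulr_ge0 (w0 r) (hk_ge0 r x)).
by under eq_fun do under eq_integral do rewrite hk_hz.
Qed.

End one_weight.

Lemma hw_le (w w' : R -> R) z : measurable_fun setT w -> measurable_fun setT w' ->
  (forall r, 0 <= w r) -> (forall r, w r <= w' r) -> (hw w z <= hw w' z)%E.
Proof.
move=> mw mw' w0 ww'; apply: ge0_Rle.
- exact: measurable_hw_fun.
- exact: measurable_hw_fun.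
- exact: hw_fun_ge0.
by move=> r; rewrite ler_wpM2r ?hz_ge0.
Qed.

Lemma hwD (w w' : R -> R) z : measurable_fun setT w -> measurable_fun setT w' ->
  (forall r, 0 <= w r) -> (forall r, 0 <= w' r) ->
  hw (fun r => w r + w' r) z = (hw w z + hw w' z)%E.
Proof.
move=> mw mw' w0 w0'; rewrite /hw; under eq_integral do rewrite mulrDl.
by rewrite ge0_RD//; [exact: measurable_hw_fun|exact: measurable_hw_fun|exact: hw_fun_ge0|
  exact: hw_fun_ge0].
Qed.

Lemma Hw_le (w w' : R -> R) z : measurable_fun setT w -> measurable_fun setT w' ->
  (forall r, 0 <= w r) -> (forall r, w r <= w' r) -> (Hw w z <= Hw w' z)%E.
Proof.
move=> mw mw' w0 ww'.
have w0' r : 0 <= w' r by exact: le_trans (ww' r).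
apply: ge0_le_integral; [exact: measurableT|by move=> t _; exact: Hw_in_ge0| | |].
- exact: measurable_Hw_in.
- exact: measurable_Hw_in.
move=> t _; apply: ge0_Rle.
- exact: (measurableT_comp (measurable_Hw_fun mw z) (measurable_pair1 t)).
- exact: (measurableT_comp (measurable_Hw_fun mw' z) (measurable_pair1 t)).
- by move=> r; exact: Hw_fun_ge0.
by move=> r; rewrite ler_wpM2l ?pw_ge0// ler_wpM2r ?hz_ge0.
Qed.

Lemma HwD (w w' : R -> R) z : measurable_fun setT w -> measurable_fun setT w' ->
  (forall r, 0 <= w r) -> (forall r, 0 <= w' r) ->
  Hw (fun r => w r + w' r) z = (Hw w z + Hw w' z)%E.
Proof.
move=> mw mw' w0 w0'.
rewrite /Hw -ge0_integralD; last 5 first.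
- exact: measurableT.
- by move=> t _; exact: Hw_in_ge0.
- exact: measurable_Hw_in.
- by move=> t _; exact: Hw_in_ge0.
- exact: measurable_Hw_in.
apply: eq_integral => t _; under eq_integral do rewrite mulrDl mulrDr.
rewrite ge0_RD//.
- exact: (measurableT_comp (measurable_Hw_fun mw z) (measurable_pair1 t)).
- exact: (measurableT_comp (measurable_Hw_fun mw' z) (measurable_pair1 t)).
- by move=> r; exact: Hw_fun_ge0.
- by move=> r; exact: Hw_fun_ge0.
Qed.

Local Notation D := (n%:R / 2 : R).

Definition hw_const b : R := (4 * pi) `^ (- D) * 4 `^ (D - b) * Gamma (D - b).

Lemma hw_const_gt0 b : b < D -> 0 < hw_const b.
Proof.
by move=> bD; rewrite !mulr_gt0 ?powR_gt0 ?mulr_gt0 ?pi_gt0// Gamma_gt0 ?subr_gt0.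
Qed.

(** Integrating r^(b-1) p_r over [r] gives a multiple of |x|^(2b - n). Convergence at large [r] is
    the condition [b < n / 2]; at small [r] the Gaussian factor takes care of it since [z > 0]. *)
Lemma hw_pw b z : b < D -> 0 < z -> hw (pw b) z = (hw_const b * z `^ (b - D))%:E.
Proof.
move=> bD z0; have Db : 0 < D - b by rewrite subr_gt0.
have p4 : 0 < 4 * pi :> R by rewrite mulr_gt0// pi_gt0.
have z4 : 0 < z / 4 by rewrite divr_gt0.
rewrite /hw; transitivity (\int[muR]_r ((4 * pi) `^ (- D) *
    (pw (- (D - b)) r * expR (- (z / 4 / r))))%:E)%E.
  apply: eq_integral => r _; congr EFin.
  have [r0|r0] := ltP 0 r; last by rewrite /pw ltNge r0/= !mul0r mulr0.
  have h : 0 <= 4 * pi * r :> R by rewrite mulr_ge0// ltW.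
  rewrite /hz -(powR12_sqrt h) -(powR_inv1 (powR_ge0 _ _)) -powR_mulrn ?powR_ge0//.
  rewrite -!powRrM (_ : 2^-1 * (-1 * n%:R) = - D); last by field.
  rewrite powRM ?(ltW p4) ?(ltW r0)// (_ : - (D - b) = b + - D); last by ring.
  rewrite pwD// invfM -(mulrA z); ring.
rewrite ge0_RZl; last 3 first.
- apply: measurable_funM; first exact: measurable_pw.
  apply: measurableT_comp => //; apply: measurableT_comp => //.
  by apply: measurable_funM => //; exact: measurable_invr.
- by move=> r; rewrite mulr_ge0 ?pw_ge0 ?expR_ge0.
- exact: powR_ge0.
rewrite integral_pw_expRV// -EFinM; congr EFin.
have e4 : 4^-1 `^ (- (D - b)) = 4 `^ (D - b) :> R.
  by rewrite -(@powR_inv1 _ 4)// -powRrM mulN1r opprK.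
rewrite (powRM _ (ltW z0)) ?invr_ge0// /hw_const.
rewrite e4 opprB; ring.
Qed.

Hypothesis s0 : 0 < s.

(** The number L(b) with which (-Laplacian)^(-s) acts on |x|^(2b - n), a factor |x|^(2s) being split
    off. It is symmetric under b -> n/2 - s - b, whose fixed point is (n - 2s)/4. *)
Definition hardy_factor b : R :=
  Gamma b * Gamma (D - s - b) / (Gamma (b + s) * Gamma (D - b)) * 4 `^ (- s).

Lemma hardy_factor_gt0 b : 0 < b -> b + s < D -> 0 < hardy_factor b.
Proof.
move=> b0 bs; apply: mulr_gt0; last exact: powR_gt0.
by apply: divr_gt0; apply: mulr_gt0; apply: Gamma_gt0 => //; have := s0; lra.
Qed.

(** [liouville] with the heat kernel as [F]: the weights [pw s] and [pw b] combine into [beta s b]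
    times [pw (s + b)], which [hw_pw] evaluates. This asks for [b + s < n / 2]. *)
Lemma Hw_pw b z : 0 < b -> b + s < D -> 0 < z ->
  Hw (pw b) z = (Gamma s * hardy_factor b * z `^ s * (hw_const b * z `^ (b - D)))%:E.
Proof.
move=> b0 bs z0.
have := @liouville R s b (fun r => hz r z) (measurable_hz z) (fun r => hz_ge0 r z).
under eq_integral do under eq_integral do rewrite -mulrA.
rewrite -/(Hw (pw b) z) => ->.
have bsD : s + b < D by rewrite addrC.
have h := hw_pw bsD z0; rewrite /hw in h; rewrite h betaE// -EFinM; congr EFin.
rewrite /hw_const /hardy_factor.
have -> : z `^ (s + b - D) = z `^ s * z `^ (b - D).
  by rewrite -powRD ?(gt_eqF z0) ?implybT// addrA.
have -> : 4 `^ (D - (s + b)) = 4 `^ (- s) * 4 `^ (D - b) :> R.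
  have n4 : 4 != 0 :> R by [].
  rewrite -powRD ?n4 ?implybT//; congr (_ `^ _); ring.
have -> : D - s - b = D - (s + b) by ring.
rewrite (addrC b s).
have g1 : Gamma (s + b) != 0 by rewrite gt_eqF// Gamma_gt0 ?addr_gt0.
have g2 : Gamma (D - b) != 0 by rewrite gt_eqF// Gamma_gt0//; have := s0; lra.
move: (Gamma (s + b)) (Gamma (D - b)) (Gamma (D - (s + b))) g1 g2 => G1 G2 G3 g1 g2.
move: (Gamma s) (Gamma b) (z `^ s) (z `^ (b - D)) (4 `^ _) (4 `^ _) ((4 * pi) `^ _) => *.
by field; rewrite g2 g1.
Qed.

Section supersolution.
Variables (w : R -> R) (th : V -> R).
Hypothesis n0 : (0 < n)%N.
Hypothesis mw : measurable_fun setT w.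
Hypothesis w0 : forall r, 0 <= w r.
Hypothesis wN : forall r, r <= 0 -> w r = 0.
Hypothesis hwoo : forall z, 0 < z -> (hw w z < +oo)%E.
Hypothesis hwgt0 : forall z, 0 < z -> (0 < hw w z)%E.
Hypothesis Hwle : forall x : V, x != 0 ->
  (Hw w (n2 x) <= (Gamma s * th x)%:E * hw w (n2 x))%E.

(** Passes from scalar profiles to functions on R^n: Tonelli exchanges the mixture with the
    convolution, and p_t * p_r = p_(t + r) identifies the result with [Hw]. *)
Lemma weight_supersolution : exists h : V -> R,
  [/\ measurable_fun setT h, forall x, 0 < h x &
    forall x : V, x != 0 ->
    (\int[muR]_t \int[mu]_y (pw s t * (h y * hk t (y - x)))%:E <=
     (Gamma s * th x * h x)%:E)%E].
Proof.
(* [hw w 0] may be infinite; the value 1 at this single point keeps [h] real and positive. *)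
pose h (x : V) := if x == 0 then 1 else fine (hw w (n2 x)).
have m0 : measurable [set (0 : V)].
  rewrite (_ : [set 0] = boxed 0 :> set V); first exact: measurable_boxed.
  apply/seteqP; split => x /=; first by move=> -> i; rewrite mxE normr0.
  by move=> h1; apply/rowP => i; rewrite mxE; apply/eqP; rewrite -normr_le0; exact: h1.
have mh : measurable_fun setT h.
  apply: measurable_fun_ifT => //; last first.
    exact: (measurableT_comp (@fine_measurable R setT measurableT) (measurable_hw mw w0)).
  apply: (@measurable_fun_bool _ _ _ _ true); rewrite setTI.
  rewrite (_ : _ @^-1` _ = [set (0 : V)])//.
  by apply/seteqP; split => x /=; [move/eqP|move=> ->; rewrite eqxx].
have hE (x : V) : x != 0 -> (h x)%:E = hw w (n2 x).
  move=> x0; rewrite /h (negbTE x0) fineK// ge0_fin_numE ?hw_ge0//.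
  by apply: hwoo; exact: n2_gt0.
have h0 x : 0 < h x.
  have [->|x0] := eqVneq x 0; first by rewrite /h eqxx.
  by rewrite -lte_fin hE//; apply: hwgt0; exact: n2_gt0.
exists h; split => // x x0.
rewrite EFinM hE//; apply: le_trans (Hwle x0).
rewrite le_eqVlt; apply/orP; left; apply/eqP; apply: eq_integral => t _.
have [t0|t0] := ltP 0 t; last first.
  rewrite /pw ltNge t0/=; under eq_integral do rewrite mul0r.
  by rewrite integral0; under eq_integral do rewrite mul0r; rewrite integral0.
have mk : measurable_fun [set: V] (fun y => hk t (y - x)).
  by apply/measurable_EFinP; exact: measurable_int (integrable_hk x t0).
pose g (y : V) (r : R) := pw s t * hk t (y - x) * (w r * hk r y).
have mg : measurable_fun [set: V * R] (fun p => g p.1 p.2).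
  apply: measurable_funM.
    apply: measurable_funM => //; exact: (measurableT_comp mk measurable_fst).
  apply: measurable_funM; first exact: (measurableT_comp mw measurable_snd).
  exact: (measurableT_comp (@measurable_hk R n) (@measurable_swap _ _ V R)).
have g0 y r : 0 <= g y r by rewrite mulr_ge0 ?mulr_ge0 ?pw_ge0 ?hk_ge0.
transitivity (\int[mu]_y \int[muR]_r (g y r)%:E)%E.
  apply: ae_eq_integral.
  - exact: measurableT.
  - by apply/measurable_EFinP; apply: measurable_funM => //; exact: measurable_funM.
  - exact: (measurable_integral_snd muR mg g0).
  exists [set (0 : V)]; split; [exact: m0|exact: lebesgue_rV_origin|].
  move=> y /= /not_implyP[_ neq]; apply: contrapT => /eqP y0; apply: neq.
  rewrite /g ge0_RZl; last 3 first.
  - by apply: measurable_funM => //; under eq_fun do rewrite hk_hz; exact: measurable_hz.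
  - by move=> r; apply: mulr_ge0 => //; exact: hk_ge0.
  - by rewrite mulr_ge0 ?pw_ge0 ?hk_ge0.
  under eq_integral do rewrite hk_hz.
  by rewrite -/(hw w (n2 y)) -hE// -EFinM (mulrC (h y)) mulrA.
rewrite (tonelli mu muR mg g0); apply: eq_integral => r _.
have [r0|r0] := ltP 0 r; last first.
  by rewrite wN// mul0r mulr0; under eq_integral do rewrite /g wN// mul0r mulr0; rewrite integral0.
transitivity (\int[mu]_y (pw s t * w r * (hk t (x - y) * hk r y))%:E)%E.
  by apply: eq_integral => y _; rewrite /g (hkC t x y); congr EFin; ring.
rewrite ge0_RZl; last 3 first.
- apply: measurable_funM; last exact: measurable_hkr.
  by under eq_fun do rewrite hkC; exact: mk.
- by move=> y; rewrite mulr_ge0 ?hk_ge0.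
- by rewrite mulr_ge0 ?pw_ge0.
by rewrite integral_hk_conv// -EFinM hk_hz mulrA.
Qed.
End supersolution.

End weights.

(** The algebra at high frequency, where [A0 * y * P], [A1 * P] and [A2 / x * P] are the profiles of
    exponents b0, b1, b2. Half of the gain (L1 - L0) A1 is spent on [K], the other half absorbs the
    cutoff error; the lower bounds on [y] make the profile positive and keep the multiplier
    nonnegative. *)
Lemma dominant_balance (R : realType) (A0 A1 A2 L0 L1 L2 x y P : R) :
  0 < A0 -> 0 < A1 -> 0 < A2 -> 0 < L0 -> L0 < L1 -> 0 < L2 -> 0 < P -> 0 < x ->
  let K := (L1 - L0) * A1 / (2 * A0) in
  A1 / A0 + 1 <= y -> K / L0 <= y -> L2 * A2 / ((L1 - L0) * A1 / 2) <= x ->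
  [/\ A1 * P < A0 * y * P, K / y <= L0 &
    L0 * (A0 * y * P) + L2 * (A2 / x * P) - L1 * (A1 * P) <=
    (L0 - K / y) * (A0 * y * P - A1 * P)].
Proof.
move=> A00 A10 A20 L00 L01 L20 P0 x0 K h1 h2 h3.
have LL : 0 < L1 - L0 by rewrite subr_gt0.
have LA : 0 < (L1 - L0) * A1 / 2 by rewrite divr_gt0// mulr_gt0.
have K0 : 0 < K by rewrite divr_gt0// mulr_gt0.
have y0 : 0 < y by apply: lt_le_trans h1; rewrite ltr_wpDl// divr_ge0// ltW.
have {}h1 : A1 < A0 * y.
  rewrite mulrC -ltr_pdivrMr//; apply: lt_le_trans h1; by rewrite ltrDl.
have {}h2 : K / y <= L0 by rewrite ler_pdivrMr// mulrC -ler_pdivrMr.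
have {}h3 : L2 * A2 / x <= (L1 - L0) * A1 / 2.
  by rewrite ler_pdivrMr// (mulrC _ x) -ler_pdivrMr.
split => //; first by rewrite ltr_pM2r.
have -> : L0 * (A0 * y * P) + L2 * (A2 / x * P) - L1 * (A1 * P) =
  (L0 * (A0 * y) + L2 * A2 / x - L1 * A1) * P by ring.
have -> : (L0 - K / y) * (A0 * y * P - A1 * P) = (L0 - K / y) * (A0 * y - A1) * P by ring.
apply: ler_wpM2r; first exact: ltW.
have KA : K * A0 = (L1 - L0) * A1 / 2 by rewrite /K; field; rewrite gt_eqF.
have q0 : 0 <= K / y * A1 by apply: mulr_ge0; [apply: divr_ge0|]; exact: ltW.
have -> : (L0 - K / y) * (A0 * y - A1) = L0 * (A0 * y) - L0 * A1 - K * A0 + K / y * A1.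
  by field; rewrite gt_eqF.
rewrite KA; lra.
Qed.

(** * Supersolutions for the sharp and the improved Hardy inequality *)

Section improved_hardy.
Context {R : realType} (n : nat) (s : R).
Local Notation mu := (@lebesgue_rV R n).
Local Notation V := 'rV[R]_n.
Local Notation muR := (@lebesgue_measure R).
Local Notation D := (n%:R / 2 : R).
Hypothesis n0 : (0 < n)%N.
Hypothesis s0 : 0 < s.
Hypothesis sD : s < D.

Let b0 : R := (n%:R - 2 * s) / 4.
Let b00 : 0 < b0. Proof. by rewrite /b0; move: sD; lra. Qed.
Let b0s : b0 + s < D. Proof. by rewrite /b0; move: sD; lra. Qed.

Lemma hardy_factor_mid : hardy_factor n s b0 = (hardy_const n s)^-1.
Proof.
have e2 : 4 `^ (- s) = (2 `^ (2 * s))^-1 :> R.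
  by rewrite powRrM -powRN (_ : 2 `^ 2 = 4)//; rewrite powR_mulrn//; ring.
rewrite /hardy_factor /hardy_const e2 /b0.
have -> : D - s - (n%:R - 2 * s) / 4 = (n%:R - 2 * s) / 4 by lra.
have -> : (n%:R - 2 * s) / 4 + s = (n%:R + 2 * s) / 4 by lra.
have -> : D - (n%:R - 2 * s) / 4 = (n%:R + 2 * s) / 4 by lra.
have p0 : 2 `^ (2 * s) != 0 :> R by rewrite gt_eqF// powR_gt0.
have g1 : Gamma ((n%:R + 2 * s) / 4) != 0 :> R.
  by rewrite gt_eqF// Gamma_gt0// divr_gt0// addr_gt0 ?mulr_gt0// ltr0n.
have g2 : Gamma ((n%:R - 2 * s) / 4) != 0 :> R by rewrite gt_eqF// Gamma_gt0.
move: (Gamma _) (Gamma _) (2 `^ _) g1 g2 p0 => G1 G2 P g1 g2 p0.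
by field; apply/and3P.
Qed.

(** Up to a constant the factor is B(a, s) B(D - s - a, s). The first arguments have the fixed sum D
    - s = 2 b0, so strict log-convexity makes the midpoint the strict minimum. *)
Lemma hardy_factor_lt b : 0 < b < b0 -> hardy_factor n s b0 < hardy_factor n s b.
Proof.
move=> /andP[b1 b2].
have fE a : 0 < a -> a + s < D -> hardy_factor n s a =
    fine (beta a s) * fine (beta (D - s - a) s) * (4 `^ (- s) / Gamma s ^+ 2).
  move=> a0 aD.
  rewrite !betaE//=; last by lra.
  rewrite /hardy_factor (_ : D - s - a + s = D - a); last by ring.
  have g0 : Gamma s != 0 by rewrite gt_eqF// Gamma_gt0.
  have g1 : Gamma (a + s) != 0 by rewrite gt_eqF// Gamma_gt0 ?addr_gt0.
  have g2 : Gamma (D - a) != 0 by rewrite gt_eqF// Gamma_gt0//; move: s0; lra.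
  move: (Gamma (a + s)) (Gamma (D - a)) (Gamma s) (Gamma a) (Gamma (D - s - a)) (4 `^ _) g0 g1 g2 => *.
  by field; apply/and3P.
rewrite !fE//; last by move: b0s; lra.
have e1 : D - s - b0 = b0 by rewrite /b0; lra.
have e2 : b0 = (D - s) / 2 by rewrite /b0; lra.
rewrite e1 ltr_pM2r; last by rewrite divr_gt0 ?powR_gt0 ?exprn_gt0 ?Gamma_gt0.
rewrite -expr2 {1}e2; apply: beta_log_convex => //.
  by rewrite b1/=; move: b2 b00; rewrite e2; lra.
by rewrite -e2 lt_eqF.
Qed.

Lemma hardy_supersolution : exists h : V -> R,
  [/\ measurable_fun setT h, forall x, 0 < h x &
    forall x : V, x != 0 ->
    (\int[muR]_t \int[mu]_y (pw s t * (h y * hk t (y - x)))%:E <=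
     (Gamma s * ((hardy_const n s)^-1 * n2 x `^ s) * h x)%:E)%E].
Proof.
have bD : b0 < D by move: b0s s0; lra.
apply: (@weight_supersolution R n s (pw b0)) => //.
- exact: measurable_pw.
- exact: pw_ge0.
- by move=> r r0; rewrite /pw ltNge r0.
- by move=> z z0; rewrite hw_pw// ltry.
- by move=> z z0; rewrite hw_pw// lte_fin mulr_gt0 ?powR_gt0// hw_const_gt0.
move=> x /n2_gt0 z0; rewrite hw_pw// Hw_pw// hardy_factor_mid -EFinM lee_fin.
by rewrite !mulrA.
Qed.

Variable t : R.
Hypothesis t0 : 0 < t.
Hypothesis ts : t < s.
Hypothesis tb : s - b0 < t.

(** The gain relative to z^s is of order z^(b1 - b0), so the target exponent [t] prescribes [b1];
    the hypothesis [s - b0 < t] is its positivity. For the cutoff error any exponent in ]0, b1[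
    would serve; halving makes b1 - b2 equal to [b2]. *)
Let b1 := b0 - (s - t).
Let b2 := b1 / 2.
Let b1_gt0 : 0 < b1. Proof. by rewrite /b1; move: tb; lra. Qed.
Let b10 : b1 < b0. Proof. by rewrite /b1; move: ts; lra. Qed.
Let b2_gt0 : 0 < b2. Proof. by rewrite /b2 divr_gt0. Qed.
Let b21 : b2 < b1. Proof. by rewrite /b2; move: b1_gt0; lra. Qed.

(** The cutoff has two effects: the difference of powers is nonnegative for r > 1, and at times at
    least 1 heat kernels at low frequencies are mutually comparable, which [hz_ge] exploits. [wc] is
    the correction it causes. *)
Let w (r : R) : R := (1 < r)%R%:R * (pw b0 r - pw b1 r).
Let wc (r : R) : R := (r <= 1)%R%:R * (pw b1 r - pw b0 r).

Let pw_ge (a b r : R) : 1 <= r -> a <= b -> pw a r <= pw b r.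
Proof.
by move=> r1 ab; rewrite /pw (lt_le_trans ltr01 r1) ler_powR// lerD2r.
Qed.

Let pw_le (a b r : R) : r <= 1 -> a <= b -> pw b r <= pw a r.
Proof.
move=> r1 ab; have [r0|r0] := ltP 0 r; last by rewrite /pw ltNge r0.
have r2 : 1 <= r^-1 by rewrite invf_ge1.
have e c : pw c r = r^-1 `^ (1 - c).
  by rewrite /pw r0 -(powR_inv1 (ltW r0)) -powRrM mulN1r opprB.
by rewrite !e ler_powR// lerD2l lerN2.
Qed.

Let w0 r : 0 <= w r.
Proof.
rewrite /w; case: (ltP 1 r) => r1; last by rewrite mul0r.
by rewrite mul1r subr_ge0; apply: pw_ge; exact: ltW.
Qed.

Let wc0 r : 0 <= wc r.
Proof.
rewrite /wc; case: (leP r 1) => r1; last by rewrite mul0r.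
by rewrite mul1r subr_ge0; apply: pw_le => //; exact: ltW.
Qed.

Let mw : measurable_fun setT w.
Proof.
apply: measurable_funM; last by apply: measurable_funB; exact: measurable_pw.
rewrite (_ : (fun _ => _) = (fun r : R => 1 - (r <= 1)%R%:R)).
  by apply: measurable_funB => //; exact: measurable_ler_nat.
by apply/funext => r; case: (leP r 1) => _; rewrite ?subrr ?subr0.
Qed.

Let mwc : measurable_fun setT wc.
Proof.
apply: measurable_funM; last by apply: measurable_funB; exact: measurable_pw.
exact: measurable_ler_nat.
Qed.

(** Written without subtraction, so that additivity of [hw] and [Hw] on nonnegative weights applies
    to it. *)
Let w_split r : w r + pw b1 r = pw b0 r + wc r.
Proof. by rewrite /w /wc; case: (leP r 1) => _ /=; ring. Qed.

Let w_le r : w r <= pw b0 r.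
Proof.
rewrite /w; case: (ltP 1 r) => r1; last by rewrite mul0r pw_ge0.
by rewrite mul1r gerBl pw_ge0.
Qed.

(** On r <= 1 a smaller exponent gives a larger power. The price is a profile of exponent [b2 < b1],
    which decays faster at high frequency than the gain from [b1]. *)
Let wc_le r : wc r <= pw b2 r.
Proof.
rewrite /wc; case: (leP r 1) => r1; last by rewrite mul0r pw_ge0.
rewrite mul1r; apply: (@le_trans _ _ (pw b1 r)); first by rewrite gerBl pw_ge0.
by apply: pw_le => //; exact: ltW.
Qed.

Let wN r : r <= 1 -> w r = 0.
Proof. by move=> r1; rewrite /w ltNge r1 mul0r. Qed.

Let A (b : R) := hw_const n b.
Let L b := hardy_factor n s b.
Let hb (b z : R) := A b * z `^ (b - D).

Let bD b : b <= b0 -> b < D. Proof. by move: b0s s0; lra. Qed.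
Let bsD b : b <= b0 -> b + s < D. Proof. by move: b0s; lra. Qed.
Let A0 b : b <= b0 -> 0 < A b. Proof. by move=> h; exact/hw_const_gt0/bD. Qed.
Let L0 b : 0 < b -> b <= b0 -> 0 < L b.
Proof. by move=> h h'; apply: hardy_factor_gt0 => //; exact: bsD. Qed.

Let hw_upper z : 0 < z -> (hw n w z <= (hb b0 z)%:E)%E.
Proof.
move=> z0; rewrite -hw_pw//; last exact: bD.
by apply: hw_le => //; exact: measurable_pw.
Qed.

Let hw_lower z : 0 < z -> ((hb b0 z - hb b1 z)%:E <= hw n w z)%E.
Proof.
move=> z0.
have mp b := @measurable_pw R b.
have : (hw n w z + (hb b1 z)%:E = (hb b0 z)%:E + hw n wc z)%E.
  rewrite /hb -!hw_pw ?bD ?(ltW b10)// -(hwD n z mw (mp b1) w0 (pw_ge0 b1)) -(hwD n z (mp b0) mwc (pw_ge0 b0) wc0).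
  by congr (hw n _ z); apply/funext => r; exact: w_split.
move=> e; rewrite EFinB leeBlDr// e leeDl// hw_ge0//.
Qed.

(** Here the cutoff correction has the unfavourable sign and costs the [b2] term, whereas in
    [hw_lower] it is simply dropped. *)
Let Hw_upper z : 0 < z ->
  (Hw n s w z <= (Gamma s * z `^ s * (L b0 * hb b0 z + L b2 * hb b2 z - L b1 * hb b1 z))%:E)%E.
Proof.
move=> z0.
have mp b := @measurable_pw R b.
have HE b : 0 < b -> b <= b0 -> Hw n s (pw b) z = (Gamma s * z `^ s * (L b * hb b z))%:E.
  by move=> h h'; rewrite Hw_pw// ?bsD//; congr EFin; rewrite /L /hb /A; ring.
have b20 : b2 <= b0 by rewrite ltW// (lt_trans b21).
have : (Hw n s w z + Hw n s (pw b1) z = Hw n s (pw b0) z + Hw n s wc z)%E.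
  rewrite -(HwD n s z mw (mp b1) w0 (pw_ge0 b1)) -(HwD n s z (mp b0) mwc (pw_ge0 b0) wc0).
  by congr (Hw n s _ z); apply/funext => r; exact: w_split.
rewrite !HE// ?(ltW b10)// => e.
rewrite mulrBr EFinB leeBrDr// e mulrDr EFinD leeD2l// -HE//.
by apply: Hw_le.
Qed.

Let powR_large (c Q : R) : 0 < c -> exists2 Z, 0 < Z & forall z, Z <= z -> Q <= z `^ c.
Proof.
move=> c0; exists ((`|Q| + 1) `^ c^-1) => [|z Zz].
  by rewrite powR_gt0// ltr_wpDl.
apply: (@le_trans _ _ (`|Q| + 1)); first by rewrite (le_trans (ler_norm _))// lerDl.
have -> : `|Q| + 1 = ((`|Q| + 1) `^ c^-1) `^ c.
  by rewrite -powRrM mulVf ?gt_eqF// powRr1.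
have z0 : 0 <= z by exact: le_trans (powR_ge0 _ _) Zz.
by apply: ge0_ler_powR; rewrite ?nnegrE ?powR_ge0 ?(ltW c0).
Qed.

Let K := (L b1 - L b0) * A b1 / (2 * A b0).
Let LL : 0 < L b1 - L b0. Proof. by rewrite subr_gt0 hardy_factor_lt// b1_gt0. Qed.
Let K0 : 0 < K.
Proof. by apply: divr_gt0; apply: mulr_gt0 => //; apply: A0 => //; exact: ltW. Qed.

(** The three thresholds ensure, in turn, a positive lower bound for the profile, a nonnegative
    multiplier, and a cutoff error small enough for [dominant_balance]. *)
Let high : exists2 Z0, 0 < Z0 & forall z, Z0 <= z -> [/\ hb b1 z < hb b0 z,
  K * z `^ t <= L b0 * z `^ s &
  (Hw n s w z <= (Gamma s * (L b0 * z `^ s - K * z `^ t))%:E * hw n w z)%E].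
Proof.
have st : 0 < s - t by rewrite subr_gt0.
have [Z1 Z10 h1] := powR_large (A b1 / A b0 + 1) st.
have [Z2 Z20 h2] := powR_large (K / L b0) st.
have [Z3 Z30 h3] := powR_large (L b2 * A b2 / ((L b1 - L b0) * A b1 / 2)) b2_gt0.
exists (Num.max Z1 (Num.max Z2 Z3)); first by rewrite lt_max Z10.
move=> z; rewrite !ge_max => /and3P[/h1 {}h1 zZ2 /h3 {}h3].
have z0 : 0 < z by exact: lt_le_trans zZ2.
have {}h2 := h2 _ zZ2.
have A0' := A0 (lexx b0); have A1' := A0 (ltW b10).
have A2' : 0 < A b2 by apply: A0; rewrite ltW// (lt_trans b21).
have L0' := L0 b00 (lexx b0).
have L2' : 0 < L b2 by apply: L0 => //; rewrite ltW// (lt_trans b21).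
have Gs := Gamma_gt0 s0.
have zs : 0 < z `^ s by exact: powR_gt0.
pose P := z `^ (b1 - D); have P0 : 0 < P by exact: powR_gt0.
pose y := z `^ (s - t); have y0 : 0 < y by exact: powR_gt0.
pose x := z `^ b2; have x0 : 0 < x by exact: powR_gt0.
have zn : z != 0 by rewrite gt_eqF.
have yE : y * P = z `^ (b0 - D).
  by rewrite /y /P -powRD ?zn ?implybT//; congr (_ `^ _); rewrite /b1; ring.
have e0 : hb b0 z = A b0 * y * P by rewrite -mulrA yE.
have e1 : hb b1 z = A b1 * P by [].
have xE : x^-1 * P = z `^ (b2 - D).
  rewrite /x /P -powRN -powRD ?zn ?implybT//; congr (_ `^ _).
  by rewrite /b2; field.
have e2 : hb b2 z = A b2 / x * P by rewrite -mulrA xE.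
have et : z `^ t = z `^ s / y.
  by rewrite /y -powRN -powRD ?zn ?implybT//; congr (_ `^ _); ring.
have LL' : L b0 < L b1 by rewrite -subr_gt0.
have [g1 g2 g3] := @dominant_balance R _ _ _ _ _ _ x y P A0' A1' A2' L0' LL' L2' P0 x0 h1 h2 h3.
have Kz : K * z `^ t <= L b0 * z `^ s.
  rewrite et (_ : K * (z `^ s / y) = K / y * z `^ s); last by ring.
  by apply: ler_wpM2r; [exact: ltW|exact: g2].
split; [by rewrite e0 e1|exact: Kz|].
apply: (le_trans (Hw_upper z0)).
have c0 : 0 <= Gamma s * (L b0 * z `^ s - K * z `^ t).
  by apply: mulr_ge0; [exact: ltW|rewrite subr_ge0].
apply: (@le_trans _ _ ((Gamma s * (L b0 * z `^ s - K * z `^ t))%:E * (hb b0 z - hb b1 z)%:E)%E).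
  rewrite -EFinM lee_fin et.
  have -> : Gamma s * (L b0 * z `^ s - K * (z `^ s / y)) * (hb b0 z - hb b1 z) =
    Gamma s * z `^ s * ((L b0 - K / y) * (hb b0 z - hb b1 z)) by ring.
  apply: ler_wpM2l; first by rewrite mulr_ge0 ?ltW.
  by rewrite e0 e1 e2.
by apply: lee_wpmul2l; [rewrite lee_fin|exact: hw_lower].
Qed.

Lemma improved_supersolution : exists (K M : R) (h : V -> R),
  [/\ 0 < K, 0 <= M,
    forall x : V, 0 <= (hardy_const n s)^-1 * n2 x `^ s + M - K * n2 x `^ t,
    measurable_fun setT h /\ (forall x, 0 < h x) &
    forall x : V, x != 0 ->
    (\int[muR]_t \int[mu]_y (pw s t * (h y * hk t (y - x)))%:E <=
     (Gamma s * ((hardy_const n s)^-1 * n2 x `^ s + M - K * n2 x `^ t) * h x)%:E)%E].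
Proof.
have [Z0 Z00 hZ] := high.
have Gs := Gamma_gt0 s0.
have [hZ1 hZ2 hZ3] := hZ _ (lexx Z0).
have L0' := L0 b00 (lexx b0).
(* Below [Z0], [hz_ge] bounds [Hw] by exp(Z0/4) times its value at [Z0], where [high] applies, and
   [hw] is nonincreasing in [z]. The second summand of [M] below compensates the term - K z^t. *)
pose M1 := expR (Z0 / 4) * (L b0 * Z0 `^ s).
have M10 : 0 <= M1 by apply: mulr_ge0; [exact: expR_ge0|apply: mulr_ge0; [exact: ltW|exact: powR_ge0]].
pose M := M1 + K * Z0 `^ t.
have hw_anti z : z <= Z0 -> (hw n w Z0 <= hw n w z)%E.
  move=> zZ; apply: ge0_Rle.
  - exact: measurable_hw_fun.
  - exact: measurable_hw_fun.
  - exact: hw_fun_ge0.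
  move=> r; have [r1|r1] := leP r 1; first by rewrite wN// !mul0r.
  by rewrite ler_wpM2l// hz_le// (lt_trans ltr01).
have Hw_low z : 0 <= z -> z <= Z0 -> (Hw n s w z <= (Gamma s * M1)%:E * hw n w z)%E.
  move=> z0 zZ; apply: (@le_trans _ _ ((expR (Z0 / 4))%:E * Hw n s w Z0)%E).
    rewrite -ge0_integralZl_EFin; last 4 first.
    - exact: measurableT.
    - by move=> u _; exact: Hw_in_ge0.
    - exact: measurable_Hw_in.
    - exact: expR_ge0.
    have mH z' u := measurableT_comp (@measurable_Hw_fun R n s w mw z') (@measurable_pair1 _ _ R R u).
    apply: ge0_le_integral; [exact: measurableT|by move=> u _; exact: Hw_in_ge0| | |].
    - exact: measurable_Hw_in.
    - by apply: measurable_funeM; exact: measurable_Hw_in.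
    move=> u _; rewrite -ge0_RZl; last 3 first.
    - exact: mH.
    - by move=> r; exact: Hw_fun_ge0.
    - exact: expR_ge0.
    apply: ge0_Rle.
    - exact: mH.
    - by apply: measurable_funM => //; exact: mH.
    - by move=> r; exact: Hw_fun_ge0.
    move=> r; have [r1|r1] := leP r 1; first by rewrite wN// !(mul0r, mulr0).
    have [u0|u0] := ltP 0 u; last by rewrite /pw ltNge u0/= !mul0r mulr0.
    rewrite [leRHS]mulrCA; apply: ler_wpM2l; first exact: pw_ge0.
    rewrite [leRHS]mulrCA; apply: ler_wpM2l => //; apply: hz_ge => //; last exact: ltW.
    by rewrite (le_trans (ltW r1))// lerDr ltW.
  apply: (@le_trans _ _ ((expR (Z0 / 4))%:E *
      ((Gamma s * (L b0 * Z0 `^ s - K * Z0 `^ t))%:E * hw n w Z0))%E).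
    by apply: lee_wpmul2l => //; rewrite lee_fin expR_ge0.
  rewrite muleA -EFinM; apply: (@le_trans _ _ ((Gamma s * M1)%:E * hw n w Z0)%E).
    apply: lee_wpmul2r; first exact: hw_ge0.
    rewrite lee_fin /M1 mulrCA; apply: ler_wpM2l; first exact: ltW.
    apply: ler_wpM2l; first exact: expR_ge0.
    by rewrite gerBl mulr_ge0 ?powR_ge0// ltW.
  by apply: lee_wpmul2l; [rewrite lee_fin mulr_ge0// ltW|exact: hw_anti].
have tle z : 0 <= z -> z <= Z0 -> K * z `^ t <= K * Z0 `^ t.
  move=> z0 zZ; apply: ler_wpM2l; first exact: ltW.
  by apply: ge0_ler_powR; rewrite ?nnegrE// ltW.
have Lz z : 0 <= L b0 * z `^ s by apply: mulr_ge0; [exact: ltW|exact: powR_ge0].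
have M0 : 0 <= M by apply: addr_ge0 => //; apply: mulr_ge0; [exact: ltW|exact: powR_ge0].
have th0 z : 0 <= z -> 0 <= L b0 * z `^ s + M - K * z `^ t.
  move=> z0; have [Zz|zZ] := leP Z0 z.
    by have [_ h2 _] := hZ _ Zz; move: h2 M0; lra.
  by have := tle _ z0 (ltW zZ); have := Lz z; move: M10; rewrite /M; lra.
exists K, M; rewrite -hardy_factor_mid -/(L b0).
suff [h [mh h0 hh]] : exists h : V -> R, [/\ measurable_fun setT h, forall x, 0 < h x &
    forall x : V, x != 0 ->
    (\int[muR]_t \int[mu]_y (pw s t * (h y * hk t (y - x)))%:E <=
     (Gamma s * (L b0 * n2 x `^ s + M - K * n2 x `^ t) * h x)%:E)%E].
  exists h; split => //.
  by move=> x; exact/th0/n2_ge0.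
apply: (@weight_supersolution R n s w (fun x => L b0 * n2 x `^ s + M - K * n2 x `^ t)) => //.
- by move=> r r0; rewrite wN// (le_trans r0).
- by move=> z z0; rewrite (le_lt_trans (hw_upper z0)) ?ltry.
- have gZ z : Z0 <= z -> (0 < hw n w z)%E.
    move=> Zz; have [h1 _ _] := hZ _ Zz.
    by apply: lt_le_trans (hw_lower (lt_le_trans Z00 Zz)); rewrite lte_fin subr_gt0.
  move=> z z0; have [Zz|zZ] := leP Z0 z; first exact: gZ.
  by rewrite (lt_le_trans (gZ _ (lexx _)))// hw_anti// ltW.
move=> x /n2_gt0 z0; have [Zz|zZ] := leP Z0 (n2 x).
  have [_ _ h3] := hZ _ Zz; apply: (le_trans h3).
  apply: lee_wpmul2r; first exact: hw_ge0.
  rewrite lee_fin ler_wpM2l ?(ltW Gs)// addrAC lerDl; exact: M0.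
apply: (le_trans (Hw_low _ (ltW z0) (ltW zZ))).
apply: lee_wpmul2r; first exact: hw_ge0.
rewrite lee_fin ler_wpM2l ?(ltW Gs)//.
have := tle _ (ltW z0) (ltW zZ); have := Lz (n2 x); rewrite /M; lra.
Qed.

End improved_hardy.

(** * Test functions *)

Section energy.
Context {R : realType} (n : nat).
Local Notation mu := (@lebesgue_rV R n).
Local Notation V := 'rV[R]_n.
Local Notation L1 f := (mu.-integrable setT (fun x => (f x)%:E)).

Variables (u1 u2 : V -> R) (B M : R).
Hypothesis c1 : continuous u1.
Hypothesis c2 : continuous u2.
Hypothesis b1 : forall x, `|u1 x| <= B.
Hypothesis b2 : forall x, `|u2 x| <= B.
Hypothesis k1 : forall x, u1 x != 0 -> boxed M x.
Hypothesis k2 : forall x, u2 x != 0 -> boxed M x.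

Let m1 : measurable_fun setT u1 := continuous_rV_measurable c1.
Let m2 : measurable_fun setT u2 := continuous_rV_measurable c2.
Let i1 : L1 u1 := integrable_boxed m1 b1 k1.
Let i2 : L1 u2 := integrable_boxed m2 b2 k2.

Let S x : R := FA u1 u2 x ^+ 2 + FB u1 u2 x ^+ 2.
Let S0 x : 0 <= S x. Proof. by rewrite addr_ge0 ?sqr_ge0. Qed.
Let mS : measurable_fun setT S.
Proof.
by apply: measurable_funD; apply: measurable_funX; [exact: measurable_FA|exact: measurable_FB].
Qed.

Let P : R := (2 * pi) ^+ n.
Let P0 : 0 < P.
Proof. by rewrite exprn_gt0// mulr_gt0// pi_gt0. Qed.

Lemma mass_lty : (\int[mu]_x (u1 x ^+ 2 + u2 x ^+ 2)%:E < +oo)%E.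
Proof.
have j : L1 (fun x => u1 x ^+ 2 + u2 x ^+ 2).
  apply: (@integrable_boxed _ _ _ (B ^+ 2 + B ^+ 2) M).
  - by apply: measurable_funD; apply: measurable_funX.
  - move=> x; rewrite ger0_norm ?addr_ge0 ?sqr_ge0// -(real_normK (num_real (u1 x))).
    rewrite -(real_normK (num_real (u2 x))).
    have B0 : 0 <= B by exact: le_trans (b1 x).
    by apply: lerD; rewrite lerXn2r// nnegrE.
  move=> x h; have [z1|] := eqVneq (u1 x) 0; last exact: k1.
  have [z2|] := eqVneq (u2 x) 0; last exact: k2.
  by move: h; rewrite z1 z2 expr0n/= addr0 eqxx.
by rewrite EFin_Rintegral// ltry.
Qed.

Variable s : R.
Hypothesis n0 : (0 < n)%N.
Hypothesis s0 : 0 < s.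
Hypothesis sD : s < n%:R / 2.

Let C := hardy_const n s.
Let C0 : 0 < C.
Proof.
by rewrite mulr_gt0 ?powR_gt0// divr_gt0// exprn_gt0// Gamma_gt0//;
  rewrite divr_gt0//; move: s0 sD; lra.
Qed.

(** Potential energy, kinetic energy and mass, named as real numbers so that differences make sense.
    The factor [P] in [kE] is the square of the Fourier normalization missing from [FA] and [FB]. *)
Variables v k m : R.
Hypothesis vE : (\int[mu]_x (enorm x `^ (- (2 * s)) * (u1 x ^+ 2 + u2 x ^+ 2))%:E = v%:E)%E.
Hypothesis kE : (\int[mu]_xi (n2 xi `^ s * S xi)%:E = (P * k)%:E)%E.
Hypothesis mE : (\int[mu]_x (u1 x ^+ 2 + u2 x ^+ 2)%:E = m%:E)%E.

Let mn2 p : measurable_fun [set: V] (fun x => n2 x `^ p).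
Proof. exact: (measurableT_comp (measurable_powR p) (@measurable_n2 R n)). Qed.

Lemma hardy_le : C * v <= k.
Proof.
have [h [mh h0 hh]] := hardy_supersolution n0 s0 sD.
have mth : measurable_fun [set: V] (fun x => C^-1 * n2 x `^ s) by exact: measurable_funM.
have th0 (x : V) : 0 <= C^-1 * n2 x `^ s by rewrite mulr_ge0 ?powR_ge0// invr_ge0 ltW.
have := @schur R n u1 u2 B M c1 c2 b1 b2 k1 k2 s h _ n0 s0 mh mth h0 th0 hh.
rewrite vE -/S; under eq_integral do rewrite -mulrA.
rewrite ge0_RZl; last 3 first.
- exact: measurable_funM.
- by move=> x; apply: mulr_ge0; [exact: powR_ge0|exact: S0].
- by rewrite invr_ge0 ltW.
rewrite kE -!EFinM lee_fin mulrCA ler_pM2l// => h1.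
by rewrite mulrC -ler_pdivlMr// mulrC.
Qed.

Lemma mass_ge0 : 0 <= m.
Proof. by rewrite -lee_fin -mE; apply: integral_ge0 => x _; rewrite lee_fin addr_ge0 ?sqr_ge0. Qed.

Lemma fourier_mass_le : (\int[mu]_xi (S xi)%:E <= (P * m)%:E)%E.
Proof. by rewrite EFinM -mE; exact: (@plancherel_le R n u1 u2 B M). Qed.

Lemma improved_hardy_le (t K L : R) (h : V -> R) : 0 < t -> 0 < K -> 0 <= L ->
  (forall x : V, 0 <= C^-1 * n2 x `^ s + L - K * n2 x `^ t) ->
  measurable_fun setT h -> (forall x, 0 < h x) ->
  (forall x : V, x != 0 ->
    (\int[@lebesgue_measure R]_t \int[mu]_y (pw s t * (h y * hk t (y - x)))%:E <=
     (Gamma s * (C^-1 * n2 x `^ s + L - K * n2 x `^ t) * h x)%:E)%E) ->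
  (\int[mu]_xi (n2 xi `^ t * S xi)%:E <= (P * ((C^-1 * k - v + L * m) / K))%:E)%E.
Proof.
move=> t0 K0 L0 th0 mh h0 hh.
have mth : measurable_fun [set: V] (fun x => C^-1 * n2 x `^ s + L - K * n2 x `^ t).
  apply: measurable_funB; last exact: measurable_funM.
  by apply: measurable_funD => //; exact: measurable_funM.
have Ci0 : 0 <= C^-1 by rewrite invr_ge0 ltW.
have mnS p : measurable_fun [set: V] (fun x => n2 x `^ p * S x) by exact: measurable_funM.
have nS0 p (x : V) : 0 <= n2 x `^ p * S x by rewrite mulr_ge0 ?powR_ge0.
have := @schur R n u1 u2 B M c1 c2 b1 b2 k1 k2 s h _ n0 s0 mh mth h0 th0 hh.
rewrite vE -EFinM -/S => h1.
pose J := (\int[mu]_xi (n2 xi `^ t * S xi)%:E)%E.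
(* The negative part of the multiplier is moved to the left, because [J] is not yet known to be
   finite; the inequality itself then excludes an infinite [J]. *)
have h2 : ((P * v)%:E + K%:E * J <= (C^-1 * (P * k) + L * (P * m))%:E)%E.
  rewrite /J -ge0_RZl; last 3 first.
  - exact: mnS.
  - exact: nS0.
  - exact: ltW.
  apply: (le_trans (leeD2r _ h1)); rewrite -ge0_RD; last 4 first.
  - exact: measurable_funM.
  - exact: measurable_funM.
  - by move=> x; exact: (mulr_ge0 (th0 x) (S0 x)).
  - by move=> x; apply: mulr_ge0 => //; exact: ltW.
  have e x : (C^-1 * n2 x `^ s + L - K * n2 x `^ t) * S x + K * (n2 x `^ t * S x) =
    C^-1 * (n2 x `^ s * S x) + L * S x by ring.
  under eq_integral do rewrite e.
  rewrite ge0_RD; last 4 first.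
  - exact: measurable_funM.
  - exact: measurable_funM.
  - by move=> x; exact: mulr_ge0.
  - by move=> x; exact: mulr_ge0.
  rewrite ge0_RZl// ge0_RZl// kE EFinD [in leRHS]EFinM leeD2l// (EFinM L).
  by apply: lee_wpmul2l; [rewrite lee_fin|exact: fourier_mass_le].
have J0 : (0 <= J)%E by apply: integral_ge0 => x _; rewrite lee_fin.
rewrite -/J; move: h2 J0; case: J => [j| |]//.
- rewrite -EFinM -EFinD !lee_fin => h2 j0.
  rewrite mulrA ler_pdivlMr//; move: h2; nra.
- by rewrite gt0_muley ?lte_fin// addey// leye_eq.
Qed.

Lemma fourier_weight_le (t : R) : 0 < t ->
  (\int[mu]_xi ((1 + n2 xi) `^ t * S xi)%:E <=
   (2 `^ t)%:E * (\int[mu]_xi (S xi)%:E + \int[mu]_xi (n2 xi `^ t * S xi)%:E))%E.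
Proof.
move=> t0.
have mnS p : measurable_fun [set: V] (fun x => n2 x `^ p * S x) by exact: measurable_funM.
rewrite -ge0_RD//; last by move=> x; rewrite mulr_ge0 ?powR_ge0.
rewrite -ge0_RZl; last 3 first.
- exact: measurable_funD.
- by move=> x; rewrite addr_ge0// mulr_ge0 ?powR_ge0.
- exact: powR_ge0.
apply: ge0_Rle.
- apply: measurable_funM => //; apply: (measurableT_comp (measurable_powR _)).
  by apply: measurable_funD => //; exact: measurable_n2.
- by apply: measurable_funM => //; exact: measurable_funD.
- by move=> x; rewrite mulr_ge0 ?powR_ge0.
move=> x; rewrite (_ : 2 `^ t * (_ + _) = 2 `^ t * (1 + n2 x `^ t) * S x); last by ring.
apply: ler_wpM2r => //.
have z0 := n2_ge0 x.
have mono (a b : R) : 0 <= a -> a <= b -> a `^ t <= b `^ t.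
  move=> a0 ab; apply: ge0_ler_powR; rewrite ?nnegrE ?(ltW t0)//.
  exact: le_trans ab.
have [z1|z1] := leP (n2 x) 1.
  apply: (@le_trans _ _ (2 `^ t)); first by apply: mono; [rewrite addr_ge0|lra].
  by rewrite ler_peMr ?powR_ge0// lerDl powR_ge0.
apply: (@le_trans _ _ ((2 * n2 x) `^ t)); first by apply: mono; [rewrite addr_ge0|lra].
by rewrite powRM// ler_wpM2l ?powR_ge0// lerDr.
Qed.

End energy.

Section test_functions.
Context {R : realType} (n : nat).
Local Notation mu := (@lebesgue_rV R n).
Local Notation V := 'rV[R]_n.
Local Notation L1 f := (mu.-integrable setT (fun x => (f x)%:E)).
Local Notation normc := ComplexField.Normc.normc.
Variable u : V -> R[i].
Local Notation u1 := (fun x : V => complex.Re (u x)).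
Local Notation u2 := (fun x : V => complex.Im (u x)).

Lemma normc_modulus x : normc (u x) = modulus u1 u2 x.
Proof. by rewrite /modulus; case: (u x). Qed.

Lemma compact_support_boxed : compact (closure [set x | u x != 0]) ->
  exists M, forall x, u x != 0 -> boxed M x.
Proof.
move=> /compact_bounded[M [_ hM]]; exists (M + 1) => x ux i.
have : `|x| <= M + 1.
  by apply: (hM (M + 1)); [rewrite ltrDl|exact: subset_closure].
apply: le_trans; rewrite /Num.norm/= mx_normrE.
by apply: (le_bigmax _ (fun ij : 'I_1 * 'I_n => `|x ij.1 ij.2|) (ord0, i)).
Qed.

Lemma compact_support_bounded (f : V -> R) : continuous f ->
  compact (closure [set x | u x != 0]) -> (forall x, f x != 0 -> u x != 0) ->
  exists B, forall x, `|f x| <= B.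
Proof.
move=> cf cK fu.
have cfK : compact (f @` closure [set x | u x != 0]).
  apply: continuous_compact => //.
  by apply: continuous_subspaceT.
have [B [_ hB]] := @compact_bounded R R^o _ cfK.
exists (`|B| + 1) => x; have [->|fx] := eqVneq (f x) 0; first by rewrite normr0 addr_ge0.
apply: (hB (`|B| + 1)); first by rewrite (le_lt_trans (ler_norm _))// ltrDl.
by exists x => //; exact/subset_closure/fu.
Qed.

Hypothesis i1 : L1 u1.
Hypothesis i2 : L1 u2.

Lemma normc_fourier (xi : V) : normc (fourier u xi) ^+ 2 =
  ((2 * pi) ^+ n)^-1 * (FA u1 u2 xi ^+ 2 + FB u1 u2 xi ^+ 2).
Proof.
have reE x : complex.Re (u x * expi (- dotp xi x)) = u1 x * cos (dotp xi x) + u2 x * sin (dotp xi x).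
  rewrite /expi cosN sinN; case: (u x) => a b /=; ring.
have imE x : complex.Im (u x * expi (- dotp xi x)) = u2 x * cos (dotp xi x) - u1 x * sin (dotp xi x).
  rewrite /expi cosN sinN; case: (u x) => a b /=; ring.
have p0 : 0 <= 2 * pi :> R by rewrite mulr_ge0// pi_ge0.
rewrite /fourier /Cintegral.
have -> : \int[mu]_x complex.Re (u x * expi (- dotp xi x)) = FA u1 u2 xi.
  rewrite /FA /fc /fs -RintegralD//; [|exact: integrable_cosM|exact: integrable_sinM].
  by apply: eq_Rintegral => x _.
have -> : \int[mu]_x complex.Im (u x * expi (- dotp xi x)) = FB u1 u2 xi.
  rewrite /FB /fc /fs -RintegralB//; [|exact: integrable_cosM|exact: integrable_sinM].
  by apply: eq_Rintegral => x _.
have cE : ((2 * pi) `^ (- (n%:R / 2))) ^+ 2 = ((2 * pi) ^+ n)^-1 :> R.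
  rewrite -powR_mulrn ?powR_ge0// -powRrM -powR_mulrn// -powRN; congr (_ `^ _).
  by field.
rewrite -cE; move: (FA _ _ _) (FB _ _ _) ((2 * pi) `^ _) => a b c.
rewrite /= sqr_sqrtr ?addr_ge0 ?sqr_ge0//; ring.
Qed.

Lemma LqnormE (q : R) : 0 < q -> L1 (fun x => modulus u1 u2 x `^ q) ->
  (Lqnorm q u ^+ 2 = ((\int[mu]_x (modulus u1 u2 x `^ q)) `^ (2 / q))%:E)%E.
Proof.
move=> q0 iq; rewrite /Lqnorm Lnorm.unlock.
have -> : (\int[mu]_x (`|(EFin \o @ComplexField.Normc.normc R \o u) x| `^ q) =
    \int[mu]_x (modulus u1 u2 x `^ q)%:E)%E.
  apply: eq_integral => x _; rewrite /= normc_modulus.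
  by rewrite ger0_norm ?modulus_ge0// poweR_EFin.
rewrite EFin_Rintegral// poweR_EFin -EFin_expe; congr EFin.
rewrite -powR_mulrn ?powR_ge0// -powRrM; congr (_ `^ _); ring.
Qed.

Lemma hardy_formE (s : R) : (hardy_form s u =
  ((2 * pi) ^+ n)^-1%:E *
    \int[mu]_xi (n2 xi `^ s * (FA u1 u2 xi ^+ 2 + FB u1 u2 xi ^+ 2))%:E
  - (hardy_const n s)%:E * \int[mu]_x (enorm x `^ (- (2 * s)) * (u1 x ^+ 2 + u2 x ^+ 2))%:E)%E.
Proof.
rewrite /hardy_form; congr (_ - _ * _)%E.
  rewrite -ge0_RZl; last 3 first.
  - apply: measurable_funM.
      exact: (measurableT_comp (measurable_powR s) (@measurable_n2 R n)).
    by apply: measurable_funD; apply: measurable_funX; [exact: measurable_FA|exact: measurable_FB].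
  - by move=> x; rewrite mulr_ge0 ?powR_ge0// addr_ge0 ?sqr_ge0.
  - by rewrite invr_ge0 exprn_ge0// mulr_ge0// pi_ge0.
  apply: eq_integral => x _.
  by rewrite normc_fourier enorm_powR; congr EFin; ring.
apply: eq_integral => x _; congr (_ * _)%:E.
by rewrite normc_modulus sqr_sqrtr ?addr_ge0 ?sqr_ge0.
Qed.

End test_functions.

Lemma lq_const_gt0 (R : realType) (n : nat) (q t : R) : 2 < q -> 0 < t ->
  n%:R * (q - 2) / (2 * q) < t -> 0 < lq_const n q t.
Proof.
move=> q2 t0 tq; have p0 := @pi_gt0 R.
have e : n%:R / 2 * ((q - 2) / q) < t by rewrite mulf_div.
rewrite /lq_const; apply: divr_gt0; last by rewrite divr_gt0 ?expR_gt0.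
apply: divr_gt0; last by rewrite exprn_gt0// mulr_gt0.
by apply: divr_gt0; [rewrite mulr_gt0 ?powR_gt0 ?mulr_gt0|rewrite subr_gt0].
Qed.

Theorem corollary2p5 (R : realType) (d : nat) (s q : R) :
  (1 <= d)%N -> 0 < s < Num.min 1 (d%:R / 2) ->
  2 <= q < 2 * d%:R / (d%:R - 2 * s) ->
  exists2 C : R, 0 < C &
    forall u : 'rV[R]_d -> R[i], C0infty u ->
      (Lqnorm q u ^+ 2 <= C%:E * (hardy_form s u + Lqnorm 2 u ^+ 2))%E.
Proof.
move=> d0 /andP[s0]; rewrite lt_min => /andP[_ sD] /andP[q2 qs].
set C := hardy_const d s.
pose P : R := (2 * pi) ^+ d.
have P0 : 0 < P by rewrite exprn_gt0// mulr_gt0// pi_gt0.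
have C0 : 0 < C.
  by rewrite mulr_gt0 ?powR_gt0// divr_gt0// exprn_gt0// Gamma_gt0//;
    rewrite divr_gt0//; move: s0 sD; lra.
(* Reduction to an inequality between real numbers. Mass and potential energy are finite; if the
   kinetic integral is infinite, so is the right side, and the claim is trivial. Hence no decay of
   the Fourier transform is ever proved. *)
have reduction (C' : R) : 0 < C' ->
  (forall (u1 u2 : 'rV[R]_d -> R) (B M v k m : R),
    continuous u1 -> continuous u2 ->
    (forall x, `|u1 x| <= B) -> (forall x, `|u2 x| <= B) ->
    (forall x, u1 x != 0 -> boxed M x) -> (forall x, u2 x != 0 -> boxed M x) ->
    (\int[lebesgue_rV d]_x (enorm x `^ (- (2 * s)) * (u1 x ^+ 2 + u2 x ^+ 2))%:E = v%:E)%E ->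
    (\int[lebesgue_rV d]_xi (n2 xi `^ s * (FA u1 u2 xi ^+ 2 + FB u1 u2 xi ^+ 2))%:E =
      (P * k)%:E)%E ->
    (\int[lebesgue_rV d]_x (u1 x ^+ 2 + u2 x ^+ 2)%:E = m%:E)%E ->
    (\int[lebesgue_rV d]_x (modulus u1 u2 x `^ q)) `^ (2 / q) <= C' * (k - C * v + m)) ->
  exists2 C : R, 0 < C &
    forall u : 'rV[R]_d -> R[i], C0infty u ->
      (Lqnorm q u ^+ 2 <= C%:E * (hardy_form s u + Lqnorm 2 u ^+ 2))%E.
  move=> C'0 H; exists C' => // u [sm1 sm2 cK].
  set u1 := fun x => complex.Re (u x); set u2 := fun x => complex.Im (u x).
  have c1 : continuous u1 by have [] := sm1 [::].
  have c2 : continuous u2 by have [] := sm2 [::].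
  have z1 x : u1 x != 0 -> u x != 0 by apply: contra_neq; rewrite /u1 => ->.
  have z2 x : u2 x != 0 -> u x != 0 by apply: contra_neq; rewrite /u2 => ->.
  have [M hM] := compact_support_boxed cK.
  have [B1 hB1] := compact_support_bounded c1 cK z1.
  have [B2 hB2] := compact_support_bounded c2 cK z2.
  pose B := Num.max B1 B2.
  have b1 x : `|u1 x| <= B by rewrite le_max hB1.
  have b2 x : `|u2 x| <= B by rewrite le_max hB2 orbT.
  have k1 x : u1 x != 0 -> boxed M x by move/z1; exact: hM.
  have k2 x : u2 x != 0 -> boxed M x by move/z2; exact: hM.
  have i1 := integrable_boxed (continuous_rV_measurable c1) b1 k1.
  have i2 := integrable_boxed (continuous_rV_measurable c2) b2 k2.
  have ip p : 0 < p -> (lebesgue_rV d).-integrable setT (fun x => (modulus u1 u2 x `^ p)%:E).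
    by move=> p0; exact: (@integrable_modulus_powR R d u1 u2 B M).
  have ge0 (f : 'rV[R]_d -> R) : (forall x, 0 <= f x) -> (0 <= \int[lebesgue_rV d]_x (f x)%:E)%E.
    by move=> f0; apply: integral_ge0 => x _; rewrite lee_fin.
  have sq0 (a b : R) : 0 <= a ^+ 2 + b ^+ 2 by rewrite addr_ge0 ?sqr_ge0.
  have mE : (\int[lebesgue_rV d]_x (u1 x ^+ 2 + u2 x ^+ 2)%:E = Lqnorm 2 u ^+ 2)%E.
    rewrite LqnormE//; last exact: ip.
    rewrite divff// powRr1; last by apply: Rintegral_ge0 => x _; exact: powR_ge0.
    rewrite -EFin_Rintegral; last exact: ip.
    by apply: eq_integral => x _; rewrite powR_mulrn ?modulus_ge0// sqr_sqrtr.
  rewrite LqnormE//; [|by apply: lt_le_trans q2|by apply: ip; apply: lt_le_trans q2].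
  rewrite hardy_formE//.
  have := mass_lty c1 c2 b1 b2 k1 k2.
  have := potential_lty c1 c2 b1 b2 k1 k2 s0 sD.
  have := ge0 _ (fun x => sq0 (u1 x) (u2 x)).
  have := ge0 _ (fun x => mulr_ge0 (powR_ge0 (enorm x) (- (2 * s))) (sq0 (u1 x) (u2 x))).
  rewrite -mE.
  case vE : (integral _ _ (fun x => (_ `^ (- (2 * s)) * _)%:E)) => [v| |]// _.
  case mE' : (integral _ _ _) => [m| |]// _ _ _.
  have := ge0 _ (fun xi => mulr_ge0 (powR_ge0 (n2 xi) s) (sq0 (FA u1 u2 xi) (FB u1 u2 xi))).
  case kE : (integral _ _ _) => [k| |]// _; last first.
    by rewrite gt0_muley ?lte_fin ?invr_gt0// addye// gt0_muley ?lte_fin// leey.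
  rewrite -EFinM lee_fin.
  apply: (H u1 u2 B M v (P^-1 * k) m) => //.
  by rewrite kE mulrA divff ?mul1r// gt_eqF.
(* At [q = 2] the left side is the mass, and Hardy's inequality gives the claim with constant 1. *)
have [q2'|q2'] := leP q 2.
  have qE : q = 2 by apply/eqP; rewrite eq_le q2' q2.
  apply: (reduction 1) => // u1 u2 B M v k m c1 c2 b1 b2 k1 k2 vE kE mE.
  have h := hardy_le c1 c2 b1 b2 k1 k2 d0 s0 sD vE kE.
  rewrite qE divff// powRr1; last by apply: Rintegral_ge0 => x _; exact: powR_ge0.
  rewrite mul1r -[leLHS]add0r lerD ?subr_ge0//.
  rewrite -lee_fin -EFin_Rintegral; last exact: (@integrable_modulus_powR R d u1 u2 B M).
  rewrite -mE le_eqVlt; apply/orP; left; apply/eqP; apply: eq_integral => x _.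
  by rewrite powR_mulrn ?modulus_ge0// sqr_sqrtr// addr_ge0 ?sqr_ge0.
have q0 : 0 < q by exact: lt_trans q2'.
(* The three lower bounds on [t]: positivity, positivity of the exponent b1, and the critical
   regularity for L^q. The second is below [s] because [s < d / 2], the third because [q] is below
   the critical exponent. *)
pose t1 := Num.max 0 (Num.max (s - (d%:R - 2 * s) / 4) (d%:R * (q - 2) / (2 * q))).
have t1s : t1 < s.
  rewrite !gt_max s0/=; apply/andP; split; first by move: sD; lra.
  rewrite ltr_pdivrMr ?mulr_gt0//.
  by move: qs; rewrite ltr_pdivlMr//; lra.
pose t := (t1 + s) / 2.
have ts : t < s by rewrite midf_lt.
have : t1 < t by rewrite midf_lt.
rewrite !gt_max => /and3P[t0 tb tq].
have [K [L [h [K0 L0 th0 [mh h0] hh]]]] := improved_supersolution d0 s0 sD t0 ts tb.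
have lq0 := lq_const_gt0 q2' t0 tq.
pose c := lq_const d q t * 2 `^ t * P.
have c0 : 0 < c by apply: mulr_gt0 => //; apply: mulr_gt0 => //; exact: powR_gt0.
(* The estimates end in c (m + C^-1/K (k - C v) + L/K m). Since [m] and, by Hardy, [k - C * v] are
   nonnegative, the sum of the coefficients dominates each of them. *)
pose C' := c * (1 + C^-1 / K + L / K).
have CK : 0 <= C^-1 / K by rewrite divr_ge0 ?invr_ge0// ltW.
have LK : 0 <= L / K by rewrite divr_ge0// ltW.
apply: (reduction C'); first by rewrite mulr_gt0//; move: CK LK; lra.
move=> u1 u2 B M v k m c1 c2 b1 b2 k1 k2 vE kE mE.
have hl := hardy_le c1 c2 b1 b2 k1 k2 d0 s0 sD vE kE.
have m0 := mass_ge0 mE.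
have il := improved_hardy_le c1 c2 b1 b2 k1 k2 d0 s0 sD vE kE mE t0 K0 L0 th0 mh h0 hh.
have fl := fourier_mass_le c1 c2 b1 b2 k1 k2 mE.
rewrite -lee_fin; apply: (le_trans (lq_bound c1 c2 b1 b2 k1 k2 q2' t0 tq)).
apply: (@le_trans _ _ ((lq_const d q t)%:E *
    ((2 `^ t)%:E * ((P * m)%:E + (P * ((C^-1 * k - v + L * m) / K))%:E)))%E).
  apply: lee_wpmul2l; first by rewrite lee_fin ltW.
  apply: (le_trans (fourier_weight_le c1 c2 b1 b2 k1 k2 t0)).
  apply: lee_wpmul2l; first by rewrite lee_fin powR_ge0.
  exact: leeD.
rewrite -EFinM lee_fin.
have -> : lq_const d q t * (2 `^ t * (P * m + P * ((C^-1 * k - v + L * m) / K))) =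
  c * (m + C^-1 / K * (k - C * v) + L / K * m).
  by rewrite /c; field; rewrite !gt_eqF.
rewrite /C' -(mulrA c) ler_pM2l//.
have hm : 0 <= k - C * v by rewrite subr_ge0.
have := mulr_ge0 CK m0; have := mulr_ge0 LK hm.
lra.
Qed.
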